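(* Let $T_0$ and $T_1$ be two contractions on a Hilbert space $\mathcal{H}$, at least one of which is strict, such that $T_1-T_0\in\mathcal{S}_2(\mathcal{H})$. Then for each Lipschitz function $f:\mathbb{T}\to\mathbb{C}$ and every $X\in\mathcal{S}_2(\mathcal{H})$, $$(f(T_1)-f(T_0))X\in\mathcal{S}_1(\mathcal{H}).$$ Moreover, for each $X\in\mathcal{S}_2(\mathcal{H})$ there exists a function $\eta=\eta_{T_0,T_1,X}\in L^1([0,2\pi])$, unique up to an additive constant, such that $$\operatorname{Tr}\big[(f(T_1)-f(T_0))X\big]=\int_0^{2\pi}\frac{d}{dt}f(e^{it})\,\eta(t)\,dt$$ for every $f\in C^1(\mathbb{T})$.
   Context: $\mathbb{T}$ is the unit circle. $\mathcal{S}_p(\mathcal{H})$ denotes the Schatten $p$-class. A contraction is an operator $T\in\mathcal{B}(\mathcal{H})$ with $\|T\|\le1$; it is strict if $\|T\|<1$. Functional calculus: a unitary dilation of a contraction $T$ on $\mathcal{H}$ is a unitary operator $U_T$ on a Hilbert space $\mathcal{K}\supset\mathcal{H}$ ($\mathcal{H}$ a closed subspace) with $T^n=P_{\mathcal{H}}U_T^n|_{\mathcal{H}}$ for all $n\in\mathbb{Z}$, where $T^{-|n|}=(T^* )^{|n|}$ and $P_{\mathcal{H}}$ is the orthogonal projection of $\mathcal{K}$ onto $\mathcal{H}$. For $f\in C(\mathbb{T})$, $f(T):=P_{\mathcal{H}}f(U_T)|_{\mathcal{H}}$ with $f(U_T)$ given by the continuous functional calculus; this does not depend on the choice of the unitary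 dilation. *)

(* Defs.v *)
From HB Require Import structures.
From mathcomp Require Import all_boot all_order all_algebra.
From mathcomp Require Import all_classical all_reals all_analysis.
From mathcomp Require Import complex.
From mathcomp.analysis.showcase Require summability.

Set Implicit Arguments.
Unset Strict Implicit.
Unset Printing Implicit Defensive.

Import Order.TTheory GRing.Theory Num.Theory.
Import numFieldNormedType.Exports.

Local Open Scope classical_set_scope.
Local Open Scope ring_scope.
Local Open Scope complex_scope.

(* No separability or dimension assumption; [hdot] is linear on the left and
   conjugate-linear on the right. *)
Record hilbertType (R : realType) := Hilbert {
  hcarrier :> completeNormedModType R[i];
  hdot : {dot hcarrier for @Num.conj R[i]};
  hdot_norm : forall x : hcarrier, hdot x x = `|x| ^+ 2 }.

Arguments hdot {R h}.

Section operators.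
Context {R : realType}.
Implicit Types H K : hilbertType R.

Definition bounded_linear H K (A : H -> K) : Prop :=
  linear A /\ exists M : R, forall x, `|A x| <= M%:C * `|x|.

Definition opnorm H K (A : H -> K) : R :=
  inf [set M : R | 0 <= M /\ forall x, `|A x| <= M%:C * `|x|].

Definition is_contraction_op H (T : H -> H) : Prop :=
  bounded_linear T /\ opnorm T <= 1.

Definition is_strict_contraction_op H (T : H -> H) : Prop :=
  bounded_linear T /\ opnorm T < 1.

(* The Hilbert-space adjoint (junk value 0 if there is none, which does not
   happen for bounded linear [A]). *)
Definition adj H K (A : H -> K) : K -> H :=
  xget (fun=> 0) [set B | forall x y, hdot (A x) y = hdot x (B y)].

Definition is_isometry H K (V : H -> K) : Prop :=
  linear V /\ forall x y, hdot (V x) (V y) = hdot x y.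

Definition is_unitary_op K (U : K -> K) : Prop :=
  [/\ bounded_linear U, cancel U (adj U) & cancel (adj U) U].

(* [T ^ n] for [n >= 0] and [(T^* ) ^ |n|] for [n < 0]; for a unitary operator
   these are the usual integer powers. *)
Definition zpower H (T : H -> H) (n : int) : H -> H :=
  match n with Posz k => iter k T | Negz k => iter k.+1 (adj T) end.

(* [H] sits in [K] as the closed subspace [range V]; the orthogonal projection
   onto it, read as a map [K -> H], is then [adj V]. *)
Definition unitary_dilation H (T : H -> H) K (V : H -> K) (U : K -> K) : Prop :=
  [/\ is_isometry V, is_unitary_op U
    & forall n : int, zpower T n = adj V \o zpower U n \o V].

End operators.

Section schatten.
Context {R : realType} {H : hilbertType R}.

(* The canonical (Schmidt) expansion A = \sum_n s_n <., e_n> f_n, in which [s]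
   is the nonincreasing sequence of singular values of [A], repeated according
   to multiplicity. The orthonormal vectors are only relevant where
   [s n != 0], so that operators of finite rank are covered. *)
Definition singular_value_expansion (A : H -> H) (s : R^nat)
    (e f : nat -> H) : Prop :=
  [/\ nonincreasing_seq s, forall n, 0 <= s n,
      forall m n, s m != 0 -> s n != 0 ->
        hdot (e m) (e n) = (m == n)%:R /\ hdot (f m) (f n) = (m == n)%:R
    & forall x, series (fun n => ((s n)%:C * hdot x (e n)) *: f n) @ \oo
                --> A x].

(* Summability of the [s n `^ p] forces [s n --> 0], hence compactness. *)
Definition schatten (p : R) (A : H -> H) : Prop :=
  bounded_linear A /\
  exists s e f, singular_value_expansion A s e f /\
    cvgn (series (fun n => s n `^ p)).

Definition orthonormal_basis (I : choiceType) (e : I -> H) : Prop :=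
  (forall i j, hdot (e i) (e j) = (i == j)%:R) /\
  (forall x, (forall i, hdot x (e i) = 0) -> x = 0).

(* [H] need not be separable: the sum of the diagonal entries is unconditional,
   along the filter of finite subsets of the index set. For trace class [A] it
   exists and is the same for all bases. *)
Definition trace (A : H -> H) : R[i] :=
  xget 0 [set t : R[i] | exists (I : choiceType) (e : I -> H),
    orthonormal_basis e /\
    summability.partial_sum (fun i => hdot (A (e i)) (e i) : R[i]^o)
      @ @summability.totally I --> (t : R[i]^o)].

End schatten.

(* Functions on the unit circle are represented by maps [R[i] -> R[i]] whose
   values off the circle are irrelevant. *)
Section circle.
Context {R : realType}.

Definition circle : set R[i]^o := [set z | `|z| = 1].

Definition continuous_circle (f : R[i] -> R[i]) : Prop :=
  {within circle, continuous (f : R[i]^o -> R[i]^o)}.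

Definition lipschitz_circle (f : R[i] -> R[i]) : Prop :=
  [lipschitz (f : R[i]^o -> R[i]^o) z | z in circle].

Definition expi (t : R) : R[i] := cos t +i* sin t.

Definition cderivable (g : R -> R[i]) (t : R) : Prop :=
  derivable (fun s => complex.Re (g s)) t 1 /\
  derivable (fun s => complex.Im (g s)) t 1.

Definition cderive (g : R -> R[i]) (t : R) : R[i] :=
  derive1 (fun s => complex.Re (g s)) t +i* derive1 (fun s => complex.Im (g s)) t.

Definition C1_circle (f : R[i] -> R[i]) : Prop :=
  [/\ forall t, cderivable (f \o expi) t,
      continuous (fun t => complex.Re (cderive (f \o expi) t))
    & continuous (fun t => complex.Im (cderive (f \o expi) t))].

Definition cintegrable (D : set R) (g : R -> R[i]) : Prop :=
  (@lebesgue_measure R).-integrable D (fun t => (complex.Re (g t))%:E) /\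
  (@lebesgue_measure R).-integrable D (fun t => (complex.Im (g t))%:E).

Definition cintegral (D : set R) (g : R -> R[i]) : R[i] :=
  Rintegral (@lebesgue_measure R) D (fun t => complex.Re (g t)) +i*
  Rintegral (@lebesgue_measure R) D (fun t => complex.Im (g t)).

End circle.

Section functional_calculus.
Context {R : realType}.

(* [Phi] is a unital *-homomorphism from C(circle) to the bounded operators on
   [K] that maps the coordinate function to [U]. For unitary [U] there is exactly
   one (automatically contractive): the continuous functional calculus of [U]. *)
Definition continuous_calculus (K : hilbertType R) (U : K -> K)
    (Phi : (R[i] -> R[i]) -> K -> K) : Prop :=
  (forall f, continuous_circle f -> bounded_linear (Phi f)) /\
  (forall f g, continuous_circle f -> continuous_circle g ->
    (forall z, circle z -> f z = g z) -> Phi f = Phi g) /\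
  Phi (fun=> 1) = id /\
  Phi id = U /\
  (forall (a : R[i]) f g, continuous_circle f -> continuous_circle g ->
    Phi (fun z => a * f z + g z) = fun x => a *: Phi f x + Phi g x) /\
  (forall f g, continuous_circle f -> continuous_circle g ->
    Phi (fun z => f z * g z) = Phi f \o Phi g) /\
  (forall f, continuous_circle f ->
    Phi (fun z => Num.conj (f z)) = adj (Phi f)).

Definition unitary_calculus (K : hilbertType R) (U : K -> K)
    (f : R[i] -> R[i]) : K -> K :=
  xget (fun=> 0) [set B | exists Phi, continuous_calculus U Phi /\ B = Phi f].

Definition contraction_calculus (H : hilbertType R) (T : H -> H)
    (f : R[i] -> R[i]) : H -> H :=
  xget (fun=> 0) [set A | exists (K : hilbertType R) (V : H -> K) (U : K -> K),
    unitary_dilation T V U /\ A = adj V \o unitary_calculus U f \o V].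

End functional_calculus.

Section trace_formula.
Context {R : realType} {H : hilbertType R}.

Definition trace_formula (T0 T1 X : H -> H) (eta : R -> R[i]) : Prop :=
  forall f : R[i] -> R[i], C1_circle f ->
    trace ((contraction_calculus T1 f \- contraction_calculus T0 f) \o X) =
    cintegral `[0, 2 * pi] (fun t => cderive (f \o expi) t * eta t).

End trace_formula.

(* Main.v *)
From HB Require Import structures.
Require Import Defs.
From mathcomp Require Import all_boot all_order all_algebra finmap.
From mathcomp Require Import all_classical all_reals all_analysis.
From mathcomp Require Import complex ring lra measurable_realfun.
From mathcomp.analysis.showcase Require summability.

(** Powers first. If T0 or T1 has norm r < 1 and T1 - T0 has Hilbert-Schmidt
    norm at most d, then all differences T1^n - T0^n, and those of the adjoints,
    have Hilbert-Schmidt norm at most d/(1 - r): telescope the difference and sum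
    a geometric series ([zpower_diff_hs]).

    A Lipschitz function f on the circle is a uniform limit of trigonometric
    polynomials for which the sum of the moduli of the nonconstant coefficients
    is bounded by a multiple of the Lipschitz constant ([alip_approx], from a
    discrete Bernstein inequality and Fejér means). As the functional calculus is
    contractive for the sup norm, f(T1) - f(T0) is a pointwise limit of operators
    bounded in Hilbert-Schmidt norm, hence a Hilbert-Schmidt operator itself,
    with norm controlled by the Lipschitz constant ([cdiff_hs]). The product of
    two Hilbert-Schmidt operators is of trace class ([hs_comp_schatten1]), and
    this is the first claim.

    With X = sum_n s_n <., e_n> f_n, the trace of A X in every orthonormal basis
    is sum_n s_n <A f_n, e_n> ([traceE]), so it is bounded by the product of the
    Hilbert-Schmidt norms of A and X ([trace_bound]). Therefore the functional
    Tr ((f(T1) - f(T0)) X) is bounded by the Lipschitz constant of f. Its values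
    a_k at the monomials z^k are bounded and a_0 = 0, and the density is
    eta = sum over k <> 0 of a_k/(2 pi i k) exp(-i k t). The coefficients are
    square-summable; eta is constructed as an almost everywhere limit of lacunary
    partial sums ([L1_limit], [exists_density]). By construction the trace
    formula holds for trigonometric polynomials. Both of its sides are controlled
    by the sup norm of the derivative of f, and the derivative of a C1 function
    is a uniform limit of trigonometric polynomials of mean zero; this gives the
    formula for all C1 functions ([trace_angle_derivative]).

    For uniqueness, the trace formula at z^k determines the nonconstant Fourier
    coefficients of the density, and an integrable function all of whose
    nonconstant coefficients vanish is almost everywhere constant
    ([fourier_const]).

    The functional calculi are made explicit in the same spirit. Every
    contraction has a unitary dilation, given by Schäffer's matrix
    ([exists_dilation]). The continuous calculus of a unitary U is the limit of
    the Fejér means of f evaluated at U ([calc_is_calculus], [calculus_uniq]),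
    and the density of trigonometric polynomials ([functional_ext]) shows that
    the compression to the original space does not depend on the dilation
    ([contraction_calculusE]). *)

Set Implicit Arguments.
Unset Strict Implicit.
Unset Printing Implicit Defensive.

Import Order.TTheory GRing.Theory Num.Theory.
Import numFieldNormedType.Exports.

Local Open Scope classical_set_scope.
Local Open Scope ring_scope.
Local Open Scope complex_scope.

(** * Real-valued norms and inner products *)

Section RealNorm.
Context {R : realType}.
Local Notation C := R[i].

(** Norms in the structures at hand are complex numbers; estimates are carried
    out with their real parts, to which real arithmetic applies. *)
Definition nrm (V : normedZmodType C) (x : V) : R := complex.Re `|x|.

Lemma nrmE (V : normedZmodType C) (x : V) : `|x| = (nrm x)%:C.
Proof. by rewrite /nrm RRe_real// normr_real. Qed.

Lemma nrm_ge0 (V : normedZmodType C) (x : V) : 0 <= nrm x.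
Proof. by rewrite -lecR -nrmE normr_ge0. Qed.

Lemma nrm0 (V : normedZmodType C) : nrm (0 : V) = 0.
Proof. by rewrite /nrm normr0. Qed.

Lemma nrm_eq0 (V : normedZmodType C) (x : V) : nrm x = 0 -> x = 0.
Proof. by move=> h; apply/eqP; rewrite -normr_eq0 nrmE h. Qed.

Lemma nrmN (V : normedZmodType C) (x : V) : nrm (- x) = nrm x.
Proof. by rewrite /nrm normrN. Qed.

Lemma nrmB (V : normedZmodType C) (x y : V) : nrm (x - y) = nrm (y - x).
Proof. by rewrite /nrm distrC. Qed.

Lemma nrmD (V : normedZmodType C) (x y : V) : nrm (x + y) <= nrm x + nrm y.
Proof. by rewrite -lecR rmorphD/= -!nrmE ler_normD. Qed.

Lemma nrm_sum (V : normedZmodType C) I (r : seq I) (P : pred I) (F : I -> V) :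
  nrm (\sum_(i <- r | P i) F i) <= \sum_(i <- r | P i) nrm (F i).
Proof.
elim/big_rec2: _ => [|i y x _ h]; first by rewrite nrm0.
by rewrite (le_trans (nrmD _ _))// lerD2l.
Qed.

Lemma nrm_tri (V : normedZmodType C) (x y z : V) :
  nrm (x - z) <= nrm (x - y) + nrm (y - z).
Proof. by rewrite -(subrKA y) nrmD. Qed.

Lemma nrm_rev (V : normedZmodType C) (x y : V) : nrm x - nrm y <= nrm (x - y).
Proof. by rewrite lerBlDr -{1}(subrK y x) nrmD. Qed.

Lemma nrmZ (V : normedModType C) (a : C) (x : V) : nrm (a *: x) = nrm a * nrm x.
Proof. by rewrite /nrm normrZ !nrmE/= !mul0r subr0. Qed.

Lemma nrmM (a b : C) : nrm (a * b) = nrm a * nrm b.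
Proof. by rewrite /nrm normrM !nrmE/= !mul0r subr0. Qed.

Lemma nrm1 : nrm (1 : C) = 1.
Proof. by rewrite /nrm normr1. Qed.

Lemma nrmX (a : C) n : nrm (a ^+ n) = nrm a ^+ n.
Proof. by elim: n => [|n ih]; rewrite ?expr0 ?nrm1// !exprS nrmM ih. Qed.

Lemma nrmV (a : C) : nrm (a^-1) = (nrm a)^-1.
Proof.
have [->|a0] := eqVneq a 0; first by rewrite invr0 nrm0 invr0.
have na0 : nrm a != 0 by apply: contra_neq a0; apply: nrm_eq0.
by apply: (mulfI na0); rewrite -nrmM !divff// nrm1.
Qed.

Lemma nrm_real (a : R) : nrm (a%:C) = `|a|.
Proof. by rewrite /nrm normc_def /= expr0n addr0 sqrtr_sqr. Qed.

Lemma nrm_ger0 (a : R) : 0 <= a -> nrm (a%:C) = a.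
Proof. by move=> ?; rewrite nrm_real ger0_norm. Qed.

Lemma nrm_nat n : nrm (n%:R : C) = n%:R.
Proof. by rewrite /nrm normr_nat -(rmorph_nat (real_complex R)). Qed.

Lemma nrm_conj (a : C) : nrm (Num.conj a) = nrm a.
Proof. by rewrite /nrm norm_conjC. Qed.

Lemma conjE (a : C) : Num.conj a = conjc a.
Proof. by []. Qed.

Lemma conj_real (a : R) : Num.conj (a%:C : C) = a%:C.
Proof. by rewrite conjE conjc_real. Qed.

Lemma nrmK (a : C) : a * Num.conj a = (nrm a ^+ 2)%:C.
Proof. by rewrite -normCK nrmE rmorphXn. Qed.

Lemma nrm_sqE (a : C) : nrm a ^+ 2 = complex.Re a ^+ 2 + complex.Im a ^+ 2.
Proof. by apply: complexI; rewrite add_Re2_Im2 nrmE rmorphXn. Qed.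

Lemma Re_le_nrm (a : C) : complex.Re a <= nrm a.
Proof.
have [h|h] := leP (complex.Re a) 0; first by rewrite (le_trans h) ?nrm_ge0.
rewrite -(@ler_pXn2r _ 2) ?nnegrE ?nrm_ge0 ?(ltW h)// nrm_sqE.
by rewrite lerDl sqr_ge0.
Qed.

Lemma nrm_le_ReIm (a : C) : nrm a <= `|complex.Re a| + `|complex.Im a|.
Proof.
rewrite -(ler_pXn2r (_ : 0 < 2)%N) ?nnegrE ?nrm_ge0 ?addr_ge0//.
rewrite nrm_sqE -(real_normK (num_real (complex.Re a))).
rewrite -(real_normK (num_real (complex.Im a))) sqrrD.
by rewrite lerD2r lerDl mulrn_wge0// mulr_ge0.
Qed.

Lemma normRe_le (a : C) : `|complex.Re a| <= nrm a.
Proof.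
rewrite -(ler_pXn2r (_ : 0 < 2)%N) ?nnegrE ?nrm_ge0// real_normK ?num_real//.
by rewrite nrm_sqE lerDl sqr_ge0.
Qed.

Lemma normIm_le (a : C) : `|complex.Im a| <= nrm a.
Proof.
rewrite -(ler_pXn2r (_ : 0 < 2)%N) ?nnegrE ?nrm_ge0// real_normK ?num_real//.
by rewrite nrm_sqE lerDr sqr_ge0.
Qed.

End RealNorm.

Section HilbertAlgebra.
Context {R : realType} {H : hilbertType R}.
Local Notation C := R[i].
Implicit Types (x y z : H) (a : C).

Lemma hdotDl x y z : hdot (x + y) z = hdot x z + hdot y z.
Proof. exact: linearDl. Qed.
Lemma hdotDr x y z : hdot z (x + y) = hdot z x + hdot z y.
Proof. exact: linearDr. Qed.
Lemma hdotZl a x y : hdot (a *: x) y = a * hdot x y.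
Proof. exact: linearZl_LR. Qed.
Lemma hdotZr a x y : hdot x (a *: y) = Num.conj a * hdot x y.
Proof. exact: linearZr_LR. Qed.
Lemma hdotC x y : hdot x y = Num.conj (hdot y x).
Proof. by rewrite (@hermC _ _ _ H) expr0 mul1r. Qed.
Lemma hdot0l y : hdot 0 y = 0. Proof. exact: linear0l. Qed.
Lemma hdot0r y : hdot y 0 = 0. Proof. exact: linear0r. Qed.
Lemma hdotNl x y : hdot (- x) y = - hdot x y. Proof. exact: linearNl. Qed.
Lemma hdotNr x y : hdot x (- y) = - hdot x y. Proof. exact: linearNr. Qed.
Lemma hdotBl x y z : hdot (x - y) z = hdot x z - hdot y z.
Proof. by rewrite hdotDl hdotNl. Qed.
Lemma hdotBr x y z : hdot z (x - y) = hdot z x - hdot z y.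
Proof. by rewrite hdotDr hdotNr. Qed.
Lemma hdot_suml I (r : seq I) (P : pred I) (F : I -> H) y :
  hdot (\sum_(i <- r | P i) F i) y = \sum_(i <- r | P i) hdot (F i) y.
Proof. by elim/big_rec2: _ => [|i u v _ <-]; rewrite ?hdot0l// hdotDl. Qed.
Lemma hdot_sumr I (r : seq I) (P : pred I) (F : I -> H) y :
  hdot y (\sum_(i <- r | P i) F i) = \sum_(i <- r | P i) hdot y (F i).
Proof. by elim/big_rec2: _ => [|i u v _ <-]; rewrite ?hdot0r// hdotDr. Qed.

Lemma hdot_nrm x : hdot x x = (nrm x ^+ 2)%:C.
Proof. by rewrite hdot_norm nrmE rmorphXn. Qed.

Lemma nrmD_sq x y :
  nrm (x + y) ^+ 2 = nrm x ^+ 2 + nrm y ^+ 2 + 2 * complex.Re (hdot x y).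
Proof.
apply: complexI; rewrite -hdot_nrm hdotDl !hdotDr !hdot_nrm (hdotC y x).
by apply/eqP; rewrite eq_complex; apply/andP; split; apply/eqP => /=;
  case: (hdot x y) => u v /=; ring.
Qed.

Lemma nrmB_sq x y :
  nrm (x - y) ^+ 2 = nrm x ^+ 2 + nrm y ^+ 2 - 2 * complex.Re (hdot x y).
Proof. by rewrite nrmD_sq nrmN hdotNr raddfN/= mulrN. Qed.

Lemma parallelogram x y :
  nrm (x + y) ^+ 2 + nrm (x - y) ^+ 2 = 2 * (nrm x ^+ 2 + nrm y ^+ 2).
Proof. by rewrite nrmD_sq nrmB_sq; ring. Qed.

(** The squared norm of x minus its orthogonal projection onto the line of y
    is nonnegative. *)
Lemma hdot_CS x y : nrm (hdot x y) <= nrm x * nrm y.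
Proof.
have [->|y0] := eqVneq y 0; first by rewrite hdot0r !nrm0 mulr0.
have ny : 0 < nrm y.
  by rewrite lt_def nrm_ge0 andbT; apply: contra_neq y0; apply: nrm_eq0.
set d := hdot x y.
have : 0 <= nrm (x - (d / (nrm y ^+ 2)%:C) *: y) ^+ 2 by rewrite sqr_ge0.
rewrite nrmB_sq nrmZ hdotZr nrmM nrmV nrm_ger0 ?sqr_ge0//.
have -> : complex.Re (Num.conj (d / (nrm y ^+ 2)%:C) * d) = nrm d ^+ 2 / nrm y ^+ 2.
  by rewrite -fmorphV rmorphM/= conj_real mulrAC (mulrC _ d) nrmK -rmorphM.
move=> h; rewrite -(ler_pXn2r (_ : 0 < 2)%N) ?nnegrE ?mulr_ge0 ?nrm_ge0//.
rewrite exprMn -ler_pdivrMr ?exprn_gt0//.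
move: h; have -> : (nrm d / nrm y ^+ 2 * nrm y) ^+ 2 = nrm d ^+ 2 / nrm y ^+ 2.
  by field; rewrite gt_eqF.
lra.
Qed.

Lemma hdot_sep x y : (forall z, hdot x z = hdot y z) -> x = y.
Proof.
move=> h; apply/eqP; rewrite -subr_eq0; apply/eqP/nrm_eq0.
have := hdot_nrm (x - y); rewrite {1}hdotBl h subrr => /(congr1 (@complex.Re R))/=.
by move/esym/eqP; rewrite expf_eq0/= => /eqP.
Qed.

Lemma hdot_sepr x y : (forall z, hdot z x = hdot z y) -> x = y.
Proof. by move=> h; apply: hdot_sep => z; rewrite hdotC h -hdotC. Qed.

End HilbertAlgebra.

(** * Limits of sequences, bounded operators, projections and adjoints *)

Section Sequences.
Context {R : realType}.
Local Notation C := R[i].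

Lemma invS_small (e : R) : 0 < e -> exists N, forall n, (N <= n)%N -> n.+1%:R^-1 < e.
Proof. by move=> e0; have [N _ h] := near_infty_natSinv_lt (PosNum e0); exists N. Qed.

(** Convergence with real tolerances, the form in which all the limits below
    are handled; [tends_cvg] identifies it with convergence in the topology of
    a normed module. *)
Definition tends (V : normedZmodType C) (u : nat -> V) (l : V) :=
  forall e : R, 0 < e -> exists N, forall n, (N <= n)%N -> nrm (u n - l) < e.

Lemma tends_cvg (V : normedModType C) (u : nat -> V) (l : V) :
  tends u l <-> u @ \oo --> l.
Proof.
split=> [h|/cvgrPdist_lt h e e0].
  apply/cvgrPdist_lt => e e0.
  have ee : e = (complex.Re e)%:C by rewrite RRe_real// gtr0_real.
  have [|N hN] := h (complex.Re e); first by rewrite -ltcR -ee.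
  by exists N => // n /= Nn; rewrite distrC nrmE ee ltcR hN.
have [|N _ hN] := h e%:C; first by rewrite ltcR.
by exists N => n Nn; rewrite -ltcR -nrmE distrC hN.
Qed.

Lemma tends_uniq (V : normedZmodType C) (u : nat -> V) (l l' : V) :
  tends u l -> tends u l' -> l = l'.
Proof.
move=> h h'; apply/eqP; rewrite -subr_eq0; apply/eqP/nrm_eq0/eqP.
rewrite eq_le nrm_ge0 andbT leNgt; apply/negP => d0.
have d2 : 0 < nrm (l - l') / 2 by rewrite divr_gt0.
have [N hN] := h _ d2; have [N' hN'] := h' _ d2.
have := nrm_tri l (u (maxn N N')) l'; rewrite leNgt => /negP; apply.
rewrite [ltRHS]splitr ltrD//; last by rewrite hN' ?leq_maxr.
by rewrite nrmB hN ?leq_maxl.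
Qed.

Lemma tends_cst (V : normedZmodType C) (l : V) : tends (fun=> l) l.
Proof. by move=> e e0; exists 0%N => n _; rewrite subrr nrm0. Qed.

Lemma tends_ext (V : normedZmodType C) (u v : nat -> V) (l : V) :
  u =1 v -> tends u l -> tends v l.
Proof. by move=> /funext ->. Qed.

Lemma tends_near (V : normedZmodType C) (u v : nat -> V) (l : V) N :
  (forall n, (N <= n)%N -> u n = v n) -> tends u l -> tends v l.
Proof.
move=> uv h e /h[N' hN']; exists (maxn N N') => n.
by rewrite geq_max => /andP[Nn N'n]; rewrite -uv// hN'.
Qed.

Lemma tendsD (V : normedZmodType C) (u v : nat -> V) (l m : V) :
  tends u l -> tends v m -> tends (fun n => u n + v n) (l + m).
Proof.
move=> h h' e e0; have e2 : 0 < e / 2 by rewrite divr_gt0.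
have [N hN] := h _ e2; have [N' hN'] := h' _ e2.
exists (maxn N N') => n; rewrite geq_max => /andP[Nn N'n].
by rewrite opprD addrACA (le_lt_trans (nrmD _ _))// [ltRHS]splitr ltrD ?hN ?hN'.
Qed.

Lemma tendsN (V : normedZmodType C) (u : nat -> V) (l : V) :
  tends u l -> tends (fun n => - u n) (- l).
Proof.
by move=> h e /h[N hN]; exists N => n Nn; rewrite -opprD nrmN hN.
Qed.

Lemma tendsB (V : normedZmodType C) (u v : nat -> V) (l m : V) :
  tends u l -> tends v m -> tends (fun n => u n - v n) (l - m).
Proof. by move=> h /tendsN; exact: tendsD. Qed.

Lemma tends_dom (V : normedZmodType C) (u : nat -> V) (l : V) (M : R)
    (W : normedZmodType C) (v : nat -> W) (m : W) :
  (forall n, nrm (u n - l) <= M * nrm (v n - m)) -> tends v m -> tends u l.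
Proof.
move=> h hv e e0; have M1 : 0 < `|M| + 1 by rewrite ltr_wpDl.
have [N hN] := hv (e / (`|M| + 1)) (divr_gt0 e0 M1).
exists N => n Nn; rewrite (le_lt_trans (h n))//.
rewrite (@le_lt_trans _ _ ((`|M| + 1) * nrm (v n - m)))//.
  by rewrite ler_wpM2r ?nrm_ge0// ler_wpDr// ler_norm.
by rewrite mulrC -ltr_pdivlMr// hN.
Qed.

Lemma tendsZ (V : normedModType C) (a : C) (u : nat -> V) (l : V) :
  tends u l -> tends (fun n => a *: u n) (a *: l).
Proof. by apply: (@tends_dom _ _ _ (nrm a)) => n; rewrite -scalerBr nrmZ. Qed.

Lemma tendsMl (a : C) (u : nat -> C) (l : C) :
  tends u l -> tends (fun n => a * u n) (a * l).
Proof. by apply: (@tends_dom _ _ _ (nrm a)) => n; rewrite -mulrBr nrmM. Qed.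

Lemma tends_conj (u : nat -> C) (l : C) :
  tends u l -> tends (fun n => Num.conj (u n)) (Num.conj l).
Proof. by apply: (@tends_dom _ _ _ 1) => n; rewrite -rmorphB nrm_conj mul1r. Qed.

Lemma tends_sum (V : normedZmodType C) I (r : seq I) (P : pred I) (u : I -> nat -> V) (l : I -> V) :
  (forall i, P i -> tends (u i) (l i)) ->
  tends (fun n => \sum_(i <- r | P i) u i n) (\sum_(i <- r | P i) l i).
Proof.
move=> h; elim: r => [|i r ih].
  by rewrite big_nil; apply: tends_ext (tends_cst _) => n; rewrite big_nil.
rewrite big_cons; case: ifP => Pi.
  by apply: tends_ext (tendsD (h _ Pi) ih) => n; rewrite big_cons Pi.
by apply: tends_ext ih => n; rewrite big_cons Pi.
Qed.

Lemma tends_shift (V : normedZmodType C) (u : nat -> V) (l : V) :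
  tends u l -> tends (fun n => u n.+1) l.
Proof. by move=> h e /h[N hN]; exists N => n Nn; rewrite hN// leqW. Qed.

Lemma tends_nrm_le (V : normedZmodType C) (u : nat -> V) (l x : V) (M : R) N :
  tends u l -> (forall n, (N <= n)%N -> nrm (u n - x) <= M) -> nrm (l - x) <= M.
Proof.
move=> h hM; apply/ler_addgt0Pr => e /h[N' hN'].
have Nm : (N <= maxn N N')%N by rewrite leq_maxl.
rewrite (le_trans (nrm_tri l (u (maxn N N')) x))// addrC lerD//; first exact: hM.
by rewrite nrmB ltW// hN' ?leq_maxr.
Qed.

Lemma tends_bound (V : normedZmodType C) (u : nat -> V) (l : V) (M : R) N :
  tends u l -> (forall n, (N <= n)%N -> nrm (u n) <= M) -> nrm l <= M.
Proof.
move=> h hM; rewrite -(subr0 l); apply: (tends_nrm_le h (N:=N)) => n.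
by rewrite subr0; exact: hM.
Qed.

Definition ccauchy (V : normedZmodType C) (u : nat -> V) :=
  forall e : R, 0 < e -> exists N, forall n m, (N <= n)%N -> (N <= m)%N ->
    nrm (u n - u m) < e.

Lemma ccauchy_tends (V : completeNormedModType C) (u : nat -> V) :
  ccauchy u -> exists l, tends u l.
Proof.
move=> h.
suff /cauchy_cvg uc : cauchy (u @ \oo) by exists (lim (u @ \oo)); apply/tends_cvg.
apply: cauchy_exP => e e0.
have ee : e = (complex.Re e)%:C by rewrite RRe_real// gtr0_real.
have [|N hN] := h (complex.Re e); first by rewrite -ltcR -ee.
exists (u N), N => // n /= Nn.
by rewrite -ball_normE/= nrmE ee ltcR hN.
Qed.

Lemma tends_ccauchy (V : normedZmodType C) (u : nat -> V) l :
  tends u l -> ccauchy u.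
Proof.
move=> h e e0; have e2 : 0 < e / 2 by rewrite divr_gt0.
have [N hN] := h _ e2; exists N => n m Nn Nm.
rewrite (le_lt_trans (nrm_tri _ l _))// [ltRHS]splitr ltrD ?hN//.
by rewrite nrmB hN.
Qed.

End Sequences.

Section Operators.
Context {R : realType}.
Local Notation C := R[i].
Implicit Types H K L : hilbertType R.

(** Quantitative boundedness: the bound M is an explicit argument and need not
    be the operator norm, so that bounds can be combined without computing
    infima. *)
Definition opb H K (A : H -> K) (M : R) :=
  [/\ linear A, 0 <= M & forall x, nrm (A x) <= M * nrm x].

Section lin.
Context {H K : hilbertType R} (A : H -> K) (lA : linear A).
Lemma lin0 : A 0 = 0.
Proof. by have := lA (-1) 0 0; rewrite scaler0 addr0 scaleN1r addNr. Qed.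
Lemma linDD x y : A (x + y) = A x + A y.
Proof. by have := lA 1 x y; rewrite !scale1r. Qed.
Lemma linZZ a x : A (a *: x) = a *: A x.
Proof. by have := lA a x 0; rewrite !addr0 lin0 addr0. Qed.
Lemma linNN x : A (- x) = - A x.
Proof. by rewrite -scaleN1r linZZ scaleN1r. Qed.
Lemma linBB x y : A (x - y) = A x - A y.
Proof. by rewrite linDD linNN. Qed.
Lemma lin_sum I (r : seq I) (P : pred I) (F : I -> H) :
  A (\sum_(i <- r | P i) F i) = \sum_(i <- r | P i) A (F i).
Proof. by elim/big_rec2: _ => [|i u v _ <-]; rewrite ?lin0// linDD. Qed.
End lin.

Lemma bounded_linearP H K (A : H -> K) : bounded_linear A <-> exists M, opb A M.
Proof.
split=> [[lA [M hM]]|[M [lA M0 hM]]].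
  exists (Num.max M 0); split; rewrite ?le_max ?lexx ?orbT// => x.
  apply: (@le_trans _ _ (M * nrm x)).
    by rewrite -lecR -nrmE rmorphM/= -nrmE hM.
  by rewrite ler_wpM2r ?nrm_ge0// le_max lexx.
split=> //; exists M => x; rewrite !nrmE -rmorphM lecR; exact: hM.
Qed.

(** The infimum defining the operator norm is attained: for fixed nonzero x
    all admissible bounds are at least the ratio of norms at x, hence so is
    their infimum. *)
Lemma opnorm_opb H K (A : H -> K) : bounded_linear A -> opb A (opnorm A).
Proof.
move=> /bounded_linearP[M [lA M0 hM]].
have ne : [set M : R | 0 <= M /\ forall x, `|A x| <= M%:C * `|x|] M.
  by split=> // x; rewrite !nrmE -rmorphM lecR; exact: hM.
have h0 : 0 <= opnorm A by apply: lb_le_inf; [exists M | move=> y []].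
split=> // x; have [/eqP|nx0] := eqVneq (nrm x) 0.
  by move=> /eqP/nrm_eq0 ->; rewrite lin0// !nrm0 mulr0.
have nx : 0 < nrm x by rewrite lt_def nx0 nrm_ge0.
rewrite -ler_pdivrMr//; apply: lb_le_inf; first by exists M.
move=> y [y0 hy]; rewrite ler_pdivrMr// -lecR -nrmE rmorphM/= -nrmE; exact: hy.
Qed.

Lemma opb_le H K (A : H -> K) M N : M <= N -> opb A M -> opb A N.
Proof.
move=> MN [lA M0 hA]; split=> //; first exact: le_trans MN.
by move=> x; rewrite (le_trans (hA x))// ler_wpM2r ?nrm_ge0.
Qed.

Lemma opb_comp H K L (A : K -> L) (B : H -> K) M N :
  opb A M -> opb B N -> opb (A \o B) (M * N).
Proof.
move=> [lA M0 hA] [lB N0 hB]; split; rewrite ?mulr_ge0//.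
  by move=> a x y /=; rewrite lB lA.
by move=> x /=; rewrite (le_trans (hA _))// -mulrA ler_wpM2l.
Qed.

Lemma opb_id H : opb (@id H) 1.
Proof. by split=> // x; rewrite mul1r. Qed.

Lemma opb_iter H (A : H -> H) M n : opb A M -> opb (iter n A) (M ^+ n).
Proof.
move=> hA; elim: n => [|n ih]; first exact: opb_id.
by rewrite exprS; exact: (opb_comp hA ih).
Qed.

Lemma opbD H K (A B : H -> K) M N :
  opb A M -> opb B N -> opb (fun x => A x + B x) (M + N).
Proof.
move=> [lA M0 hA] [lB N0 hB]; split; rewrite ?addr_ge0//.
  by move=> a x y /=; rewrite lB lA scalerDr addrACA.
by move=> x /=; rewrite mulrDl (le_trans (nrmD _ _))// lerD.
Qed.

Lemma opbZ H K (A : H -> K) M (a : C) :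
  opb A M -> opb (fun x => a *: A x) (nrm a * M).
Proof.
move=> [lA M0 hA]; split; rewrite ?mulr_ge0 ?nrm_ge0//.
  by move=> b x y /=; rewrite lA scalerDr !scalerA mulrC.
by move=> x /=; rewrite nrmZ -mulrA ler_wpM2l ?nrm_ge0.
Qed.

Lemma opbN H K (A : H -> K) M : opb A M -> opb (fun x => - A x) M.
Proof.
move=> [lA M0 hA]; split=> //; last by move=> x; rewrite nrmN.
by move=> b x y /=; rewrite lA opprD scalerN.
Qed.

Lemma opbB H K (A B : H -> K) M N :
  opb A M -> opb B N -> opb (fun x => A x - B x) (M + N).
Proof. by move=> hA /opbN; exact: opbD. Qed.

Lemma opb0 H K : opb (fun _ : H => 0 : K) 0.
Proof.
by split=> [a x y| |x]; rewrite ?scaler0 ?addr0 ?nrm0 ?mul0r.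
Qed.

Lemma tends_opb H K (A : H -> K) M (u : nat -> H) l :
  opb A M -> tends u l -> tends (fun n => A (u n)) (A l).
Proof. by case=> lA _ hA; apply: (@tends_dom _ _ _ _ M) => n; rewrite -linBB. Qed.

Lemma opb_tends H K (A : nat -> H -> K) (B : H -> K) M N :
  (forall n, (N <= n)%N -> opb (A n) M) -> (forall x, tends (fun n => A n x) (B x)) -> opb B M.
Proof.
move=> hA hB; have [_ M0 _] := hA N (leqnn _); split=> //.
  move=> a x y; apply: (tends_uniq (hB _)).
  apply: (@tends_near _ _ (fun n => a *: A n x + A n y) _ _ N).
    by move=> n /hA[lA _ _]; rewrite lA.
  by apply: tendsD; [apply: tendsZ|]; exact: hB.
by move=> x; apply: (tends_bound (hB x) (N := N)) => n /hA[].
Qed.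

Lemma tends_hdotl H (u : nat -> H) l y :
  tends u l -> tends (fun n => hdot (u n) y) (hdot l y).
Proof.
apply: (@tends_dom _ _ _ _ (nrm y)) => n.
by rewrite -hdotBl mulrC hdot_CS.
Qed.

Lemma tends_hdotr H (u : nat -> H) l y :
  tends u l -> tends (fun n => hdot y (u n)) (hdot y l).
Proof. by apply: (@tends_dom _ _ _ _ (nrm y)) => n; rewrite -hdotBr hdot_CS. Qed.

End Operators.

Section Projection.
Context {R : realType} {H : hilbertType R}.
Local Notation C := R[i].

(** A minimising sequence for the distance from y to the subspace S is Cauchy
    by the parallelogram law. As S is merely a subspace, the limit z lies in
    its closure, and minimality of the distance makes y - z orthogonal to S.
    *)
Lemma projection (S : set H) (y : H) :
  S 0 -> (forall (a : C) u v, S u -> S v -> S (a *: u + v)) ->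
  exists z, (forall s, S s -> hdot (y - z) s = 0) /\
    forall e : R, 0 < e -> exists s, S s /\ nrm (s - z) < e.
Proof.
move=> S0 SD.
pose E := [set d : R | exists s, S s /\ d = nrm (y - s)]; pose d := inf E.
have E0 : E !=set0 by exists (nrm (y - 0)), 0.
have Elb : lbound E 0 by move=> _ [s [_ ->]]; exact: nrm_ge0.
have hE : has_inf E by split=> //; exists 0.
have d0 : 0 <= d by exact: lb_le_inf.
have dS s : S s -> d <= nrm (y - s) by move=> Ss; apply: ge_inf; [exists 0|exists s].
have ex n : exists s, S s /\ nrm (y - s) < d + n.+1%:R^-1.
  by have [|_ [s [Ss ->]] hs] := @inf_adherent _ E n.+1%:R^-1 _ hE; [|exists s].
pose s (n : nat) : H := xget (0 : H) [set s | S s /\ nrm (y - s) < d + n.+1%:R^-1].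
have hs n : S (s n) /\ nrm (y - s n) < d + n.+1%:R^-1 by exact: xgetPex (ex n).
have sc : ccauchy s.
  move=> e e0.
  (* With both distances at most d + f, the parallelogram law bounds the
     squared distance of the two terms by 8 d f + 4 f^2, and f <= 1. *)
  pose f := Num.min 1 (e ^+ 2 / (8 * d + 5)).
  have f0 : 0 < f by rewrite lt_min ltr01 divr_gt0 ?exprn_gt0//; lra.
  have [N hN] := invS_small f0.
  exists N => n m Nn Nm.
  have [Sn hn] := hs n; have [Sm hm] := hs m.
  have {}hn : nrm (y - s n) <= d + f by rewrite (le_trans (ltW hn))// lerD2l ltW// hN.
  have {}hm : nrm (y - s m) <= d + f by rewrite (le_trans (ltW hm))// lerD2l ltW// hN.
  have := parallelogram (y - s m) (y - s n).
  have -> : y - s m - (y - s n) = s n - s m by rewrite opprB addrC addrA subrK.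
  have -> : y - s m + (y - s n) = 2%:R *: (y - 2%:R^-1 *: (s m + s n)).
    rewrite scalerBr scalerA divff ?pnatr_eq0// scale1r scaler_nat.
    by rewrite mulr2n addrACA opprD.
  have Smid : S (2%:R^-1 *: (s m + s n)).
    rewrite -[_ *: _]addr0; apply: (SD) => //.
    by rewrite -[s m]scale1r; exact: SD.
  rewrite nrmZ nrm_nat exprMn => hp.
  have hd2 : d ^+ 2 <= nrm (y - 2%:R^-1 *: (s m + s n)) ^+ 2.
    by rewrite lerXn2r ?nnegrE ?nrm_ge0// dS.
  have hn2 : nrm (y - s n) ^+ 2 <= (d + f) ^+ 2.
    by rewrite lerXn2r ?nnegrE ?nrm_ge0// addr_ge0// ltW.
  have hm2 : nrm (y - s m) ^+ 2 <= (d + f) ^+ 2.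
    by rewrite lerXn2r ?nnegrE ?nrm_ge0// addr_ge0// ltW.
  have f1 : f <= 1 by rewrite ge_min lexx.
  have f2 : f * (8 * d + 5) <= e ^+ 2.
    by rewrite -ler_pdivlMr ?ge_min ?lexx ?orbT//; lra.
  rewrite -(@ltr_pXn2r _ 2) ?nnegrE ?nrm_ge0 ?(ltW e0)//.
  nra.
have [z hz] := ccauchy_tends sc.
have zS (t : H) : S t -> nrm (y - z) <= nrm (y - z - t).
  move=> St.
  suff key (e : R) : 0 < e -> nrm (y - z) <= nrm (y - z - t) + e.
    exact/ler_addgt0Pr.
  move=> e0; have e3 : 0 < e / 3 by rewrite divr_gt0.
  have [N hN] := hz _ e3; have [N' hN'] := invS_small e3.
  pose n := maxn N N'.
  have h1 : nrm (s n - z) < e / 3 by rewrite hN// leq_maxl.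
  have h2 : n.+1%:R^-1 < e / 3 by rewrite hN'// leq_maxr.
  have [Sn h3] := hs n.
  have h4 := nrm_tri y (s n) z.
  have h5 : d <= nrm (y - (s n + t)).
    by apply: dS; rewrite -[s n]scale1r; exact: SD.
  have h6 : nrm (y - (s n + t)) <= nrm (y - z - t) + nrm (s n - z).
    have -> : y - (s n + t) = (y - z - t) - (s n - z).
      by rewrite opprB [y - z - t]addrAC subrKA opprD addrA addrAC.
    by rewrite (le_trans (nrmD _ _))// nrmN.
  have h7 : nrm (y - s n) < d + e / 3 by rewrite (lt_trans h3)// ltrD2l.
  clear -h1 h7 h4 h5 h6; lra.
exists z; split; last first.
  by move=> e /hz[N hN]; exists (s N); split; [case: (hs N)|exact: hN].
move=> t St; have [->|t0] := eqVneq t 0; first by rewrite hdot0r.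
have nt : 0 < nrm t by rewrite lt_def nrm_ge0 andbT; apply: contra_neq t0; apply: nrm_eq0.
set w := y - z; set a := hdot w t.
(* Compare z with z moved along t by the coefficient of the projection onto t.
   *)
have /zS : S (a / (nrm t ^+ 2)%:C *: t) by rewrite -[_ *: _]addr0; exact: SD.
rewrite -/w -(@ler_pXn2r _ 2) ?nnegrE ?nrm_ge0// (nrmB_sq w) nrmZ hdotZr -/a nrmM nrmV.
rewrite nrm_ger0 ?sqr_ge0//.
have -> : complex.Re (Num.conj (a / (nrm t ^+ 2)%:C) * a) = nrm a ^+ 2 / nrm t ^+ 2.
  by rewrite -fmorphV rmorphM/= conj_real mulrAC (mulrC _ a) nrmK -rmorphM.
have -> : (nrm a / nrm t ^+ 2 * nrm t) ^+ 2 = nrm a ^+ 2 / nrm t ^+ 2.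
  by field; rewrite gt_eqF.
move=> h; apply: nrm_eq0; apply/eqP; rewrite -sqrf_eq0 eq_le sqr_ge0 andbT.
have : nrm a ^+ 2 / nrm t ^+ 2 <= 0 by lra.
by rewrite pmulr_lle0// invr_gt0 exprn_gt0.
Qed.

(** If phi does not vanish at y, subtract from y its projection onto the
    kernel of phi: the difference w spans the orthogonal complement of the
    kernel, so phi is a multiple of the pairing with w. *)
Lemma riesz (phi : H -> C) (M : R) :
  (forall a x y, phi (a *: x + y) = a * phi x + phi y) ->
  (forall x, nrm (phi x) <= M * nrm x) ->
  exists z, forall x, phi x = hdot x z.
Proof.
move=> lphi bphi.
have p0 : phi 0 = 0 by have := lphi (-1) 0 0; rewrite scaler0 addr0 mulN1r addNr.
have pD x y : phi (x + y) = phi x + phi y by have := lphi 1 x y; rewrite scale1r mul1r.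
have pZ a x : phi (a *: x) = a * phi x by have := lphi a x 0; rewrite !addr0 p0 addr0.
have pB x y : phi (x - y) = phi x - phi y by rewrite pD -scaleN1r pZ mulN1r.
have [h|/existsNP[y hy]] := pselect (forall x, phi x = 0).
  by exists 0 => x; rewrite hdot0r.
have [|a u v /= pu pv|z [hz zS]] := @projection [set x | phi x = 0] y.
- exact: p0.
- by rewrite /= lphi pu pv mulr0 addr0.
have pz : phi z = 0.
  have M1 : 0 < `|M| + 1 by rewrite ltr_wpDl.
  apply: nrm_eq0; apply/eqP; rewrite eq_le nrm_ge0 andbT.
  apply/ler_addgt0Pr => e e0; rewrite add0r.
  have [s [/= ps hs]] := zS (e / (`|M| + 1)) (divr_gt0 e0 M1).
  have -> : phi z = - phi (s - z) by rewrite pB ps sub0r opprK.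
  rewrite nrmN (le_trans (bphi _))// (@le_trans _ _ ((`|M| + 1) * nrm (s - z)))//.
    by rewrite ler_wpM2r ?nrm_ge0// ler_wpDr// ler_norm.
  by rewrite mulrC -ler_pdivlMr// ltW.
set w := y - z in hz.
have pw : phi w != 0 by apply/eqP; rewrite pB pz subr0.
have ww : hdot w w != 0.
  rewrite hdot_nrm; apply: contra_neq pw => /(congr1 (@complex.Re R))/=/eqP.
  by rewrite sqrf_eq0 => /eqP/nrm_eq0 ->; rewrite p0.
exists (Num.conj (phi w / hdot w w) *: w) => x.
rewrite hdotZr conjCK.
have /hz : phi (x - (phi x / phi w) *: w) = 0 by rewrite pB pZ divfK// subrr.
rewrite hdotC hdotBl hdotZl => /(congr1 Num.conj).
rewrite conjCK rmorph0 => /eqP.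
rewrite subr_eq0 => /eqP ->.
by field; rewrite ww pw.
Qed.

End Projection.

Section Adjoint.
Context {R : realType}.
Local Notation C := R[i].
Implicit Types H K L : hilbertType R.

Lemma adj_uniq H K (A : H -> K) (B : K -> H) :
  (forall x y, hdot (A x) y = hdot x (B y)) -> adj A = B.
Proof.
move=> h; apply: xget_unique => // B' hB'; apply/funext => y.
by apply: hdot_sepr => z; rewrite -hB' h.
Qed.

(** Riesz representation of x |-> <A x, y>, so the default value in the
    definition of the adjoint is never used for bounded operators. *)
Lemma adjP H K (A : H -> K) M : opb A M ->
  forall x y, hdot (A x) y = hdot x (adj A y).
Proof.
move=> [lA M0 hA]; rewrite /adj; case: xgetP => [B _ //|].
have ex y : exists z, forall x, hdot (A x) y = hdot x z.
  apply: (@riesz _ _ _ (M * nrm y)) => [a u v|x].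
    by rewrite lA hdotDl hdotZl.
  by rewrite (le_trans (hdot_CS _ _))// mulrAC ler_wpM2r ?nrm_ge0.
move=> /(_ (fun y => xget 0 [set z | forall x, hdot (A x) y = hdot x z])) [] x y.
exact: (@xgetPex _ _ [set z | forall x, hdot (A x) y = hdot x z] (ex y)).
Qed.

Lemma adjP' H K (A : H -> K) M : opb A M ->
  forall x y, hdot x (A y) = hdot (adj A x) y.
Proof. by move=> hA x y; rewrite hdotC (adjP hA) -hdotC. Qed.

(** From |A' y|^2 = <A A' y, y> and Cauchy-Schwarz, where A' is the adjoint.
    *)
Lemma opb_adj H K (A : H -> K) M : opb A M -> opb (adj A) M.
Proof.
move=> hA; have [lA M0 bA] := hA; split=> //.
  by move=> a x y; apply: hdot_sepr => z; rewrite -(adjP hA) !hdotDr !hdotZr -!(adjP hA).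
move=> y; have [->|n0] := eqVneq (nrm (adj A y)) 0; first by rewrite mulr_ge0 ?nrm_ge0.
have np : 0 < nrm (adj A y) by rewrite lt_def n0 nrm_ge0.
rewrite -(ler_pM2l np) -expr2.
have -> : nrm (adj A y) ^+ 2 = nrm (hdot (A (adj A y)) y).
  by rewrite (adjP hA) hdot_nrm nrm_ger0// sqr_ge0.
by rewrite (le_trans (hdot_CS _ _))// mulrA ler_wpM2r ?nrm_ge0// mulrC.
Qed.

Lemma adjK H K (A : H -> K) M : opb A M -> adj (adj A) = A.
Proof. by move=> hA; apply: adj_uniq => x y; rewrite -(adjP' hA). Qed.

Lemma adj_comp H K L (A : K -> L) (B : H -> K) M N : opb A M -> opb B N ->
  adj (A \o B) = adj B \o adj A.
Proof. by move=> hA hB; apply: adj_uniq => x y /=; rewrite (adjP hA) (adjP hB). Qed.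

Lemma adj_iter H (A : H -> H) M n : opb A M -> adj (iter n A) = iter n (adj A).
Proof.
move=> hA; elim: n => [|n ih]; first by apply: adj_uniq.
apply: adj_uniq => x y; rewrite iterS (adjP hA) (adjP (opb_iter n hA)) ih.
by rewrite -iterSr.
Qed.

End Adjoint.

(** * Orthonormal families and Hilbert-Schmidt operators *)

Section Orthonormal.
Context {R : realType} {H : hilbertType R}.
Local Notation C := R[i].

Definition orthonormal_on (I : eqType) (r : seq I) (g : I -> H) :=
  uniq r /\ forall i j, i \in r -> j \in r -> hdot (g i) (g j) = (i == j)%:R.

Definition proj (I : eqType) (r : seq I) (g : I -> H) (x : H) : H :=
  \sum_(i <- r) hdot x (g i) *: g i.

Section family.
Context (I : eqType) (r : seq I) (g : I -> H) (og : orthonormal_on r g).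

Lemma hdot_onsum (c : I -> C) j : j \in r ->
  hdot (\sum_(i <- r) c i *: g i) (g j) = c j.
Proof.
case: og => ur gg rj; rewrite hdot_suml (bigD1_seq j)//= hdotZl gg// eqxx mulr1.
rewrite big_seq_cond big1 ?addr0// => i /andP[ri ij].
by rewrite hdotZl gg// (negPf ij) mulr0.
Qed.

Lemma nrm_onsum (c : I -> C) :
  nrm (\sum_(i <- r) c i *: g i) ^+ 2 = \sum_(i <- r) nrm (c i) ^+ 2.
Proof.
apply: complexI; rewrite -hdot_nrm hdot_sumr rmorph_sum /=.
rewrite big_seq [RHS]big_seq; apply: eq_bigr => j rj.
by rewrite hdotZr hdot_onsum// mulrC nrmK.
Qed.

Lemma nrm_proj x : nrm (proj r g x) ^+ 2 = \sum_(i <- r) nrm (hdot x (g i)) ^+ 2.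
Proof. exact: nrm_onsum. Qed.

Lemma proj_orth x (c : I -> C) :
  hdot (x - proj r g x) (\sum_(i <- r) c i *: g i) = 0.
Proof.
rewrite hdot_sumr big_seq big1// => j rj.
by rewrite hdotZr hdotBl hdot_onsum// subrr mulr0.
Qed.

(** Pythagoras, as proj x is orthogonal to x - proj x. *)
Lemma nrm_subproj x :
  nrm (x - proj r g x) ^+ 2 = nrm x ^+ 2 - \sum_(i <- r) nrm (hdot x (g i)) ^+ 2.
Proof.
rewrite -nrm_proj; apply/eqP; rewrite -subr_eq opprK; apply/eqP.
rewrite -[in RHS](subrK (proj r g x) x) (nrmD_sq (x - _)).
by rewrite [hdot (_ - _) _]proj_orth mulr0 addr0.
Qed.

Lemma bessel x : \sum_(i <- r) nrm (hdot x (g i)) ^+ 2 <= nrm x ^+ 2.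
Proof. by rewrite -subr_ge0 -nrm_subproj sqr_ge0. Qed.

Lemma nrm_subproj_le x : nrm (x - proj r g x) <= nrm x.
Proof.
rewrite -(@ler_pXn2r _ 2) ?nnegrE ?nrm_ge0// nrm_subproj.
by rewrite gerBl sumr_ge0// => i _; rewrite sqr_ge0.
Qed.

Lemma projB x y : proj r g (x - y) = proj r g x - proj r g y.
Proof. by rewrite -sumrB; apply: eq_bigr => i _; rewrite hdotBl scalerBl. Qed.

Lemma proj_id i : i \in r -> proj r g (g i) = g i.
Proof.
case: og => ur gg ri; rewrite /proj (bigD1_seq i)//= gg// eqxx scale1r.
rewrite big_seq_cond big1 ?addr0// => j /andP[rj ji].
by rewrite gg// eq_sym (negPf ji) scale0r.
Qed.

End family.

Definition orthoset (S : set H) :=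
  forall x y : H, S x -> S y -> hdot x y = (x == y)%:R.

(** Zorn's lemma on orthonormal sets: a unit vector orthogonal to a maximal
    one would enlarge it. Bases of arbitrary cardinality are needed because
    the space may be nonseparable. *)
Lemma exists_onb : exists (I : choiceType) (e : I -> H), orthonormal_basis e.
Proof.
have [F FP totF|A [PA maxA]] := @Zorn_bigcup H orthoset.
  move=> x y [X FX Xx] [Y FY Yy].
  have [XY|YX] := totF _ _ FX FY; first by apply: (FP _ FY) => //; exact: XY.
  by apply: (FP _ FX) => //; exact: YX.
exists (A : choiceType), (fun i : A => \val i); split=> [i j|x hx].
  by rewrite (PA _ _ (set_valP i) (set_valP j)).
apply/eqP/negPn/negP => x0.
have nx : nrm x != 0 by apply: contra_neq x0; apply: nrm_eq0.
have hx' y : A y -> hdot x y = 0.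
  by move=> Ay; have := hx (SigSub (mem_set Ay)).
pose u := (nrm x)^-1%:C *: x.
have uu : hdot u u = 1.
  rewrite hdot_nrm nrmZ nrm_ger0 ?invr_ge0 ?nrm_ge0// mulVf// expr1n.
  by rewrite rmorph1.
have uA y : A y -> hdot u y = 0 by move=> Ay; rewrite hdotZl hx' ?mulr0.
apply: (maxA (A `|` [set u])).
  split; last first.
    move=> /(_ u); rewrite /= => /(_ (or_intror erefl))/uA/eqP.
    by rewrite uu oner_eq0.
  by move=> y; left.
move=> y z [Ay|/= ->] [Az|/= ->]; first exact: PA.
- have yu : y != u by apply/eqP => yu; move: (uA _ Ay); rewrite yu => /eqP; rewrite uu oner_eq0.
  by rewrite hdotC uA// rmorph0 (negPf yu).
- have yu : u != z by apply/eqP => yu; move: (uA _ Az); rewrite -yu => /eqP; rewrite uu oner_eq0.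
  by rewrite uA// (negPf yu).
- by rewrite eqxx.
Qed.

Lemma onb_on (I : choiceType) (e : I -> H) (r : seq I) :
  orthonormal_basis e -> uniq r -> orthonormal_on r e.
Proof. by case=> ee _ ur; split=> // i j _ _; exact: ee. Qed.

(** The projection theorem applied to the span of the basis: the component of
    y orthogonal to the span vanishes by completeness, so y is approximated by
    a finite combination; once the index set contains those of the
    combination, the projection fixes the combination and does not increase
    the norm of the remainder. *)
Lemma onb_dense (I : choiceType) (e : I -> H) (y : H) (eps : R) :
  orthonormal_basis e -> 0 < eps ->
  exists s : seq I, forall r : seq I, uniq r -> {subset s <= r} ->
    nrm (y - proj r e y) < eps.
Proof.
move=> oe eps0; have [ee ecomp] := oe.
pose S := [set x : H | exists s : seq (C * I), x = \sum_(p <- s) p.1 *: e p.2].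
have [| |z [hz hS]] := @projection _ _ S y.
- by exists [::]; rewrite big_nil.
- move=> a _ _ [s ->] [t ->]; exists ([seq (a * p.1, p.2) | p <- s] ++ t).
  rewrite big_cat big_map/= scaler_sumr; congr (_ + _).
  by apply: eq_bigr => p _; rewrite scalerA.
have yz : y = z.
  apply/eqP; rewrite -subr_eq0; apply/eqP/ecomp => i; apply: hz.
  by exists [:: (1, i)]; rewrite big_seq1 scale1r.
have [_ [[s ->]]] := hS _ eps0; rewrite -yz => hs.
exists [seq p.2 | p <- s] => r ur sr.
have or := onb_on oe ur.
set x := \sum_(p <- s) _ in hs.
have px : proj r e x = x.
  rewrite /x /proj; under eq_bigr do rewrite hdot_suml scaler_suml.
  rewrite exchange_big/= big_seq [RHS]big_seq; apply: eq_bigr => p ps.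
  under eq_bigr do rewrite hdotZl -scalerA.
  rewrite -scaler_sumr; congr (_ *: _).
  by apply: (proj_id or); apply: sr; exact: map_f.
(* The projection fixes x, so the error for y is the error for y - x. *)
have -> : y - proj r e y = (y - x) - proj r e (y - x).
  by rewrite projB px opprB addrA subrK.
by rewrite (le_lt_trans (nrm_subproj_le or _))// nrmB.
Qed.

End Orthonormal.

Section HilbertSchmidt.
Context {R : realType}.
Local Notation C := R[i].
Implicit Types H K L : hilbertType R.

(** Hilbert-Schmidt norm at most M, tested on finite orthonormal families.
    Quantifying over all such families, of any index type, avoids choosing a
    basis of a possibly nonseparable space and makes the bound stable under
    pointwise limits. *)
Definition hs H K (A : H -> K) (M : R) :=
  [/\ exists N, opb A N, 0 <= M & forall (I : eqType) (r : seq I) (g : I -> H),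
     orthonormal_on r g -> \sum_(i <- r) nrm (A (g i)) ^+ 2 <= M ^+ 2].

Lemma hs_le H K (A : H -> K) M N : M <= N -> hs A M -> hs A N.
Proof.
move=> MN [bA M0 h]; split=> //; first exact: le_trans MN.
by move=> I r g /h/le_trans; apply; rewrite lerXn2r// nnegrE// (le_trans M0).
Qed.

Lemma hs0 H K : hs (fun _ : H => 0 : K) 0.
Proof.
split=> // [|I r g _]; first by exists 0; exact: opb0.
by rewrite big1// => i _; rewrite nrm0 expr0n.
Qed.

Lemma hsN H K (A : H -> K) M : hs A M -> hs (fun x => - A x) M.
Proof.
move=> [[N bA] M0 h]; split=> //; first by exists N; exact: opbN.
by move=> I r g /h; under [X in _ -> X <= _]eq_bigr do rewrite nrmN.
Qed.

Lemma hsZ H K (A : H -> K) M (a : C) : hs A M -> hs (fun x => a *: A x) (nrm a * M).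
Proof.
move=> [[N bA] M0 h]; split; rewrite ?mulr_ge0 ?nrm_ge0//.
  by exists (nrm a * N); exact: opbZ.
move=> I r g /h; under [X in _ -> X <= _]eq_bigr do rewrite nrmZ exprMn.
by rewrite -mulr_sumr exprMn => ?; rewrite ler_wpM2l// sqr_ge0.
Qed.

(** With bounds A, B enlarged to positive s, t, apply 2ab <= (t/s) a^2 + (s/t)
    b^2 termwise, then let the enlargement tend to 0. *)
Lemma sum_minkowski I (r : seq I) (a b : I -> R) (A B : R) :
  (forall i, 0 <= a i) -> (forall i, 0 <= b i) -> 0 <= A -> 0 <= B ->
  \sum_(i <- r) a i ^+ 2 <= A ^+ 2 -> \sum_(i <- r) b i ^+ 2 <= B ^+ 2 ->
  \sum_(i <- r) (a i + b i) ^+ 2 <= (A + B) ^+ 2.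
Proof.
move=> a0 b0 A0 B0 hA hB.
have key e : 0 < e -> \sum_(i <- r) (a i + b i) ^+ 2 <= (A + e + (B + e)) ^+ 2.
  move=> e0; have Ae : 0 < A + e by rewrite ltr_wpDl.
  have Be : 0 < B + e by rewrite ltr_wpDl.
  set s := A + e in Ae *; set t := B + e in Be *.
  have hA' : \sum_(i <- r) a i ^+ 2 <= s ^+ 2.
    by rewrite (le_trans hA)// lerXn2r ?nnegrE ?(ltW Ae)// lerDl ltW.
  have hB' : \sum_(i <- r) b i ^+ 2 <= t ^+ 2.
    by rewrite (le_trans hB)// lerXn2r ?nnegrE ?(ltW Be)// lerDl ltW.
  apply: (@le_trans _ _ (\sum_(i <- r) ((1 + t / s) * a i ^+ 2 + (1 + s / t) * b i ^+ 2))).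
    apply: ler_sum => i _.
    have : 0 <= (t / s) * (a i - s / t * b i) ^+ 2.
      by rewrite mulr_ge0 ?sqr_ge0// divr_ge0 ?ltW.
    have -> : t / s * (a i - s / t * b i) ^+ 2 =
      t / s * a i ^+ 2 + s / t * b i ^+ 2 - 2 * (a i * b i).
      by field; rewrite !gt_eqF.
    nra.
  rewrite big_split/= -!mulr_sumr.
  apply: (@le_trans _ _ ((1 + t / s) * s ^+ 2 + (1 + s / t) * t ^+ 2)).
    by rewrite lerD// ler_wpM2l// addr_ge0// divr_ge0 ?ltW.
  by rewrite le_eqVlt; apply/orP; left; apply/eqP; field; rewrite !gt_eqF.
rewrite -(sqr_sqrtr (sumr_ge0 _ _ : 0 <= \sum_(i <- r) (a i + b i) ^+ 2)); last first.
  by move=> i _; rewrite sqr_ge0.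
rewrite lerXn2r ?nnegrE ?addr_ge0 ?sqrtr_ge0//.
apply/ler_addgt0Pr => e e0; have e2 : 0 < e / 2 by rewrite divr_gt0.
rewrite -(@ler_pXn2r _ 2) ?nnegrE ?addr_ge0 ?sqrtr_ge0 ?(ltW e0)//.
rewrite sqr_sqrtr; last by rewrite sumr_ge0// => i _; rewrite sqr_ge0.
by rewrite (le_trans (key _ e2))// addrACA -splitr.
Qed.

Lemma hsD H K (A B : H -> K) M N : hs A M -> hs B N ->
  hs (fun x => A x + B x) (M + N).
Proof.
move=> [[M' bA] M0 hA] [[N' bB] N0 hB]; split; rewrite ?addr_ge0//.
  by exists (M' + N'); exact: opbD.
move=> I r g og.
apply: le_trans (sum_minkowski (fun i => nrm_ge0 (A (g i)))
  (fun i => nrm_ge0 (B (g i))) M0 N0 (hA _ _ _ og) (hB _ _ _ og)).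
apply: ler_sum => i _.
by rewrite lerXn2r ?nnegrE ?addr_ge0 ?nrm_ge0// nrmD.
Qed.

Lemma hs_sum H K I (r : seq I) (A : I -> H -> K) (M : I -> R) :
  (forall i, hs (A i) (M i)) ->
  hs (fun x => \sum_(i <- r) A i x) (\sum_(i <- r) M i).
Proof.
move=> h; elim: r => [|i r ih].
  rewrite big_nil; rewrite (_ : (fun _ => _) = fun=> 0); first exact: hs0.
  by apply/funext => x; rewrite big_nil.
rewrite big_cons (_ : (fun _ => _) = fun x => A i x + \sum_(j <- r) A j x).
  exact: hsD.
by apply/funext => x; rewrite big_cons.
Qed.

Lemma hs_compl H K L (A : K -> L) (B : H -> K) M N :
  opb A M -> hs B N -> hs (A \o B) (M * N).
Proof.
move=> bA [[N' bB] N0 hB]; have [_ M0 hA] := bA.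
split; rewrite ?mulr_ge0//; first by exists (M * N'); exact: opb_comp.
move=> I r g og; apply: (@le_trans _ _ (\sum_(i <- r) M ^+ 2 * nrm (B (g i)) ^+ 2)).
  apply: ler_sum => i _; rewrite -exprMn lerXn2r ?nnegrE ?mulr_ge0 ?nrm_ge0//.
  exact: hA.
by rewrite -mulr_sumr exprMn ler_wpM2l ?sqr_ge0// hB.
Qed.

(** Expand the vectors A' g_i, with A' the adjoint, along an orthonormal basis
    (e_j), up to an error eps. As <A' g_i, e_j> = <g_i, A e_j>, exchanging the
    sums over i and j and applying Bessel's inequality to the family (g_i)
    leaves the sum of the |A e_j|^2. *)
Lemma hs_adj H K (A : H -> K) M : hs A M -> hs (adj A) M.
Proof.
move=> [[N bA] M0 hA]; split=> //; first by exists N; exact: opb_adj.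
move=> I r g og.
have [J [e oe]] := @exists_onb _ H.
have key (eps : R) : 0 < eps ->
    \sum_(i <- r) nrm (adj A (g i)) ^+ 2 <= M ^+ 2 + (size r)%:R * eps ^+ 2.
  move=> eps0.
  have [s [us hs]] : exists s : seq J, uniq s /\ forall i, i \in r ->
      nrm (adj A (g i) - proj s e (adj A (g i))) < eps.
    have ex i := onb_dense (adj A (g i)) oe eps0.
    have [s hs] := boolp.choice ex.
    exists (undup (flatten [seq s i | i <- r])); split; first exact: undup_uniq.
    move=> i ri; apply: hs; first exact: undup_uniq.
    move=> j sj; rewrite mem_undup; apply/flattenP; exists (s i) => //.
    exact: map_f.
  have os := onb_on oe us.
  apply: (@le_trans _ _ (\sum_(i <- r) (\sum_(j <- s) nrm (hdot (adj A (g i)) (e j)) ^+ 2 + eps ^+ 2))).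
    rewrite big_seq [leRHS]big_seq; apply: ler_sum => i ri.
    rewrite -lerBlDl -(nrm_subproj os) lerXn2r ?nnegrE ?nrm_ge0 ?(ltW eps0)//.
    exact/ltW/hs.
  rewrite big_split/= lerD//; last first.
    by rewrite big_const_seq count_predT iter_addr_0 mulr_natl.
  rewrite exchange_big/=; apply: le_trans (hA _ _ _ os).
  apply: ler_sum => j _.
  under eq_bigr => i _ do rewrite -(adjP' bA) -nrm_conj -hdotC.
  exact: bessel.
apply/ler_addgt0Pr => eps eps0.
have d0 : 0 < eps / (size r).+1%:R by rewrite divr_gt0.
have := key (Num.sqrt (eps / (size r).+1%:R)); rewrite sqrtr_gt0 => /(_ d0)/le_trans; apply.
rewrite lerD2l sqr_sqrtr ?(ltW d0)// mulrCA ger_pMr// ler_pdivrMr// mul1r.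
by rewrite ler_nat.
Qed.

(** By passing to adjoints, which turns right multiplication into left
    multiplication. *)
Lemma hs_compr H K L (A : K -> L) (B : H -> K) M N :
  hs A M -> opb B N -> hs (A \o B) (M * N).
Proof.
move=> hA bB; have [[M' bA] _ _] := hA.
rewrite -(adjK (opb_comp bA bB)) (adj_comp bA bB) mulrC.
apply: hs_adj; apply: hs_compl; [exact: opb_adj bB|exact: hs_adj].
Qed.

Lemma tends_sqsum (V : normedZmodType C) I (r : seq I) (u : I -> nat -> V) (l : I -> V) (M : R) N :
  (forall i, tends (u i) (l i)) ->
  (forall n, (N <= n)%N -> \sum_(i <- r) nrm (u i n) ^+ 2 <= M) ->
  \sum_(i <- r) nrm (l i) ^+ 2 <= M.
Proof.
move=> ul hM.
have h i : tends (fun n => (nrm (u i n) ^+ 2)%:C : C) ((nrm (l i) ^+ 2)%:C).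
  have [N' hN'] := ul i 1 ltr01.
  move=> e e0.
  have [K hK] := ul i (e / (2 * nrm (l i) + 1)) (divr_gt0 e0 (ltr_wpDl (mulr_ge0 (ler0n _ _) (nrm_ge0 _)) ltr01)).
  exists (maxn K N') => n; rewrite geq_max => /andP[Kn N'n].
  rewrite -rmorphB nrm_real subr_sqr normrM.
  have h1 := hN' _ N'n.
  have h2 : `|nrm (u i n) - nrm (l i)| <= nrm (u i n - l i).
    by rewrite ler_norml nrm_rev andbT lerNl opprB nrmB nrm_rev.
  have h3 : `|nrm (u i n) + nrm (l i)| <= 2 * nrm (l i) + 1.
    rewrite ger0_norm ?addr_ge0 ?nrm_ge0//.
    by have := nrm_rev (u i n) (l i); lra.
  rewrite (le_lt_trans (ler_pM _ _ h2 h3))//.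
  rewrite -ltr_pdivlMr; first exact: hK.
  by rewrite ltr_wpDl// mulr_ge0 ?nrm_ge0.
have ts := tends_sum (P := xpredT) r (fun i _ => h i).
have : nrm (\sum_(i <- r) (nrm (l i) ^+ 2)%:C : C) <= M.
  apply: (tends_bound ts (N := N)) => n Nn.
  by rewrite -rmorph_sum/= nrm_ger0 ?hM// sumr_ge0// => i _; rewrite sqr_ge0.
by rewrite -rmorph_sum/= nrm_ger0// sumr_ge0// => i _; rewrite sqr_ge0.
Qed.

(** Only finitely many vectors enter each test of the Hilbert-Schmidt bound,
    so it survives limits that are merely pointwise. *)
Lemma hs_tends H K (A : nat -> H -> K) (B : H -> K) M N :
  (exists N', opb B N') -> (forall n, (N <= n)%N -> hs (A n) M) ->
  (forall x, tends (fun n => A n x) (B x)) -> hs B M.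
Proof.
move=> bB hA hB; have [_ M0 _] := hA N (leqnn _); split=> //.
move=> I r g og; apply: (@tends_sqsum _ _ _ (fun i n => A n (g i)) _ _ N) => //.
by move=> n /hA[_ _ h]; exact: h.
Qed.

End HilbertSchmidt.

(** * Square roots of positive contractions *)

Section OperatorSqrt.
Context {R : realType}.
Local Notation C := R[i].
Implicit Types H K : hilbertType R.

(** For a positive contraction A, these iterates of Y |-> (A + Y^2)/2 increase
    to the solution 1 - sqrt(1 - A) of Y = (A + Y^2)/2 with norm at most 1. *)
Fixpoint sqit H (A : H -> H) (n : nat) (x : H) : H :=
  if n is m.+1 then 2%:R^-1 *: (A x + sqit A m (sqit A m x)) else 0.

Lemma sqitS H (A : H -> H) n x :
  sqit A n.+1 x = 2%:R^-1 *: (A x + sqit A n (sqit A n x)).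
Proof. by []. Qed.

(** The same iteration at the scalar 1. It majorises the operator iteration in
    norm, and so do its increments, which is what gives convergence without
    any spectral theory. *)
Fixpoint sqitn (n : nat) : R :=
  if n is m.+1 then 2^-1 * (1 + sqitn m ^+ 2) else 0.

Lemma sqitn_ge0 n : 0 <= sqitn n.
Proof. by case: n => //= n; rewrite mulr_ge0 ?invr_ge0// addr_ge0// sqr_ge0. Qed.

Lemma sqitn_le1 n : sqitn n <= 1.
Proof.
elim: n => //= n ih; have := sqitn_ge0 n.
have : sqitn n ^+ 2 <= 1 by rewrite expr_le1// sqitn_ge0.
lra.
Qed.

Lemma half_nrm : nrm (2%:R^-1 : C) = 2^-1.
Proof. by rewrite nrmV nrm_nat. Qed.

Lemma opb_sqit H (A : H -> H) n : opb A 1 -> opb (sqit A n) (sqitn n).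
Proof.
move=> hA; elim: n => [|n ih] /=; first exact: opb0.
rewrite -half_nrm; apply: opbZ; apply: opbD => //.
by rewrite expr2; exact: (opb_comp ih ih).
Qed.

(** The iterates are polynomials in A without constant term, so an operator
    intertwining A and B intertwines the iterates. *)
Lemma sqit_inter H K (A : H -> H) (B : K -> K) (T : H -> K) n :
  linear T -> (forall x, T (A x) = B (T x)) ->
  forall x, T (sqit A n x) = sqit B n (T x).
Proof.
move=> lT TA; elim: n => [|n ih] x /=; first by rewrite lin0.
by rewrite linZZ// linDD// TA !ih.
Qed.

Lemma sqit_comm H (A : H -> H) m n x : opb A 1 ->
  sqit A m (sqit A n x) = sqit A n (sqit A m x).
Proof.
move=> hA; have [lAm _ _] := opb_sqit m hA; have [lA _ _] := hA.
have cA y : sqit A m (A y) = A (sqit A m y) by rewrite -(@sqit_inter _ _ A A A m lA).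
exact: (sqit_inter n lAm cA).
Qed.

(** The iterates commute, so the increment Y_(n+2) - Y_(n+1) factors as half
    of (Y_(n+1) + Y_n) (Y_(n+1) - Y_n); the scalar iteration satisfies the
    same identity. *)
Lemma sqit_step H (A : H -> H) n x : opb A 1 ->
  nrm (sqit A n.+1 x - sqit A n x) <= (sqitn n.+1 - sqitn n) * nrm x.
Proof.
move=> hA; elim: n x => [|n ih] x.
  have [lA _ bA] := hA.
  rewrite /= !subr0 addr0 nrmZ half_nrm -mulrA ler_wpM2l ?invr_ge0//.
  by rewrite expr0n addr0 bA.
have [lY _ bY] := opb_sqit n.+1 hA; have [lZ _ bZ] := opb_sqit n hA.
have -> : sqit A n.+2 x - sqit A n.+1 x =
    2%:R^-1 *: (sqit A n.+1 (sqit A n.+1 x - sqit A n x)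
              + sqit A n (sqit A n.+1 x - sqit A n x)).
  rewrite (linBB lY) (linBB lZ) (sqit_comm n.+1 n x hA) sqitS.
  rewrite -(subrKA (2%:R^-1 *: A x)); have := sqitS A n x.
  set b := sqit A n.+1 x; set c := sqit A n.+1 b; set d := sqit A n b.
  move=> eb; rewrite {1}eb; apply: hdot_sep => z.
  by rewrite !(hdotDl, hdotNl, hdotZl); ring.
rewrite nrmZ half_nrm.
apply: (@le_trans _ _ (2^-1 * ((sqitn n.+1 + sqitn n) * nrm (sqit A n.+1 x - sqit A n x)))).
  rewrite ler_wpM2l ?invr_ge0// (le_trans (nrmD _ _))// mulrDl lerD//.
apply: (@le_trans _ _ (2^-1 * ((sqitn n.+1 + sqitn n) *
   ((sqitn n.+1 - sqitn n) * nrm x)))).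
  rewrite ler_wpM2l ?invr_ge0// ler_wpM2l// ?addr_ge0 ?sqitn_ge0//.
rewrite le_eqVlt; apply/orP; left; apply/eqP.
have -> : sqitn n.+2 = 2^-1 * (1 + sqitn n.+1 ^+ 2) by [].
have -> : sqitn n.+1 = 2^-1 * (1 + sqitn n ^+ 2) by [].
by field.
Qed.

Lemma sqit_dist H (A : H -> H) n m x : opb A 1 ->
  nrm (sqit A (m + n) x - sqit A n x) <= (sqitn (m + n) - sqitn n) * nrm x.
Proof.
move=> hA; elim: m => [|m ih]; first by rewrite add0n !subrr mul0r nrm0.
rewrite addSn (le_trans (nrm_tri _ (sqit A (m + n) x) _))//.
rewrite -(subrKA (sqitn (m + n)) (sqitn _)) mulrDl lerD//; exact: sqit_step.
Qed.

(** The scalar iterates increase and are bounded by 1, and their increments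
    dominate those of the operator iterates. *)
Lemma sqit_limit H (A : H -> H) x : opb A 1 ->
  exists l, tends (fun n => sqit A n x) l.
Proof.
move=> hA; apply: ccauchy_tends => e e0.
pose E := range sqitn; pose s := sup E.
have hE : has_sup E.
  split; first by exists (sqitn 0), 0%N.
  by exists 1 => _ [n _ <-]; exact: sqitn_le1.
have d0 : 0 < e / (2 * nrm x + 1) by rewrite divr_gt0// ltr_wpDl// mulr_ge0 ?nrm_ge0.
have [_ [N _ <-] hN] := sup_adherent d0 hE.
have sle n : sqitn n <= s by apply: ub_le_sup; [case: hE|exists n].
have key n : (N <= n)%N -> nrm (sqit A n x - sqit A N x) <= e / (2 * nrm x + 1) * nrm x.
  move=> Nn; rewrite -(subnK Nn) (le_trans (sqit_dist _ _ _ hA))// subnK//.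
  rewrite ler_wpM2r ?nrm_ge0//.
  by have := sle n; rewrite -/s in hN; lra.
exists N => n m Nn Nm; rewrite (le_lt_trans (nrm_tri _ (sqit A N x) _))//.
rewrite (nrmB (sqit A N x)) (le_lt_trans (lerD (key _ Nn) (key _ Nm)))//.
have q0 : 0 < 2 * nrm x + 1 by rewrite ltr_wpDl// mulr_ge0 ?nrm_ge0.
rewrite -mulr2n -mulrnAr mulrAC ltr_pdivrMr// ltr_pM2l// -mulr_natl.
by rewrite ltrDl.
Qed.

(** The square root of 1 - A; with A = T'T, where T' is the adjoint, this is
    the defect operator of a contraction T. *)
Definition psqrt H (A : H -> H) (x : H) : H :=
  x - xget 0 [set l | tends (fun n => sqit A n x) l].

Lemma psqrtP H (A : H -> H) x : opb A 1 ->
  tends (fun n => x - sqit A n x) (psqrt A x).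
Proof.
move=> hA; apply: tendsB; first exact: tends_cst.
exact: (@xgetPex _ _ [set l | tends (fun n => sqit A n x) l] (sqit_limit x hA)).
Qed.

Lemma opb_psqrt H (A : H -> H) : opb A 1 -> opb (psqrt A) 2.
Proof.
move=> hA; apply: (@opb_tends _ _ _ (fun n x => x - sqit A n x) _ _ 0%N).
  move=> n _; apply: opb_le (opbB (opb_id H) (opb_sqit n hA)).
  by have := sqitn_le1 n; lra.
by move=> x; exact: psqrtP.
Qed.

Lemma psqrt_inter H K (A : H -> H) (B : K -> K) (T : H -> K) M :
  opb A 1 -> opb B 1 -> opb T M -> (forall x, T (A x) = B (T x)) ->
  forall x, T (psqrt A x) = psqrt B (T x).
Proof.
move=> hA hB hT TA x; have [lT _ _] := hT.
apply: (tends_uniq (tends_opb hT (psqrtP x hA))).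
apply: tends_ext (psqrtP (T x) hB) => n.
by rewrite linBB// (sqit_inter n lT TA).
Qed.

Lemma sqit_sa H (A : H -> H) n : (forall x y, hdot (A x) y = hdot x (A y)) ->
  forall x y, hdot (sqit A n x) y = hdot x (sqit A n y).
Proof.
move=> sA; elim: n => [|n ih] x y /=; first by rewrite hdot0l hdot0r.
rewrite hdotZl hdotZr hdotDl hdotDr sA !ih.
by rewrite fmorphV rmorph_nat.
Qed.

Lemma psqrt_sa H (A : H -> H) : opb A 1 ->
  (forall x y, hdot (A x) y = hdot x (A y)) ->
  forall x y, hdot (psqrt A x) y = hdot x (psqrt A y).
Proof.
move=> hA sA x y; apply: (tends_uniq (tends_hdotl y (psqrtP x hA))).
apply: tends_ext (tends_hdotr x (psqrtP y hA)) => n.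
by rewrite hdotBl hdotBr (sqit_sa n sA).
Qed.

(** With Z_n = 1 - Y_n one has Z_n^2 = 1 - A - 2 Y_n + 2 Y_(n+1), and the last
    two terms cancel in the limit. Since the limit is pointwise, Z_n Z_n x is
    compared with Z_n applied to the limit of Z_n x, using that the Y_n are
    contractions. *)
Lemma psqrtK H (A : H -> H) x : opb A 1 -> psqrt A (psqrt A x) = x - A x.
Proof.
move=> hA; have [lA _ _] := hA; have hD := opb_psqrt hA.
have t1 : tends (fun n => psqrt A x - sqit A n (psqrt A x)) (psqrt A (psqrt A x)).
  exact: psqrtP.
apply: (tends_uniq t1).
have t2 : tends (fun n => (x - sqit A n x) - sqit A n (x - sqit A n x)) (x - A x).
  (* Here Y_n^2 has been eliminated by the recursion: Y_n^2 = 2 Y_(n+1) - A.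
     *)
  have t3 : tends (fun n => x - sqit A n x - sqit A n x + (2%:R *: sqit A n.+1 x - A x)) (x - A x).
    have t4 := psqrtP x hA.
    pose l := x - psqrt A x.
    have tl : tends (fun n => sqit A n x) l.
      by apply: tends_ext (tendsB (tends_cst x) t4) => n; rewrite subKr.
    have tl' := tendsZ 2%:R (tends_shift tl).
    have := tendsD (tendsB t4 tl) (tendsB tl' (tends_cst (A x))).
    suff -> : psqrt A x - l + (2%:R *: l - A x) = x - A x by [].
    rewrite scaler_nat mulr2n /l addrA addrA subrK addrC [_ + (_ - _)]addrC subrK.
    by rewrite addrC.
  apply: tends_ext t3 => n /=; have [lY _ _] := opb_sqit n hA.
  rewrite (linBB lY); apply: hdot_sep => z.
  by rewrite !(hdotDl, hdotNl, hdotZl); field.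
move=> e e0; have e2 : 0 < e / 2 by rewrite divr_gt0.
have [N hN] := t2 _ e2; have [N' hN'] := psqrtP x hA (divr_gt0 e2 (ltr0n R 2)).
exists (maxn N N') => n; rewrite geq_max => /andP[Nn N'n].
rewrite (le_lt_trans (nrm_tri _ (x - sqit A n x - sqit A n (x - sqit A n x)) _))//.
rewrite [ltRHS]splitr ler_ltD ?hN//.
rewrite [X in X <= _](_ : _ = nrm ((psqrt A x - (x - sqit A n x)) - sqit A n (psqrt A x - (x - sqit A n x)))).
  have [lY _ bY] := opb_sqit n hA.
  set w := _ - (x - _).
  have hw : nrm w <= e / 2 / 2 by rewrite nrmB ltW// hN'.
  rewrite (le_trans (nrmD _ _))// nrmN [leRHS]splitr lerD//.
  rewrite (le_trans (bY _))// (le_trans _ hw)// ler_piMl ?nrm_ge0//.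
  exact: sqitn_le1.
have [lY _ _] := opb_sqit n hA.
congr nrm; rewrite (linBB lY (psqrt A x)); apply: hdot_sep => z.
by rewrite !(hdotDl, hdotNl); ring.
Qed.

End OperatorSqrt.

(** * Two-sided square-summable sequences in a Hilbert space *)

Section SquareSummable.
Context {R : realType}.
Local Notation C := R[i].

(** The real numbers are treated apart because the normed space that provides
    completeness here has complex scalars. *)
Lemma real_cauchy (u : nat -> R) :
  (forall e, 0 < e -> exists N, forall n m, (N <= n)%N -> (N <= m)%N -> `|u n - u m| < e) ->
  exists l, forall e, 0 < e -> exists N, forall n, (N <= n)%N -> `|u n - l| < e.
Proof.
move=> h.
suff /cauchy_cvg uc : cauchy (u @ \oo).
  exists (lim (u @ \oo)) => e e0; move/cvgrPdist_lt: uc => /(_ e e0)[N _ hN].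
  by exists N => n Nn; rewrite distrC hN.
apply: cauchy_exP => e e0; have [N hN] := h e e0.
by exists (u N), N => // n /= Nn; rewrite -ball_normE/= hN.
Qed.

Lemma tends_ReIm (u : nat -> C) (a b : R) :
  (forall e, 0 < e -> exists N, forall n, (N <= n)%N -> `|complex.Re (u n) - a| < e) ->
  (forall e, 0 < e -> exists N, forall n, (N <= n)%N -> `|complex.Im (u n) - b| < e) ->
  tends u (a +i* b).
Proof.
move=> ha hb e e0; have e2 : 0 < e / 2 by rewrite divr_gt0.
have [N hN] := ha _ e2; have [N' hN'] := hb _ e2.
exists (maxn N N') => n; rewrite geq_max => /andP[Nn N'n].
rewrite (le_lt_trans (nrm_le_ReIm _))// [ltRHS]splitr.
by case: (u n) (hN n Nn) (hN' n N'n) => x y /= *; rewrite ltrD.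
Qed.

Lemma complex_ccauchy (u : nat -> C) : ccauchy u -> exists l, tends u l.
Proof.
move=> h.
have [|a ha] := @real_cauchy (fun n => complex.Re (u n)).
  move=> e /h[N hN]; exists N => n m Nn Nm; rewrite -raddfB.
  by rewrite (le_lt_trans (normRe_le _))// hN.
have [|b hb] := @real_cauchy (fun n => complex.Im (u n)).
  move=> e /h[N hN]; exists N => n m Nn Nm; rewrite -raddfB.
  by rewrite (le_lt_trans (normIm_le _))// hN.
by exists (a +i* b); exact: tends_ReIm.
Qed.

(** Pick a point of each ball of radius 1/(n+1) on which the filter
    concentrates: the points form a Cauchy sequence, and its limit is the
    limit of the filter. *)
Lemma seq_complete (V : normedModType C) :
  (forall u : nat -> V, ccauchy u -> exists l, tends u l) ->
  forall F : set_system V, ProperFilter F -> cauchy F -> cvg F.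
Proof.
move=> h F PF /cauchyP cF.
have ex n : exists x, F (ball x (n.+1%:R^-1 : C)).
  by apply: cF; rewrite /= invr_gt0.
have [u hu] := boolp.choice ex.
have inv n : (n.+1%:R^-1 : C) = (n.+1%:R^-1)%:C by rewrite fmorphV rmorph_nat.
have near_u n m : nrm (u n - u m) < n.+1%:R^-1 + m.+1%:R^-1.
  have [z [/= h1 h2]] := filter_ex (filterI (hu n) (hu m)).
  move: h1 h2; rewrite -!ball_normE/= !nrmE !inv !ltcR => h1 h2.
  by rewrite (le_lt_trans (nrm_tri _ z _))// ltrD// nrmB.
have [|l hl] := h u.
  move=> e e0; have e2 : 0 < e / 2 by rewrite divr_gt0.
  have [N hN] := invS_small e2; exists N => n m Nn Nm.
  by rewrite (lt_trans (near_u _ _))// [ltRHS]splitr ltrD// hN.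
apply/cvg_ex; exists l; apply/cvgrPdist_lt => e e0.
have ee : e = (complex.Re e)%:C by rewrite RRe_real// gtr0_real.
have e2 : 0 < complex.Re e / 2 by rewrite divr_gt0// -ltcR -ee.
have [N hN] := invS_small e2; have [N' hN'] := hl _ e2.
apply: filterS (hu (maxn N N')) => x /=; rewrite -ball_normE/= nrmE inv ltcR => hx.
rewrite nrmE ee ltcR (le_lt_trans (nrm_tri _ (u (maxn N N')) _))// [ltRHS]splitr ltrD//.
  by rewrite nrmB hN' ?leq_maxr.
by rewrite (lt_trans hx)// hN// leq_maxl.
Qed.

(** The integers from -n to n-1, listed so that passing from n to n+1 adds two
    terms. *)
Fixpoint win (n : nat) : seq int :=
  if n is m.+1 then Posz m :: Negz m :: win m else [::].

Lemma sum_win_S (V : zmodType) (F : int -> V) n :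
  \sum_(k <- win n.+1) F k = F (Posz n) + F (Negz n) + \sum_(k <- win n) F k.
Proof. by rewrite /= !big_cons addrA. Qed.

Lemma sum_win_le (F : int -> R) n m : (forall k, 0 <= F k) -> (n <= m)%N ->
  \sum_(k <- win n) F k <= \sum_(k <- win m) F k.
Proof.
move=> F0 /subnK <-; elim: (m - n)%N => // p ih.
by rewrite addSn sum_win_S (le_trans ih)// lerDr addr_ge0.
Qed.

End SquareSummable.

(** Two-sided square-summable sequences, with summability expressed by bounded
    partial sums. *)
Record l2 (R : realType) (H : hilbertType R) := L2 {
  l2fun :> int -> H;
  l2P : exists M : R, forall n, \sum_(k <- win n) nrm (l2fun k) ^+ 2 <= M }.

Section l2.
Context {R : realType} {H : hilbertType R}.
Local Notation C := R[i].
Implicit Types x y z : l2 H.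

Lemma l2_ext x y : l2fun x =1 l2fun y -> x = y.
Proof.
case: x y => [x px] [y py] /= /funext xy; subst y; congr L2; exact: Prop_irrelevance.
Qed.

Lemma l2D_subproof x y :
  exists M : R, forall n, \sum_(k <- win n) nrm (x k + y k) ^+ 2 <= M.
Proof.
have [M hM] := l2P x; have [N hN] := l2P y; exists (2 * M + 2 * N) => n.
apply: (@le_trans _ _ (\sum_(k <- win n) (2 * nrm (x k) ^+ 2 + 2 * nrm (y k) ^+ 2))).
  apply: ler_sum => k _; rewrite -mulrDr -parallelogram lerDl sqr_ge0//.
by rewrite big_split/= -!mulr_sumr lerD// ler_wpM2l.
Qed.
Definition l2D x y := L2 (l2D_subproof x y).

Lemma l2Z_subproof (a : C) x :
  exists M : R, forall n, \sum_(k <- win n) nrm (a *: x k) ^+ 2 <= M.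
Proof.
have [M hM] := l2P x; exists (nrm a ^+ 2 * M) => n.
under eq_bigr do rewrite nrmZ exprMn.
by rewrite -mulr_sumr ler_wpM2l ?sqr_ge0.
Qed.
Definition l2Z a x := L2 (l2Z_subproof a x).

Lemma l20_subproof :
  exists M : R, forall n, \sum_(k <- win n) nrm ((fun=> 0) k : H) ^+ 2 <= M.
Proof. by exists 0 => n; rewrite big1// => k _; rewrite nrm0 expr0n. Qed.
Definition l20 := L2 l20_subproof.

Lemma l2N_subproof x :
  exists M : R, forall n, \sum_(k <- win n) nrm (- x k) ^+ 2 <= M.
Proof.
have [M hM] := l2P x; exists M => n.
by under eq_bigr do rewrite nrmN.
Qed.
Definition l2N x := L2 (l2N_subproof x).

Lemma l2DA : associative l2D.
Proof. by move=> x y z; apply: l2_ext => k /=; rewrite addrA. Qed.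
Lemma l2DC : commutative l2D.
Proof. by move=> x y; apply: l2_ext => k /=; rewrite addrC. Qed.
Lemma l20D : left_id l20 l2D.
Proof. by move=> x; apply: l2_ext => k /=; rewrite add0r. Qed.
Lemma l2ND : left_inverse l20 l2N l2D.
Proof. by move=> x; apply: l2_ext => k /=; rewrite addNr. Qed.
Lemma l2ZA a b x : l2Z a (l2Z b x) = l2Z (a * b) x.
Proof. by apply: l2_ext => k /=; rewrite scalerA. Qed.
Lemma l2Z1 : left_id 1 l2Z.
Proof. by move=> x; apply: l2_ext => k /=; rewrite scale1r. Qed.
Lemma l2ZDr : right_distributive l2Z l2D.
Proof. by move=> a x y; apply: l2_ext => k /=; rewrite scalerDr. Qed.
Lemma l2ZDl x : {morph l2Z^~ x : a b / a + b >-> l2D a b}.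
Proof. by move=> a b; apply: l2_ext => k /=; rewrite scalerDl. Qed.
End l2.

HB.instance Definition _ (R : realType) (H : hilbertType R) := gen_eqMixin (l2 H).
HB.instance Definition _ (R : realType) (H : hilbertType R) := gen_choiceMixin (l2 H).
HB.instance Definition _ (R : realType) (H : hilbertType R) :=
  GRing.isZmodule.Build (l2 H) l2DA l2DC l20D l2ND.
HB.instance Definition _ (R : realType) (H : hilbertType R) :=
  GRing.Zmodule_isLmodule.Build R[i] (l2 H) l2ZA l2Z1 l2ZDr l2ZDl.

Section l2dot.
Context {R : realType} {H : hilbertType R}.
Local Notation C := R[i].
Implicit Types x y z : l2 H.

Definition l2sum x y (n : nat) : C := \sum_(k <- win n) hdot (x k) (y k).

Lemma l2sum_diag x n : l2sum x x n = (\sum_(k <- win n) nrm (x k) ^+ 2)%:C.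
Proof. by rewrite rmorph_sum; apply: eq_bigr => k _; rewrite hdot_nrm. Qed.

Lemma l2sq_cauchy x e : 0 < e -> exists N, forall n m, (N <= n)%N -> (n <= m)%N ->
  \sum_(k <- win m) nrm (x k) ^+ 2 - \sum_(k <- win n) nrm (x k) ^+ 2 < e.
Proof.
move=> e0; have [M hM] := l2P x.
pose u n := \sum_(k <- win n) nrm (x k) ^+ 2.
have hE : has_sup (range u) by split; [exists (u 0%N), 0%N|exists M => _ [n _ <-]; exact: hM].
have [_ [N _ <-] hN] := sup_adherent e0 hE.
exists N => n m Nn nm; have sm : u m <= sup (range u) by apply: ub_le_sup; [case: hE|exists m].
have : u N <= u n by apply: sum_win_le => // k; rewrite sqr_ge0.
by rewrite /u in sm hN *; lra.
Qed.

(** By |<u,v>| <= (|u|^2 + |v|^2)/2 the increments of the partial sums are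
    dominated by those of the two sums of squares. *)
Lemma l2sum_cauchy x y : ccauchy (l2sum x y).
Proof.
move=> e e0; have [N hN] := l2sq_cauchy x e0; have [N' hN'] := l2sq_cauchy y e0.
have key n m : (maxn N N' <= n)%N -> (n <= m)%N -> nrm (l2sum x y m - l2sum x y n) < e.
  rewrite geq_max => /andP[Nn N'n] nm.
  apply: (@le_lt_trans _ _ (2^-1 * (\sum_(k <- win m) nrm (x k) ^+ 2 - \sum_(k <- win n) nrm (x k) ^+ 2)
    + 2^-1 * (\sum_(k <- win m) nrm (y k) ^+ 2 - \sum_(k <- win n) nrm (y k) ^+ 2))).
    rewrite -(subnK nm); elim: (m - n)%N => [|p ih].
      by rewrite add0n !subrr nrm0 !mulr0 addr0.
    have amgm k : nrm (hdot (x k) (y k)) <= 2^-1 * nrm (x k) ^+ 2 + 2^-1 * nrm (y k) ^+ 2.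
      have := hdot_CS (x k) (y k); have := sqr_ge0 (nrm (x k) - nrm (y k)); nra.
    have := nrm_tri (l2sum x y (p.+1 + n)) (l2sum x y (p + n)) (l2sum x y n).
    have : nrm (l2sum x y (p.+1 + n) - l2sum x y (p + n)) <=
       nrm (hdot (x (Posz (p + n))) (y (Posz (p + n)))) + nrm (hdot (x (Negz (p + n))) (y (Negz (p + n)))).
      by rewrite /l2sum addSn sum_win_S addrK nrmD.
    have := amgm (Posz (p + n)); have := amgm (Negz (p + n)).
    rewrite addSn !sum_win_S; lra.
  have := hN _ _ Nn nm; have := hN' _ _ N'n nm; lra.
exists (maxn N N') => n m hn hm; have [nm|/ltnW nm] := leqP n m.
  by rewrite nrmB key.
by rewrite key.
Qed.

Definition l2dot x y : C := xget 0 [set l | tends (l2sum x y) l].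

Lemma l2dotP x y : tends (l2sum x y) (l2dot x y).
Proof. exact: (@xgetPex _ _ [set l | tends (l2sum x y) l] (complex_ccauchy (@l2sum_cauchy x y))). Qed.

Lemma l2dot_uniq x y l : tends (l2sum x y) l -> l2dot x y = l.
Proof. exact/tends_uniq/l2dotP. Qed.

Lemma l2dot_herm x y : l2dot x y = (-1) ^+ false * Num.conj (l2dot y x).
Proof.
rewrite mul1r; apply: l2dot_uniq; apply: tends_ext (tends_conj (l2dotP y x)) => n.
by rewrite /l2sum rmorph_sum; apply: eq_bigr => k _; rewrite [RHS]hdotC.
Qed.

Lemma l2dot_linl z a x y : l2dot (a *: x + y) z = a * l2dot x z + l2dot y z.
Proof.
apply: l2dot_uniq; apply: tends_ext (tendsD (tendsMl a (l2dotP x z)) (l2dotP y z)) => n.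
rewrite /l2sum mulr_sumr -big_split; apply: eq_bigr => k _ /=.
by rewrite hdotDl hdotZl.
Qed.

Lemma l2dot_linr z a x y : l2dot z (a *: x + y) = Num.conj a * l2dot z x + l2dot z y.
Proof.
rewrite l2dot_herm l2dot_linl mul1r rmorphD rmorphM.
by rewrite (l2dot_herm z x) (l2dot_herm z y) !mul1r.
Qed.

Definition l2nrm x : R := Num.sqrt (complex.Re (l2dot x x)).

(** The squared norm is the least upper bound of the partial sums of squares;
    all estimates on the norm are derived from this description. *)
Lemma l2dot_Re x : (complex.Re (l2dot x x))%:C = l2dot x x /\
  0 <= complex.Re (l2dot x x) /\
  (forall n, \sum_(k <- win n) nrm (x k) ^+ 2 <= complex.Re (l2dot x x)) /\
  (forall M : R, (forall n, \sum_(k <- win n) nrm (x k) ^+ 2 <= M) -> complex.Re (l2dot x x) <= M).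
Proof.
have t := l2dotP x x.
have t' : tends (fun n => (complex.Im (l2sum x x n))%:C : C) ((complex.Im (l2dot x x))%:C).
  apply: (tends_dom (M := 1) _ t) => n; rewrite mul1r -rmorphB nrm_real.
  by rewrite (_ : _ - _ = complex.Im (l2sum x x n - l2dot x x)) ?normIm_le// raddfB.
have im0 : complex.Im (l2dot x x) = 0.
  apply: complexI; apply: (tends_uniq t'); apply: tends_ext (tends_cst 0) => n.
  by rewrite l2sum_diag.
have rr : (complex.Re (l2dot x x))%:C = l2dot x x.
  by apply/eqP; rewrite eq_complex/= im0 !eqxx.
move: (complex.Re _) rr => r rr {t' im0}.
have le n : \sum_(k <- win n) nrm (x k) ^+ 2 <= r.
  apply/ler_addgt0Pr => e /t[N hN].
  have := hN _ (leq_maxr n N); rewrite l2sum_diag -rr -rmorphB nrm_real => /ltr_normlP[_ h].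
  have := @sum_win_le _ (fun k => nrm (x k) ^+ 2) _ _ (fun k => sqr_ge0 _) (leq_maxl n N).
  by move: h; lra.
split=> //; split; first by rewrite (le_trans _ (le 0%N))// big_nil.
split=> // M hM; apply/ler_addgt0Pr => e /t[N hN].
have := hN _ (leqnn N); rewrite l2sum_diag -rr -rmorphB nrm_real => /ltr_normlP[h h'].
have := hM N; move: h; lra.
Qed.

Lemma l2nrm_ge0 x : 0 <= l2nrm x. Proof. exact: sqrtr_ge0. Qed.

Lemma l2nrm_win x n : \sum_(k <- win n) nrm (x k) ^+ 2 <= l2nrm x ^+ 2.
Proof. by have [_ [h0 [h _]]] := l2dot_Re x; rewrite sqr_sqrtr. Qed.

Lemma l2nrm_le x M : 0 <= M -> (forall n, \sum_(k <- win n) nrm (x k) ^+ 2 <= M ^+ 2) -> l2nrm x <= M.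
Proof.
move=> M0 h; have [_ [h0 [_ h1]]] := l2dot_Re x.
by rewrite -(@ler_pXn2r _ 2) ?nnegrE ?l2nrm_ge0// sqr_sqrtr// h1.
Qed.

Lemma l2nrm_coord x k : nrm (x k) <= l2nrm x.
Proof.
rewrite -(@ler_pXn2r _ 2) ?nnegrE ?l2nrm_ge0 ?nrm_ge0//.
case: k => n; apply: le_trans (l2nrm_win x n.+1); rewrite sum_win_S.
  by rewrite -addrA lerDl addr_ge0 ?sqr_ge0// sumr_ge0// => i _; rewrite sqr_ge0.
by rewrite addrAC lerDr addr_ge0 ?sqr_ge0// sumr_ge0// => i _; rewrite sqr_ge0.
Qed.

Lemma l2nrmD x y : l2nrm (x + y) <= l2nrm x + l2nrm y.
Proof.
apply: l2nrm_le => [|n]; first by rewrite addr_ge0 ?l2nrm_ge0.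
apply: le_trans (sum_minkowski (fun k => nrm_ge0 (x k)) (fun k => nrm_ge0 (y k))
  (l2nrm_ge0 x) (l2nrm_ge0 y) (l2nrm_win x n) (l2nrm_win y n)).
by apply: ler_sum => k _; rewrite lerXn2r ?nnegrE ?addr_ge0 ?nrm_ge0// nrmD.
Qed.

Lemma l2nrm_sq x : (l2nrm x ^+ 2)%:C = l2dot x x.
Proof. by have [h [h0 _]] := l2dot_Re x; rewrite sqr_sqrtr. Qed.

Lemma l2nrmZ a x : l2nrm (a *: x) = nrm a * l2nrm x.
Proof.
suff e : (l2nrm (a *: x) ^+ 2)%:C = ((nrm a * l2nrm x) ^+ 2)%:C.
  apply/eqP; rewrite -(@eqrXn2 _ 2) ?mulr_ge0 ?nrm_ge0 ?l2nrm_ge0//; apply/eqP.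
  exact: complexI e.
rewrite l2nrm_sq exprMn rmorphM/= l2nrm_sq -nrmK.
have := l2dot_linl (a *: x) a x 0; rewrite addr0 => ->.
have := l2dot_linr x a x 0; rewrite addr0 => ->.
have z0 : l2dot x 0 = 0.
  by apply: l2dot_uniq; apply: tends_ext (tends_cst 0) => n; rewrite /l2sum big1// => k _; rewrite hdot0r.
have z1 : l2dot 0 (a *: x) = 0.
  by apply: l2dot_uniq; apply: tends_ext (tends_cst 0) => n; rewrite /l2sum big1// => k _; rewrite hdot0l.
by rewrite z0 z1 !addr0 mulrA.
Qed.

Lemma l2nrm_eq0 x : l2nrm x = 0 -> x = 0.
Proof.
move=> h; apply: l2_ext => k /=; apply: nrm_eq0; apply/eqP; rewrite eq_le nrm_ge0 andbT.
by rewrite -h l2nrm_coord.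
Qed.

Definition l2norm x : C := (l2nrm x)%:C.
Lemma l2normD x y : l2norm (x + y) <= l2norm x + l2norm y.
Proof. by rewrite -rmorphD lecR l2nrmD. Qed.
Lemma l2normZ a x : l2norm (a *: x) = `|a| * l2norm x.
Proof. by rewrite /l2norm l2nrmZ rmorphM nrmE. Qed.
Lemma l2norm_eq0 x : l2norm x = 0 -> x = 0.
Proof. by move=> /complexI/l2nrm_eq0. Qed.
Lemma l2dot_pos x : x != 0 -> 0 < l2dot x x.
Proof.
move=> x0; rewrite -l2nrm_sq ltcR exprn_gt0// lt_def l2nrm_ge0 andbT.
by apply: contra_neq x0; exact: l2nrm_eq0.
Qed.
Lemma l2dot_bilinear : bilinear_for ( *%R : GRing.Scale.law C C)
   (Num.conj \; *%R : GRing.Scale.law C C) l2dot.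
Proof. by split=> [z|z] a x y /=; rewrite ?l2dot_linl ?l2dot_linr. Qed.
End l2dot.

HB.instance Definition _ (R : realType) (H : hilbertType R) :=
  Lmodule_isNormed.Build R[i] (l2 H) l2normD l2normZ l2norm_eq0.

Lemma l2_nrmE (R : realType) (H : hilbertType R) (x : l2 H) : nrm x = l2nrm x.
Proof. by []. Qed.

(** Coordinates of a Cauchy sequence converge; finite windows of the
    coordinatewise limit inherit the bounds, which are uniform in the window.
    *)
Lemma l2_seq_complete (R : realType) (H : hilbertType R) (u : nat -> l2 H) :
  ccauchy u -> exists l, tends u l.
Proof.
move=> uc.
have ex k : exists l, tends (fun n => u n k) l.
  apply: ccauchy_tends => e /uc[N hN]; exists N => n m Nn Nm.
  by rewrite (le_lt_trans _ (hN _ _ Nn Nm))//; exact: (l2nrm_coord (u n - u m) k).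
have [l hl] := boolp.choice ex.
have bd e N : 0 < e -> (forall n m, (N <= n)%N -> (N <= m)%N -> nrm (u n - u m) < e) ->
    forall n K, (N <= n)%N -> \sum_(k <- win K) nrm (u n k - l k) ^+ 2 <= e ^+ 2.
  move=> e0 hN n K Nn.
  apply: (@tends_sqsum _ _ _ _ (fun k m => u n k - u m k) _ _ N) => [k|m Nm].
    exact/(tendsB (tends_cst _))/hl.
  apply: (le_trans (l2nrm_win (u n - u m) K)).
  by rewrite lerXn2r ?nnegrE ?l2nrm_ge0 ?(ltW e0)// ltW// hN.
have [N1 hN1] := uc 1 ltr01.
have lP : exists M : R, forall n, \sum_(k <- win n) nrm (l k) ^+ 2 <= M.
  exists (2 * l2nrm (u N1) ^+ 2 + 2 * 1) => n.
  apply: (@le_trans _ _ (\sum_(k <- win n) (2 * nrm (u N1 k) ^+ 2 + 2 * nrm (u N1 k - l k) ^+ 2))).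
    apply: ler_sum => k _; rewrite -mulrDr -parallelogram subKr lerDr sqr_ge0//.
  rewrite big_split/= -!mulr_sumr lerD// ler_wpM2l// ?l2nrm_win//.
  by have := bd 1 N1 ltr01 hN1 N1 n (leqnn _); rewrite expr1n.
exists (L2 lP) => e e0; have e2 : 0 < e / 2 by rewrite divr_gt0.
have [N hN] := uc _ e2; exists N => n Nn.
rewrite (@le_lt_trans _ _ (e / 2))//; last by rewrite ltr_pdivrMr// ltr_pMr// ltr1n.
by rewrite l2_nrmE; apply: l2nrm_le => [|K]; [exact: ltW|exact: (bd _ _ e2 hN)].
Qed.

HB.instance Definition _ (R : realType) (H : hilbertType R) :=
  Uniform_isComplete.Build (l2 H) (seq_complete (@l2_seq_complete R H)).

HB.instance Definition _ (R : realType) (H : hilbertType R) :=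
  bilinear_isBilinear.Build R[i] (l2 H) (l2 H) R[i] _ _ (@l2dot R H) l2dot_bilinear.
HB.instance Definition _ (R : realType) (H : hilbertType R) :=
  isHermitianSesquilinear.Build R[i] (l2 H) false (@Num.conj R[i]) (@l2dot R H) l2dot_herm.
HB.instance Definition _ (R : realType) (H : hilbertType R) :=
  isDotProduct.Build R[i] (l2 H) (@l2dot R H) (@l2dot_pos R H).

Lemma l2dot_norm (R : realType) (H : hilbertType R) (x : l2 H) : l2dot x x = `|x| ^+ 2.
Proof. by rewrite -l2nrm_sq nrmE rmorphXn. Qed.

Definition l2hilbert (R : realType) (H : hilbertType R) : hilbertType R :=
  @Hilbert R (l2 H) (@l2dot R H : {dot (l2 H) for @Num.conj R[i]}) (@l2dot_norm R H).

(** * Unitary dilations *)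

Section SchaefferDilation.
Context {R : realType} {H : hilbertType R}.
Local Notation C := R[i].
Context (T D D' : H -> H) (hT : opb T 1) (lD : linear D) (lD' : linear D').
Context (defect_sa : forall x y, hdot (D x) y = hdot x (D y)).
Context (defect'_sa : forall x y, hdot (D' x) y = hdot x (D' y)).
Context (defectK : forall x, D (D x) = x - adj T (T x)).
Context (defect'K : forall x, D' (D' x) = x - T (adj T x)).
Context (defect_inter : forall x, T (D x) = D' (T x)).
Context (defect_inter' : forall x, adj T (D' x) = D (adj T x)).
Local Notation K := (l2hilbert H).

Lemma hdotK_l2 (x y : K) : hdot x y = l2dot x y.
Proof. by []. Qed.

Let lT : linear T. Proof. by case: hT. Qed.
Let lTa : linear (adj T). Proof. by case: (opb_adj hT). Qed.

(** Schäffer's matrix, with the space itself at index 0. Everything is shifted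
    by one place, except that the entries at -1 and 0 are sent to 0 and 1 by
    the 2 x 2 block with rows (T, D') and (D, -T'), D and D' being the square
    roots of 1 - T'T and 1 - TT', and T' the adjoint of T. *)
Definition schU_fun (x : int -> H) (k : int) : H :=
  match k with
  | Posz 0 => T (x (Posz 0)) + D' (x (Negz 0))
  | Posz 1 => D (x (Posz 0)) - adj T (x (Negz 0))
  | Posz (m.+1) => x (Posz m)
  | Negz m => x (Negz m.+1)
  end.

(** The inverse is Schäffer's matrix for the adjoint, shifted the other way.
    *)
Definition schUi_fun (x : int -> H) (k : int) : H :=
  match k with
  | Posz 0 => adj T (x (Posz 0)) + D (x (Posz 1))
  | Posz m => x (Posz m.+1)
  | Negz 0 => D' (x (Posz 0)) - T (x (Posz 1))
  | Negz (m.+1) => x (Negz m)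
  end.

Lemma schUK x : schUi_fun (schU_fun x) =1 x.
Proof.
case=> [[|m]|[|m]] //=.
  rewrite (linDD lTa) (linBB lD) defect_inter' defectK.
  by apply: hdot_sep => z; rewrite !(hdotDl, hdotNl); ring.
rewrite (linDD lD') (linBB lT) defect_inter defect'K.
by apply: hdot_sep => z; rewrite !(hdotDl, hdotNl); by ring.
Qed.

Lemma schUiK x : schU_fun (schUi_fun x) =1 x.
Proof.
case=> [[|[|m]]|m] //=.
  rewrite (linDD lT) (linBB lD') defect_inter defect'K.
  by apply: hdot_sep => z; rewrite !(hdotDl, hdotNl); ring.
rewrite (linDD lD) (linBB lTa) defect_inter' defectK.
by apply: hdot_sep => z; rewrite !(hdotDl, hdotNl); by ring.
Qed.

(** The cross terms cancel by the intertwining relations T D = D' T and T' D'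
    = D T', and the diagonal terms by D^2 = 1 - T'T and D'^2 = 1 - TT'. *)
Lemma schU_block a b c d :
  hdot (D a - adj T b) (D c - adj T d) + hdot (T a + D' b) (T c + D' d) =
  hdot a c + hdot b d.
Proof.
rewrite !(hdotDl, hdotDr, hdotNl, hdotNr).
have -> : hdot (D a) (D c) = hdot a c - hdot (T a) (T c).
  by rewrite defect_sa defectK hdotBr (adjP hT).
have -> : hdot (D' b) (D' d) = hdot b d - hdot (adj T b) (adj T d).
  by rewrite defect'_sa defect'K hdotBr (adjP' hT).
have -> : hdot (D a) (adj T d) = hdot (T a) (D' d).
  by rewrite defect_sa -defect_inter' (adjP hT).
have -> : hdot (adj T b) (D c) = hdot (D' b) (T c).
  by rewrite -(adjP' hT) defect_inter defect'_sa.
by ring.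
Qed.

(** Because of the shift the two windows do not match; the boundary terms are
    entries far on the left, which tend to 0. *)
Lemma schU_dot_win (x y : int -> H) n :
  \sum_(k <- win n.+2) hdot (schU_fun x k) (schU_fun y k) =
  \sum_(k <- win n.+1) hdot (x k) (y k) + hdot (x (Negz n.+2)) (y (Negz n.+2))
    + hdot (x (Negz n.+1)) (y (Negz n.+1)).
Proof.
elim: n => [|n ih].
  rewrite !sum_win_S /= !big_nil !addr0 -(schU_block (x 0) (x (Negz 0))).
  by ring.
rewrite sum_win_S ih [in RHS]sum_win_S /=; by ring.
Qed.

Lemma schU_subproof (x : l2 H) :
  exists M : R, forall n, \sum_(k <- win n) nrm (schU_fun x k) ^+ 2 <= M.
Proof.
exists (3 * l2nrm x ^+ 2) => n.
apply: (@le_trans _ _ (\sum_(k <- win n.+2) nrm (schU_fun x k) ^+ 2)).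
  by apply: sum_win_le => [k|]; rewrite ?sqr_ge0// -addn2 leq_addr.
rewrite -lecR rmorph_sum /=; under eq_bigr do rewrite -hdot_nrm.
rewrite schU_dot_win !hdot_nrm.
under eq_bigr do rewrite hdot_nrm.
rewrite -rmorph_sum -!rmorphD lecR.
have h1 := l2nrm_win x n.+1.
have h2 : nrm (x (Negz n.+2)) ^+ 2 <= l2nrm x ^+ 2.
  by rewrite lerXn2r ?nnegrE ?nrm_ge0 ?l2nrm_ge0// l2nrm_coord.
have h3 : nrm (x (Negz n.+1)) ^+ 2 <= l2nrm x ^+ 2.
  by rewrite lerXn2r ?nnegrE ?nrm_ge0 ?l2nrm_ge0// l2nrm_coord.
by move: h1 h2 h3; lra.
Qed.
Definition schU (x : K) : K := L2 (schU_subproof x).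

Lemma l2_coord0 (x : l2 H) e : 0 < e -> exists N, forall n, (N <= n)%N ->
  nrm (x (Negz n)) < e.
Proof.
move=> e0; have [N hN] := l2sq_cauchy x (exprn_gt0 2 e0).
exists N => n Nn; rewrite -(@ltr_pXn2r _ 2) ?nnegrE ?nrm_ge0 ?(ltW e0)//.
have := hN _ _ Nn (leqnSn n); rewrite sum_win_S addrK.
by apply: le_lt_trans; rewrite lerDr sqr_ge0.
Qed.

Lemma tends_coordK (x y : l2 H) m :
  tends (fun n => hdot (x (Negz (n + m))) (y (Negz (n + m)))) 0.
Proof.
move=> e e0; have e1 : 0 < e / (l2nrm y + 1) by rewrite divr_gt0// ltr_wpDl ?l2nrm_ge0.
have [N hN] := l2_coord0 x e1; exists N => n Nn; rewrite subr0.
have Nnm : (N <= n + m)%N by rewrite (leq_trans Nn)// leq_addr.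
rewrite (le_lt_trans (hdot_CS _ _))//.
apply: (@le_lt_trans _ _ (nrm (x (Negz (n + m))) * (l2nrm y + 1))).
  rewrite ler_wpM2l ?nrm_ge0// (le_trans (l2nrm_coord _ _))// lerDl.
  exact: ler01.
by rewrite -ltr_pdivlMr ?hN// ltr_wpDl ?l2nrm_ge0.
Qed.

(** The boundary terms in [schU_dot_win] vanish in the limit. *)
Lemma schU_dot (x y : K) : hdot (schU x) (schU y) = hdot x y.
Proof.
rewrite !hdotK_l2.
have t1 := tends_shift (tends_shift (l2dotP (schU x) (schU y))).
apply: (tends_uniq t1).
have := tendsD (tendsD (tends_shift (l2dotP x y)) (tends_coordK x y 2)) (tends_coordK x y 1).
rewrite !addr0; apply: tends_ext => n.
by rewrite addn2 addn1; exact/esym/schU_dot_win.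
Qed.

Lemma schUi_subproof (x : l2 H) :
  exists M : R, forall n, \sum_(k <- win n) nrm (schUi_fun x k) ^+ 2 <= M.
Proof.
exists (l2nrm x ^+ 2) => n.
apply: (@le_trans _ _ (\sum_(k <- win n.+1) nrm (schUi_fun x k) ^+ 2)).
  by apply: sum_win_le => [k|]; rewrite ?sqr_ge0.
apply: le_trans (l2nrm_win x n.+2).
rewrite -lecR !rmorph_sum /=; under eq_bigr do rewrite -hdot_nrm.
under [leRHS]eq_bigr do rewrite -hdot_nrm.
have e k : hdot (x k) (x k) = hdot (schU_fun (schUi_fun x) k) (schU_fun (schUi_fun x) k).
  by rewrite schUiK.
rewrite [leRHS](eq_bigr _ (fun k _ => e k)) schU_dot_win -addrA lerDl !hdot_nrm.
by rewrite -rmorphD ler0c addr_ge0 ?sqr_ge0.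
Qed.
Definition schUi (x : K) : K := L2 (schUi_subproof x).

Lemma schU_linear : linear schU.
Proof.
move=> a x y; apply: l2_ext => -[[|[|m]]|m] //=.
  rewrite (linDD lT) (linZZ lT) (linDD lD') (linZZ lD') scalerDr.
  by rewrite addrACA.
rewrite (linDD lTa) (linZZ lTa) (linDD lD) (linZZ lD) scalerBr.
by rewrite opprD addrACA.
Qed.

Lemma schU_nrm x : nrm (schU x) = nrm x.
Proof.
apply/eqP; rewrite -(@eqrXn2 _ 2) ?nrm_ge0//; apply/eqP.
by apply: complexI; rewrite -!hdot_nrm schU_dot.
Qed.

Lemma schU_opb : opb schU 1.
Proof. by split=> [||x]; [exact: schU_linear| |rewrite schU_nrm mul1r]. Qed.

Lemma schU_adj : adj schU = schUi.
Proof.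
apply: adj_uniq => x y; rewrite -[in LHS](_ : schU (schUi y) = y) ?schU_dot//.
by apply: l2_ext => k /=; rewrite schUiK.
Qed.

Lemma schU_unitary : is_unitary_op schU.
Proof.
rewrite /is_unitary_op schU_adj; split.
- by apply/bounded_linearP; exists 1; exact: schU_opb.
- by move=> x; apply: l2_ext => k /=; rewrite schUK.
- by move=> x; apply: l2_ext => k /=; rewrite schUiK.
Qed.

Definition schV_fun (h : H) (k : int) : H := if k is Posz 0 then h else 0.

Lemma schV_win h n : \sum_(k <- win n.+1) nrm (schV_fun h k) ^+ 2 = nrm h ^+ 2.
Proof.
elim: n => [|n ih]; first by rewrite sum_win_S big_nil /= nrm0 expr0n !addr0.
by rewrite sum_win_S ih /= nrm0 expr0n !add0r.
Qed.

Lemma schV_subproof h :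
  exists M : R, forall n, \sum_(k <- win n) nrm (schV_fun h k) ^+ 2 <= M.
Proof.
exists (nrm h ^+ 2) => n; rewrite -(schV_win h n).
by apply: sum_win_le => // k; rewrite sqr_ge0.
Qed.
Definition schV (h : H) : K := L2 (schV_subproof h).

Lemma schV_dot h (x : K) : hdot (schV h) x = hdot h ((x : l2 H) (Posz 0)).
Proof.
rewrite hdotK_l2; apply: l2dot_uniq.
apply: (@tends_near _ _ (fun=> hdot h ((x : l2 H) (Posz 0))) _ _ 1%N).
  case=> // n _; rewrite /l2sum; elim: n => [|n ih].
    by rewrite sum_win_S big_nil /= hdot0l !addr0.
  by rewrite sum_win_S -ih /= !hdot0l !add0r.
exact: tends_cst.
Qed.

Lemma schV_linear : linear schV.
Proof.
by move=> a x y; apply: l2_ext => -[[|m]|m] //=; rewrite scaler0 addr0.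
Qed.

Lemma schV_isometry : is_isometry schV.
Proof. by split=> [|x y]; [exact: schV_linear|rewrite schV_dot]. Qed.

Lemma schV_adj : adj schV = fun x => (x : l2 H) (Posz 0).
Proof. by apply: adj_uniq => x y; exact: schV_dot. Qed.

(** Sequences supported on the nonnegative indices are preserved, and on them
    the entry at 0 is transformed by T alone: this is why powers are dilated
    and not only T itself. *)
Lemma schU_iter n h :
  (iter n schU (schV h) : l2 H) (Posz 0) = iter n T h /\
  (forall m, (iter n schU (schV h) : l2 H) (Negz m) = 0).
Proof.
elim: n => [//|n [ih1 ih2]]; split=> [|m] /=; last exact: ih2.
by rewrite ih1 ih2 (lin0 lD') addr0.
Qed.

Lemma schaeffer_dilation : unitary_dilation T schV schU.
Proof.
split; [exact: schV_isometry|exact: schU_unitary|].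
have pos n : iter n T = adj schV \o iter n schU \o schV.
  by apply/funext => h /=; rewrite schV_adj; have [] := schU_iter n h.
case=> n /=; first exact: pos.
rewrite -(adj_iter _ hT) -(adj_iter _ schU_opb); apply: adj_uniq => x y.
have -> : iter n.+1 T x = ((iter n.+1 schU (schV x) : K) : l2 H) (Posz 0).
  by rewrite pos /comp schV_adj.
transitivity (hdot (iter n.+1 schU (schV x)) (schV y)).
  by rewrite [RHS]hdotC schV_dot -hdotC.
by rewrite (adjP (opb_iter n.+1 schU_opb)) schV_dot /comp schV_adj.
Qed.

End SchaefferDilation.

Section DilationExists.
Context {R : realType} {H : hilbertType R}.

(** The intertwining relations hold for the defect operators because T (T'T) =
    (TT') T, with T' the adjoint, and square roots are limits of polynomials.
    *)
Lemma exists_dilation (T : H -> H) : opb T 1 ->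
  exists (K : hilbertType R) (V : H -> K) (U : K -> K), unitary_dilation T V U.
Proof.
move=> hT.
have hA : opb (adj T \o T) 1 by rewrite -(mulr1 1); exact: (opb_comp (opb_adj hT) hT).
have hB : opb (T \o adj T) 1 by rewrite -(mulr1 1); exact: (opb_comp hT (opb_adj hT)).
have [lD _ _] := opb_psqrt hA; have [lD' _ _] := opb_psqrt hB.
exists (l2hilbert H); do 2 eexists.
apply: (@schaeffer_dilation _ _ T (psqrt (adj T \o T)) (psqrt (T \o adj T))) => //.
- by apply: (psqrt_sa hA) => u v /=; rewrite -(adjP' hT) (adjP hT).
- by apply: (psqrt_sa hB) => u v /=; rewrite (adjP hT) (adjP' hT).
- by move=> x; exact: (psqrtK _ hA).
- by move=> x; exact: (psqrtK _ hB).
- by move=> x; exact: (psqrt_inter hA hB hT).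
- by move=> x; exact: (psqrt_inter hB hA (opb_adj hT)).
Qed.

End DilationExists.

(** * Continuous functions on the circle *)

Section UnitCircle.
Context {R : realType}.
Local Notation C := R[i].

Lemma circleE (z : C) : circle (z : R[i]^o) <-> nrm z = 1.
Proof.
rewrite /circle/=; split=> [h|h]; first by rewrite /nrm h.
by rewrite nrmE h.
Qed.

Lemma expi0 : expi (0 : R) = 1.
Proof. by rewrite /expi cos0 sin0. Qed.

Lemma expiD (s t : R) : expi (s + t) = expi s * expi t.
Proof.
rewrite /expi sinD cosD; apply/eqP; rewrite eq_complex /=.
by rewrite eqxx/= addrC.
Qed.

Lemma expiX (t : R) n : expi t ^+ n = expi (t *+ n).
Proof.
by elim: n => [|n ih]; rewrite ?expr0 ?mulr0n ?expi0// exprS ih -expiD -mulrS.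
Qed.

Lemma nrm_expi (t : R) : nrm (expi t) = 1.
Proof.
apply/eqP; rewrite -(@eqrXn2 _ 2) ?nrm_ge0// nrm_sqE /= cos2Dsin2.
by rewrite expr1n.
Qed.

Lemma expi_2pi : expi (2 * pi : R) = 1.
Proof. by rewrite /expi mulr_natl cos2pi sin2pi. Qed.

Lemma expi_neq1 (t : R) : 0 < t -> t < 2 * pi -> expi t != 1.
Proof.
move=> t0 t1; apply/eqP => /(congr1 (@complex.Re R))/=.
have -> : t = (t / 2) *+ 2 by rewrite -mulr_natr divfK.
rewrite cos_mulr2n => h.
have : 0 < sin (t / 2).
  apply: sin_gt0_pi; apply/andP; split; first by rewrite divr_gt0.
  by rewrite ltr_pdivrMr// mulrC.
have := cos2Dsin2 (t / 2); move: h; rewrite -mulr_natr; nra.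
Qed.

Lemma expi_continuous : continuous (expi : R -> R[i]^o).
Proof.
move=> t; apply/cvgrPdist_lt => e e0.
have ee : e = (complex.Re e)%:C by rewrite RRe_real// gtr0_real.
have e2 : 0 < complex.Re e / 2 by rewrite divr_gt0// -ltcR -ee.
have /cvgrPdist_lt/(_ _ e2) hc := @continuous_cos R t.
have /cvgrPdist_lt/(_ _ e2) hs := @continuous_sin R t.
near=> s; rewrite nrmE ee ltcR (le_lt_trans (nrm_le_ReIm _))//= [ltRHS]splitr ltrD//.
  by near: s.
by near: s.
Unshelve. all: by end_near. Qed.

(** The angle is arccos of the real part, or its reflection 2 pi - arccos,
    according to the sign of the imaginary part. *)
Lemma circle_expi (z : C) : nrm z = 1 -> exists t, 0 <= t <= 2 * pi /\ z = expi t.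
Proof.
case: z => a b h.
have h2 : a ^+ 2 + b ^+ 2 = 1 by have := nrm_sqE (a +i* b); rewrite h expr1n => ->.
have a1 : -1 <= a <= 1 by have := sqr_ge0 b; nra.
have sq : sin (acos a) = `|b|.
  by rewrite sin_acos// -h2 addrAC subrr add0r sqrtr_sqr.
have [b0|b0] := leP 0 b.
  exists (acos a); split.
    rewrite acos_ge0//=; have := acos_lepi a1; have := pi_ge0 R; lra.
  by rewrite /expi acosK// sq ger0_norm.
exists (2 * pi - acos a); split.
  have := acos_lepi a1; have := acos_ge0 a1; have := pi_ge0 R; lra.
rewrite /expi; congr (_ +i* _).
  by rewrite cosB mulr_natl cos2pi sin2pi mul1r mul0r addr0 acosK.
by rewrite sinB mulr_natl cos2pi sin2pi mul1r mul0r sub0r sq ltr0_norm// opprK.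
Qed.

Lemma circle_compact : compact (@circle R).
Proof.
have -> : @circle R = (expi : R -> R[i]^o) @` `[0, 2 * pi].
  apply/seteqP; split=> z.
    by move=> /circleE/circle_expi[t [t1 ->]]; exists t => //=; rewrite in_itv.
  by move=> [t _ <-]; apply/circleE; exact: nrm_expi.
apply: continuous_compact; last exact: segment_compact.
exact/continuous_subspaceT/expi_continuous.
Qed.

(** Uniform continuity on the circle, phrased with real tolerances. By
    compactness it is equivalent to continuity ([ucontP]); it is the form in
    which continuity is used. *)
Definition ucont (f : C -> C) := forall e : R, 0 < e -> exists2 d : R, 0 < d &
  forall z w, nrm z = 1 -> nrm w = 1 -> nrm (z - w) < d -> nrm (f z - f w) < e.

Lemma ucontP f : continuous_circle f <-> ucont f.
Proof.
split=> [cf e e0|uf]; last first.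
  apply/subspace_continuousP => z /circleE zc.
  apply/cvgrPdist_lt => e e0.
  have ee : e = (complex.Re e)%:C by rewrite RRe_real// gtr0_real.
  have [|d d0 hd] := uf (complex.Re e); first by rewrite -ltcR -ee.
  apply/nbhs_ballP; exists d%:C; first by rewrite /= ltcR.
  move=> w; rewrite -ball_normE/= nrmE ltcR => zw /circleE wc.
  by rewrite nrmE ee ltcR hd.
have cf' z : nrm z = 1 -> exists2 d : R, 0 < d & forall w, nrm w = 1 ->
    nrm (z - w) < d -> nrm (f z - f w) < e / 2.
  move=> /circleE zc; move/subspace_continuousP: cf => /(_ z zc).
  move=> /cvgrPdist_lt/(_ (e / 2)%:C).
  rewrite ltcR divr_gt0// => /(_ isT)/nbhs_ballP[d /= d0 hd].
  have dd : d = (complex.Re d)%:C by rewrite RRe_real// gtr0_real.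
  exists (complex.Re d); first by rewrite -ltcR -dd.
  move=> w /circleE wc zw; rewrite -ltcR -nrmE; apply: hd => //.
  by rewrite -ball_normE/= nrmE dd ltcR.
apply: contrapT => h.
have ex n : exists p : C * C, [/\ nrm p.1 = 1, nrm p.2 = 1, nrm (p.1 - p.2) < n.+1%:R^-1 &
    e <= nrm (f p.1 - f p.2)].
  apply: contrapT => hn; apply: h; exists n.+1%:R^-1; first by rewrite invr_gt0.
  move=> z w hz hw zw; rewrite ltNge; apply/negP => le; apply: hn.
  by exists (z, w).
have [p hp] := boolp.choice ex.
(* Pairs violating uniformity accumulate at a point of the circle, by
   compactness. *)
have [|z [zc clz]] := @circle_compact ((fun n => (p n).1 : R[i]^o) @ \oo) _.
  by exists 0%N => // n _ /=; apply/circleE; case: (hp n).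
have [d d0 hd] := cf' z (proj1 (circleE z) zc).
have [N hN] := @invS_small R (d / 2) (divr_gt0 d0 (ltr0n _ 2)).
have [||q [[n Nn <-] /=]] := clz ((fun n => (p n).1) @` [set n | (N <= n)%N]) (ball (z : R[i]^o) (d / 2)%:C).
- by exists N => // n /= Nn; exists n.
- by apply: nbhsx_ballx; rewrite ltcR divr_gt0.
rewrite -ball_normE/= nrmE ltcR => zp.
have [h1 h2 h3 h4] := hp n.
have k1 : nrm (f z - f (p n).1) < e / 2.
  by apply: hd => //; rewrite (lt_le_trans zp)// ler_pdivrMr// ler_peMr ?(ltW d0)// ler1n.
have k2 : nrm (f z - f (p n).2) < e / 2.
  apply: hd => //; rewrite (le_lt_trans (nrm_tri _ (p n).1 _))// [ltRHS]splitr ltrD//.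
  by rewrite (lt_trans h3)// hN.
have := nrm_tri (f (p n).1) (f z) (f (p n).2); rewrite (nrmB (f (p n).1) (f z)).
by move: k1 k2 h4; lra.
Qed.

Lemma ucont_bounded f : ucont f -> exists2 B : R, 0 <= B & forall z, nrm z = 1 -> nrm (f z) <= B.
Proof.
move=> uf; apply: contrapT => h.
have ex n : exists z : C, nrm z = 1 /\ n%:R <= nrm (f z).
  apply: contrapT => hn; apply: h; exists n%:R => // z hz.
  by rewrite leNgt; apply/negP => lt; apply: hn; exists z; rewrite ltW.
have [p hp] := boolp.choice ex.
have [|z [zc clz]] := @circle_compact ((fun n => p n : R[i]^o) @ \oo) _.
  by exists 0%N => // n _ /=; apply/circleE; case: (hp n).
have [d d0 hd] := uf 1 ltr01.
have [N hN] : exists N : nat, nrm (f z) + 1 <= N%:R.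
  exists (Num.truncn (nrm (f z) + 1)).+1; apply: ltW; apply: truncnS_gt.
have [||q [[n Nn <-] /=]] := clz (p @` [set n | (N <= n)%N]) (ball (z : R[i]^o) d%:C).
- by exists N => // n /= Nn; exists n.
- by apply: nbhsx_ballx; rewrite ltcR.
rewrite -ball_normE/= nrmE ltcR => zp.
have [h1 h2] := hp n.
have := hd z (p n) (proj1 (circleE z) zc) h1 zp.
have := nrm_rev (f (p n)) (f z); rewrite nrmB.
have : (N%:R : R) <= n%:R by rewrite ler_nat.
by move: h2 hN; lra.
Qed.

Lemma ucont_cst a : ucont (fun=> a).
Proof. by move=> e e0; exists 1 => // z w _ _ _; rewrite subrr nrm0. Qed.

Lemma ucont_id : ucont id.
Proof. by move=> e e0; exists e. Qed.

Lemma ucont_conj f : ucont f -> ucont (fun z => Num.conj (f z)).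
Proof.
move=> uf e /uf[d d0 hd]; exists d => // z w hz hw zw.
by rewrite -rmorphB nrm_conj hd.
Qed.

Lemma ucontD f g : ucont f -> ucont g -> ucont (fun z => f z + g z).
Proof.
move=> uf ug e e0; have e2 : 0 < e / 2 by rewrite divr_gt0.
have [d d0 hd] := uf _ e2; have [d' d0' hd'] := ug _ e2.
exists (Num.min d d'); first by rewrite lt_min d0.
move=> z w hz hw; rewrite lt_min => /andP[h1 h2].
by rewrite opprD addrACA (le_lt_trans (nrmD _ _))// [ltRHS]splitr ltrD ?hd ?hd'.
Qed.

Lemma ucontM f g : ucont f -> ucont g -> ucont (fun z => f z * g z).
Proof.
move=> uf ug e e0.
have [A A0 hA] := ucont_bounded uf; have [B B0 hB] := ucont_bounded ug.
have A1 : 0 < 2 * (A + 1) by rewrite mulr_gt0// ltr_wpDl.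
have B1 : 0 < 2 * (B + 1) by rewrite mulr_gt0// ltr_wpDl.
have [d d0 hd] := uf _ (divr_gt0 e0 B1); have [d' d0' hd'] := ug _ (divr_gt0 e0 A1).
exists (Num.min d d'); first by rewrite lt_min d0.
move=> z w hz hw; rewrite lt_min => /andP[h1 h2].
rewrite -(subrKA (f w * g z)) (le_lt_trans (nrmD _ _))// -mulrBl -mulrBr !nrmM.
have k1 := hd _ _ hz hw h1; have k2 := hd' _ _ hz hw h2.
have k3 : nrm (f z - f w) * nrm (g z) <= e / (2 * (B + 1)) * (B + 1).
  by rewrite ler_pM ?nrm_ge0 ?(ltW k1)// (le_trans (hB _ hz))// lerDl.
have k4 : nrm (f w) * nrm (g z - g w) < (A + 1) * (e / (2 * (A + 1))).
  rewrite (@le_lt_trans _ _ ((A + 1) * nrm (g z - g w)))//.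
    by rewrite ler_wpM2r ?nrm_ge0// (le_trans (hA _ hw))// lerDl.
  by rewrite ltr_pM2l// ltr_wpDl.
have e1 : e / (2 * (B + 1)) * (B + 1) = e / 2 by field; rewrite gt_eqF// ltr_wpDl.
have e3 : (A + 1) * (e / (2 * (A + 1))) = e / 2 by field; rewrite gt_eqF// ltr_wpDl.
by move: k3 k4; rewrite e1 e3; lra.
Qed.

Lemma ucont_ext f g : (forall z, nrm z = 1 -> f z = g z) -> ucont f -> ucont g.
Proof.
move=> fg uf e /uf[d d0 hd]; exists d => // z w hz hw zw.
by rewrite -!fg// hd.
Qed.

(** Integer powers on the circle, with negative ones taken from the conjugate,
    in the same way as negative powers of an operator are taken from its
    adjoint. *)
Definition zp (z : C) (k : int) : C :=
  match k with Posz n => z ^+ n | Negz n => Num.conj z ^+ n.+1 end.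

Lemma zp_nrm z k : nrm z = 1 -> nrm (zp z k) = 1.
Proof. by case: k => n h; rewrite /= nrmX ?nrm_conj h expr1n. Qed.

Lemma ucontX f n : ucont f -> ucont (fun z => f z ^+ n).
Proof.
move=> uf; elim: n => [|n ih]; first exact: ucont_cst.
by apply: ucont_ext (ucontM uf ih) => z _; rewrite exprS.
Qed.

Lemma ucont_zp k : ucont (zp ^~ k).
Proof.
by case: k => n; [exact/ucontX/ucont_id | exact/ucontX/ucont_conj/ucont_id].
Qed.

Lemma conjM1 (z : C) : nrm z = 1 -> z * Num.conj z = 1.
Proof. by move=> h; rewrite nrmK h expr1n. Qed.

Lemma zp_sub (z : C) (i l : nat) : nrm z = 1 ->
  zp z (Posz i - Posz l) = z ^+ i * Num.conj z ^+ l.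
Proof.
move=> hz; have [li|il] := leqP l i.
  rewrite subzn//= -{2}(subnK li) exprD -mulrA -exprMn conjM1// expr1n mulr1//.
have -> : (Posz i - Posz l)%R = Negz (l - i).-1.
  by rewrite NegzE prednK ?subn_gt0// -opprB subzn// ltnW.
rewrite /= prednK ?subn_gt0// -{2}(subnKC (ltnW il)) exprD mulrA -exprMn.
by rewrite conjM1// expr1n mul1r.
Qed.

Lemma zpM (z w : C) k : zp (z * w) k = zp z k * zp w k.
Proof. by case: k => n /=; rewrite ?rmorphM exprMn. Qed.

Lemma zp_conj (z : C) k : zp (Num.conj z) k = Num.conj (zp z k).
Proof. by case: k => n /=; rewrite rmorphXn. Qed.

Lemma zpX (z : C) k n : zp (z ^+ n) k = zp z k ^+ n.
Proof. by case: k => m /=; rewrite ?rmorphXn -!exprM mulnC. Qed.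

Lemma zp_addC (z : C) (k l : int) : nrm z = 1 -> zp z k * zp z l = zp z (k + l).
Proof.
move=> hz; case: k => k; case: l => l.
- by rewrite -PoszD /= exprD.
- by rewrite NegzE zp_sub.
- by rewrite NegzE addrC zp_sub// mulrC.
- have -> : (Negz k + Negz l)%R = Negz (k + l).+1.
    by rewrite !NegzE -opprD -PoszD addnS addSn.
  by rewrite /= -exprD addnS addSn.
Qed.

Lemma zp_inv (z : C) k : nrm z = 1 -> zp z k * zp (Num.conj z) k = 1.
Proof. by move=> hz; rewrite zp_conj conjM1// zp_nrm. Qed.

End UnitCircle.

Section Dirichlet.
Context {R : realType}.
Local Notation C := R[i].

(** Symmetric sums over the integers k with |k| <= m. *)
Definition dsum (V : zmodType) (m : nat) (F : int -> V) : V :=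
  F (Posz 0) + \sum_(p < m) (F (Posz p.+1) + F (Negz p)).

Lemma dsumS (V : zmodType) m (F : int -> V) :
  dsum m.+1 F = dsum m F + (F (Posz m.+1) + F (Negz m)).
Proof. by rewrite /dsum big_ord_recr/= addrA. Qed.

(** The Fejér counting identity: the differences i - l of two indices below N
    take each value k exactly N - |k| times, as do the symmetric windows of
    radius m < N. It turns Cesàro sums of Dirichlet sums into squares. *)
Lemma double_sum_dsum (V : zmodType) (F : int -> V) N :
  \sum_(i < N) \sum_(l < N) F (Posz i - Posz l) = \sum_(m < N) dsum m F.
Proof.
elim: N => [|N ih]; first by rewrite !big_ord0.
rewrite [RHS]big_ord_recr /= -ih big_ord_recr /=.
under eq_bigr do rewrite big_ord_recr/=.
rewrite big_split/= -addrA; congr (_ + _).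
rewrite big_ord_recr/= subrr addrA addrC /dsum big_split/=; congr (_ + _).
rewrite addrC; congr (_ + _).
  rewrite (reindex_inj rev_ord_inj)/=; apply: eq_bigr => i _; congr F.
  by rewrite subzn ?leq_subr// subKn// ltn_ord.
rewrite (reindex_inj rev_ord_inj)/=; apply: eq_bigr => i _; congr F.
by rewrite NegzE -opprB subzn ?leq_subr// subKn.
Qed.

Lemma dsum_eq (V : zmodType) m (F G : int -> V) :
  F =1 G -> dsum m F = dsum m G.
Proof. by move=> /funext ->. Qed.

Lemma dsum_add (V : zmodType) m (F G : int -> V) :
  dsum m (fun k => F k + G k) = dsum m F + dsum m G.
Proof.
rewrite /dsum addrACA -big_split; congr (_ + _); apply: eq_bigr => p _ /=.
by rewrite addrACA.
Qed.

Lemma dsum_morph (V W : zmodType) m (F : int -> V) (h : V -> W) :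
  (forall x y, h (x + y) = h x + h y) -> h 0 = 0 ->
  h (dsum m F) = dsum m (h \o F).
Proof.
move=> hD h0; rewrite /dsum hD /=; congr (_ + _).
elim/big_rec2: _ => [//|i x y _ <-]; by rewrite !hD.
Qed.

Lemma dsum_single (V : zmodType) m (F : int -> V) k :
  (forall l, l != k -> F l = 0) ->
  dsum m F = if (`|k| <= m)%N then F k else 0.
Proof.
move=> Fk; elim: m => [|m ih].
  rewrite /dsum big_ord0 addr0; case: ifP => [|/negbT].
    by rewrite leqn0 absz_eq0 => /eqP ->.
  by rewrite leqn0 absz_eq0 eq_sym => /Fk.
rewrite dsumS ih [in RHS]leq_eqVlt [in RHS]ltnS; case: k Fk {ih} => k Fk /=.
  rewrite (Fk (Negz m))// addr0; have [->|km] := eqVneq k m.+1.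
    by rewrite ltnn add0r.
  rewrite (Fk (Posz m.+1)) ?addr0//; by rewrite eqz_nat eq_sym.
rewrite (Fk (Posz m.+1))// add0r eqSS; have [->|km] := eqVneq k m.
  by rewrite ltnn add0r.
rewrite (Fk (Negz m)) ?addr0//; by apply: contra_neq km => -[].
Qed.

End Dirichlet.

(** * Discrete Fourier coefficients and Fejér means *)

Section RootsOfUnity.
Context {R : realType}.
Local Notation C := R[i].

Definition unity_root (M : nat) (w : C) :=
  [/\ nrm w = 1, w ^+ M = 1 & forall n, (0 < n < M)%N -> w ^+ n != 1].

Definition rootM (M : nat) : C := expi (2 * pi / M%:R).

Lemma rootMP M : (0 < M)%N -> unity_root M (rootM M).
Proof.
move=> M0; have M0' : (0 : R) < M%:R by rewrite ltr0n.
split; first exact: nrm_expi.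
  by rewrite /rootM expiX -[_ *+ _]mulr_natr divfK ?gt_eqF// expi_2pi.
move=> n /andP[n0 nM]; rewrite /rootM expiX -[_ *+ _]mulr_natr.
have n0' : (0 : R) < n%:R by rewrite ltr0n.
apply: expi_neq1; first by rewrite mulr_gt0// divr_gt0// mulr_gt0// pi_gt0.
rewrite -mulrA gtr_pMr; last by rewrite mulr_gt0// pi_gt0.
by rewrite mulrC ltr_pdivrMr// mul1r ltr_nat.
Qed.

Context (M : nat) (w : C) (hw : unity_root M w).

Let nw j : nrm (w ^+ j) = 1.
Proof. by case: hw => h _ _; rewrite nrmX h expr1n. Qed.

(** A geometric sum of the powers of zp w k, which is a nontrivial root of
    unity because 0 < |k| < M. *)
Lemma unity_root_orth k : k != 0 -> (`|k| < M)%N ->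
  \sum_(j < M) zp (w ^+ j) k = 0.
Proof.
case: hw => h1 h2 h3 k0 kM; under eq_bigr do rewrite zpX.
have u1 : zp w k - 1 != 0.
  rewrite subr_eq0; case: k k0 kM => [[//|n]|n] _ /= kM; first by rewrite h3.
  rewrite -rmorphXn; apply: contra (h3 n.+1 kM) => /eqP e.
  by rewrite -[w ^+ _]conjCK e rmorph1.
apply: (mulfI u1); rewrite mulr0 -subrX1 -zpX h2.
by rewrite (_ : zp 1 k = 1) ?subrr//; case: (k) => n /=; rewrite ?rmorph1 expr1n.
Qed.

(** Fourier coefficients computed by sampling at the powers of the M-th root
    of unity w. Finite sums replace integrals here, so that no integration of
    operator-valued functions is needed. *)
Definition dft (f : C -> C) (k : int) : C :=
  M%:R^-1 * \sum_(j < M) f (w ^+ j) * zp (Num.conj (w ^+ j)) k.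

(** Frequencies are recovered exactly as long as they differ by less than M,
    that is, without aliasing. *)
Lemma dft_zp k0 k : (0 < M)%N -> (`|k0 - k| < M)%N ->
  dft (zp ^~ k0) k = (k == k0)%:R.
Proof.
move=> M0 kM; rewrite /dft.
have e j : zp (w ^+ j) k0 * zp (Num.conj (w ^+ j)) k = zp (w ^+ j) (k0 - k).
  rewrite -[RHS]mulr1 -(zp_inv k (nw j)) mulrA zp_addC// subrK.
  by [].
under eq_bigr do rewrite e.
have M0' : (M%:R : C) != 0 by rewrite pnatr_eq0 -lt0n.
have [->|kk] := eqVneq k k0.
  rewrite subrr; under eq_bigr do rewrite /= expr0.
  by rewrite sumr_const card_ord mulVf.
by rewrite unity_root_orth ?mulr0// subr_eq0 eq_sym.
Qed.

Lemma dft_lin a f g k : dft (fun z => a * f z + g z) k = a * dft f k + dft g k.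
Proof.
rewrite /dft [a * _]mulrCA -mulrDr; congr (_ * _); rewrite mulr_sumr -big_split.
by apply: eq_bigr => j _ /=; rewrite mulrDl mulrA.
Qed.

(** Cesàro means of Fourier sums, with the monomial z^k replaced by an
    arbitrary scalar X k. Taking X k = z^k gives Fejér's approximation of a
    function, and X k = <U^k x, y> that of a matrix entry of the functional
    calculus. *)
Definition fejC (N : nat) (X : int -> C) (f : C -> C) : C :=
  N%:R^-1 * \sum_(m < N) dsum m (fun k => dft f k * X k).

Lemma dsum_eq_in (V : zmodType) m (F G : int -> V) :
  (forall k, (`|k| <= m)%N -> F k = G k) -> dsum m F = dsum m G.
Proof.
move=> FG; rewrite /dsum FG//; congr (_ + _); apply: eq_bigr => p _.
by congr (_ + _); apply: FG => /=; exact: ltn_ord.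
Qed.

(** The condition on M excludes aliasing: all frequencies met are at most N +
    |k0| - 1 apart. *)
Lemma fejC_zp N X k0 : (0 < N)%N -> (N + `|k0| <= M)%N ->
  fejC N X (zp ^~ k0) = N%:R^-1 * (X k0 *+ (N - `|k0|)).
Proof.
move=> N0 NM; congr (_ * _).
have M0 : (0 < M)%N by rewrite (leq_trans _ NM)// addn_gt0 N0.
transitivity (\sum_(m < N) (if (`|k0| <= m)%N then X k0 else 0)).
  apply: eq_bigr => m _.
  have -> : dsum m (fun k => dft (zp ^~ k0) k * X k) = dsum m (fun k => (k == k0)%:R * X k).
    apply: dsum_eq_in => k km; rewrite dft_zp//.
    apply: leq_ltn_trans (leqD_dist k0 0 k) _; rewrite subr0 sub0r abszN.
    rewrite (leq_trans _ NM)// addnC -addSn leq_add//.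
    by rewrite (leq_ltn_trans km).
  by rewrite (@dsum_single _ m _ k0) ?eqxx ?mul1r// => l /negPf ->; rewrite mul0r.
rewrite -big_mkcond/= sumr_const; congr (_ *+ _).
rewrite -sum1_card -(big_mkord (fun m => (`|k0| <= m)%N) (fun=> 1%N)).
have [kN|kN] := leqP N `|k0|.
  rewrite (eqP kN) big_nat_cond big_pred0// => m.
  by apply/negP => /andP[/andP[_ mN] km]; have := leq_trans mN (leq_trans kN km); rewrite ltnn.
rewrite (big_cat_nat _ (n := `|k0|)) ?(ltnW kN)//= big_nat_cond big_pred0; last first.
  by move=> m; apply/negP => /andP[/andP[_ mN] km]; have := leq_trans mN km; rewrite ltnn.
rewrite add0n big_nat_cond (eq_bigl (fun m => (`|k0| <= m < N)%N && true)); last first.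
  by move=> m; rewrite andbT; case: (leqP `|k0| m) => //=; rewrite ?andbT.
by rewrite -big_nat_cond sum_nat_const_nat muln1.
Qed.

(** By [double_sum_dsum] the Cesàro mean is a double sum over i, l < N, which
    becomes a square whenever X is of the form <x_i, y_l>. *)
Lemma fejC_expand N X (G : nat -> nat -> C) f :
  (forall i l : nat, X (Posz i - Posz l) = G i l) ->
  fejC N X f = (N%:R * M%:R)^-1 * \sum_(j < M) f (w ^+ j) *
    \sum_(i < N) \sum_(l < N) Num.conj (w ^+ j) ^+ i * (w ^+ j) ^+ l * G i l.
Proof.
move=> XG; rewrite /fejC -double_sum_dsum invfM -mulrA; congr (_ * _).
under eq_bigr => i _.
  under eq_bigr => l _.
    rewrite XG /dft -mulrA mulr_suml.
    under eq_bigr => j _ do rewrite zp_sub ?nrm_conj// conjCK -mulrA.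
    over.
  rewrite -mulr_sumr exchange_big/=.
  under eq_bigr => j _ do rewrite -mulr_sumr.
  over.
rewrite -mulr_sumr exchange_big/=; congr (_ * _); apply: eq_bigr => j _.
by rewrite -mulr_sumr.
Qed.

Lemma fejC_lin N X a f g :
  fejC N X (fun z => a * f z + g z) = a * fejC N X f + fejC N X g.
Proof.
rewrite /fejC [a * _]mulrCA -mulrDr; congr (_ * _); rewrite mulr_sumr -big_split.
apply: eq_bigr => m _ /=.
rewrite (@dsum_morph _ _ m _ (fun x => a * x)) ?mulr0//; last by move=> x y; rewrite mulrDr.
by rewrite -dsum_add; apply: dsum_eq => k /=; rewrite dft_lin mulrDl mulrA.
Qed.

End RootsOfUnity.

Section Fejer.
Context {R : realType}.
Local Notation C := R[i].

(** Up to normalisation the kernel is a square, hence nonnegative. *)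
Lemma fejer_scalar M w (N : nat) f (z : C) : unity_root M w -> nrm z = 1 ->
  fejC M w N (zp z) f = (N%:R * M%:R)^-1 * \sum_(j < M) f (w ^+ j) *
    (nrm (\sum_(i < N) (Num.conj (w ^+ j) * z) ^+ i) ^+ 2)%:C.
Proof.
move=> hw hz; rewrite (fejC_expand hw _ _ (G := fun i l => z ^+ i * Num.conj z ^+ l)); last first.
  by move=> i l; rewrite zp_sub.
congr (_ * _); apply: eq_bigr => j _; congr (_ * _).
rewrite -nrmK rmorph_sum mulr_suml; apply: eq_bigr => i _.
rewrite mulr_sumr; apply: eq_bigr => l _.
rewrite rmorphXn/= rmorphM/= conjCK !exprMn; ring.
Qed.

(** The kernel is nonnegative with total mass 1. At sample points closer than
    d to z the function varies little; at the others the geometric sum is at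
    most 2/d, so the kernel is of order 1/N. The threshold is uniform in the
    number of samples. *)
Lemma fejer_approx (f : C -> C) (e : R) : ucont f -> 0 < e ->
  exists N0, forall N M w z, (N0 <= N)%N -> (0 < N)%N -> (N <= M)%N ->
    unity_root M w -> nrm z = 1 -> nrm (fejC M w N (zp z) f - f z) <= e.
Proof.
move=> uf e0; have [B B0 hB] := ucont_bounded uf.
have e2 : 0 < e / 2 by rewrite divr_gt0.
have [d d0 hd] := uf _ e2.
pose Q := 8 * B / d ^+ 2.
have Q0 : 0 <= Q by rewrite divr_ge0 ?mulr_ge0 ?exprn_ge0// ltW.
exists (Num.truncn (Q / (e / 2))).+1 => N M w z N0 Np NM hw hz.
have M0 : (0 < M)%N by rewrite (leq_trans Np).
have NR : (0 : R) < N%:R by rewrite ltr0n.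
have MR : (0 : R) < M%:R by rewrite ltr0n.
set S := fun j : nat => nrm (\sum_(i < N) (Num.conj (w ^+ j) * z) ^+ i).
have mass : (N%:R * M%:R)^-1 * \sum_(j < M) S j ^+ 2 = 1 :> R.
  apply: complexI; rewrite rmorphM rmorph_sum /= fmorphV rmorphM !rmorph_nat.
  have h1 : fejC M w N (zp z) (zp ^~ (Posz 0)) = 1.
    by rewrite fejC_zp ?addn0// subn0 /= expr0 mulVf// pnatr_eq0 -lt0n.
  rewrite rmorph1 -[RHS]h1 fejer_scalar//.
  by congr (_ * _); apply: eq_bigr => j _; rewrite /= expr0 mul1r.
have nw j : nrm (w ^+ j) = 1 by case: hw => h _ _; rewrite nrmX h expr1n.
rewrite fejer_scalar//.
have -> : f z = (N%:R * M%:R)^-1 * \sum_(j < M) f z * (S j ^+ 2)%:C.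
  rewrite -mulr_sumr -rmorph_sum mulrCA.
  rewrite (_ : (N%:R * M%:R)^-1 = ((N%:R * M%:R)^-1 : R)%:C); last by rewrite fmorphV rmorphM !rmorph_nat.
  by rewrite -rmorphM mass rmorph1 mulr1.
rewrite -mulrBr -sumrB nrmM nrmV nrmM !nrm_nat.
have step (j : 'I_M) : nrm (f (w ^+ j) * (S j ^+ 2)%:C - f z * (S j ^+ 2)%:C) <=
    e / 2 * S j ^+ 2 + Q.
  rewrite -mulrBl nrmM nrm_ger0 ?sqr_ge0//.
  have [h|h] := ltP (nrm (w ^+ j - z)) d.
    by rewrite ler_wpDr// ler_wpM2r ?sqr_ge0// ltW// hd.
  apply: ler_wpDl; first by rewrite mulr_ge0 ?sqr_ge0 ?ltW.
  have h1 : nrm (f (w ^+ j) - f z) <= 2 * B.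
    by rewrite (le_trans (nrmD _ _))// nrmN mulr_natl mulr2n lerD ?hB.
  have h2 : S j * d <= 2.
    apply: (@le_trans _ _ (S j * nrm (Num.conj (w ^+ j) * z - 1))).
      rewrite ler_wpM2l ?nrm_ge0// (le_trans h)//.
      rewrite nrmB -(mul1r (nrm (z - _))) -(nw j) -(nrm_conj (w ^+ j)) -nrmM mulrBr.
      by rewrite [_ * w ^+ j]mulrC conjM1.
    rewrite mulrC -nrmM -subrX1 (le_trans (nrmD _ _))// nrmN nrm1 nrmX nrmM nrm_conj.
    by rewrite nw hz mulr1 expr1n -mulr2n.
  have h3 : S j ^+ 2 <= 4 / d ^+ 2.
    rewrite ler_pdivlMr ?exprn_gt0// -exprMn (_ : 4 = 2 ^+ 2); last by rewrite -natrX.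
    by rewrite lerXn2r ?nnegrE ?mulr_ge0 ?nrm_ge0 ?(ltW d0).
  apply: le_trans (ler_pM (nrm_ge0 _) (sqr_ge0 _) h1 h3) _.
  by rewrite /Q le_eqVlt; apply/orP; left; apply/eqP; field; rewrite gt_eqF.
apply: le_trans (ler_wpM2l _ (le_trans (nrm_sum _ _ _) (ler_sum _ (fun j _ => step j)))) _.
  by rewrite invr_ge0 mulr_ge0.
rewrite big_split/= -mulr_sumr mulrDr mulrCA mass mulr1 sumr_const card_ord.
rewrite [leRHS]splitr lerD2l.
have -> : (N%:R * M%:R)^-1 * (Q *+ M) = Q / N%:R.
  by rewrite -mulr_natr; field; rewrite !gt_eqF.
rewrite ler_pdivrMr// mulrC -ler_pdivrMr//.
apply: ltW; apply: lt_le_trans (truncnS_gt _) _.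
by rewrite ler_nat.
Qed.

(** The induction principle used for every statement about continuous
    functions on the circle: prove it for monomials, for linear combinations
    and for uniform limits. *)
Lemma trig_density (P : (C -> C) -> Prop) :
  (forall k, P (zp ^~ k)) ->
  (forall a f g, ucont f -> ucont g -> P f -> P g -> P (fun z => a * f z + g z)) ->
  (forall f, ucont f -> (forall e : R, 0 < e -> exists g, [/\ ucont g, P g &
     forall z, nrm z = 1 -> nrm (f z - g z) <= e]) -> P f) ->
  forall f, ucont f -> P f.
Proof.
move=> Pk Pl Plim f uf; apply: Plim => // e e0.
have [N0 hN] := fejer_approx uf e0.
pose UP g := ucont g /\ P g.
have UPk k : UP (zp ^~ k) by split; [exact: ucont_zp|].
have UPl a h g : UP h -> UP g -> UP (fun z => a * h z + g z).
  move=> [uh Ph] [ug Pg]; split; last exact: Pl.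
  exact/ucontD/ug/ucontM/uh/ucont_cst.
have UP0 : UP (fun=> 0).
  have := UPl (-1) _ _ (UPk 0) (UPk 0); rewrite (_ : (fun z => _) = fun=> 0)//.
  by apply/funext => z /=; rewrite expr0 mulr1 addNr.
have UPZ a h : UP h -> UP (fun z => a * h z).
  move=> hh; have := UPl a _ _ hh UP0; rewrite (_ : (fun z => _) = fun z => a * h z)//.
  by apply/funext => z; rewrite addr0.
have UPD h g : UP h -> UP g -> UP (fun z => h z + g z).
  move=> hh hg; have := UPl 1 _ _ hh hg; rewrite (_ : (fun z => _) = fun z => h z + g z)//.
  by apply/funext => z; rewrite mul1r.
have UPS n (h : 'I_n -> C -> C) : (forall i, UP (h i)) -> UP (fun z => \sum_(i < n) h i z).
  elim: n h => [|n ih] h hh.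
    by rewrite (_ : (fun z => _) = fun=> 0)//; apply/funext => z; rewrite big_ord0.
  rewrite (_ : (fun z => _) = fun z => \sum_(i < n) h (widen_ord (leqnSn n) i) z + h ord_max z).
    by apply: UPD => //; exact: ih.
  by apply/funext => z; rewrite big_ord_recr.
pose N := N0.+1; pose w := rootM N : C.
exists (fun z => fejC N w N (zp z) f).
have [] : UP (fun z => fejC N w N (zp z) f).
  apply: (UPZ); apply: (UPS) => m; apply: (UPD); first by apply: (UPZ); exact: (UPk 0).
  by apply: (UPS) => p; apply: (UPD); apply: (UPZ); [exact: (UPk (Posz p.+1))|exact: (UPk (Negz p))].
move=> ug Pg; split=> // z hz; rewrite nrmB; apply: hN => //; exact: rootMP.
Qed.

(** Equalities between functional calculi, and between integrals, are obtained
    by applying this to the difference of their matrix entries. *)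
Lemma functional_ext (L : (C -> C) -> C) (c : R) : 0 <= c ->
  (forall k, L (zp ^~ k) = 0) ->
  (forall a f g, ucont f -> ucont g -> L (fun z => a * f z + g z) = a * L f + L g) ->
  (forall f B, ucont f -> 0 <= B -> (forall z, nrm z = 1 -> nrm (f z) <= B) -> nrm (L f) <= c * B) ->
  forall f, ucont f -> L f = 0.
Proof.
move=> c0 Lk Ll Lb; apply: trig_density => // [a f g uf ug Lf Lg|f uf h].
  by rewrite Ll// Lf Lg mulr0 addr0.
apply: nrm_eq0; apply/eqP; rewrite eq_le nrm_ge0 andbT.
suff key (e : R) : 0 < e -> nrm (L f) <= 0 + e by exact/ler_addgt0Pr.
move=> e0; rewrite add0r; have c1 : 0 < c + 1 by rewrite ltr_wpDl.
have [g [ug Lg fg]] := h (e / (c + 1)) (divr_gt0 e0 c1).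
have -> : L f = L (fun z => -1 * g z + f z) by rewrite Ll// Lg mulr0 add0r.
apply: (@le_trans _ _ (c * (e / (c + 1)))).
  apply: Lb; [|by rewrite divr_ge0 ?ltW|].
    exact/ucontD/uf/ucontM/ug/ucont_cst.
  by move=> z hz; rewrite mulN1r addrC fg.
rewrite mulrCA ger_pMr// ler_pdivrMr// mul1r lerDl.
exact: ler01.
Qed.

End Fejer.

(** * The continuous functional calculus of a unitary operator *)

Section UnitaryCalculus.
Context {R : realType} {K : hilbertType R} (U : K -> K).
Local Notation C := R[i].
Context (uU : is_unitary_op U).

Lemma unitary_dot x y : hdot (U x) (U y) = hdot x y.
Proof.
case: uU => /bounded_linearP[M bU] h1 h2.
by rewrite (adjP bU) h1.
Qed.

Lemma unitary_nrm x : nrm (U x) = nrm x.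
Proof.
apply/eqP; rewrite -(@eqrXn2 _ 2) ?nrm_ge0//; apply/eqP.
by apply: complexI; rewrite -!hdot_nrm unitary_dot.
Qed.

Lemma unitary_opb : opb U 1.
Proof.
case: uU => /bounded_linearP[M [lU _ _]] _ _; split=> // x.
by rewrite unitary_nrm mul1r.
Qed.

Lemma zpower_opb k : opb (zpower U k) 1.
Proof.
case: k => n; rewrite /zpower.
  by rewrite -(expr1n _ n); exact: (opb_iter n unitary_opb).
by rewrite -(expr1n _ n.+1); exact: (opb_iter n.+1 (opb_adj unitary_opb)).
Qed.

Lemma iter_adjK n : cancel (iter n U) (iter n (adj U)).
Proof.
case: uU => _ h _; elim: n => // n ih x.
by rewrite [iter n.+1 U x]iterS iterSr h ih.
Qed.

Lemma iter_adjKV n : cancel (iter n (adj U)) (iter n U).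
Proof.
case: uU => _ _ h; elim: n => // n ih x.
by rewrite [iter n.+1 (adj U) x]iterS iterSr h ih.
Qed.

Lemma zpower_sub (i l : nat) x : zpower U (Posz i - Posz l) x = iter l (adj U) (iter i U x).
Proof.
have [li|il] := leqP l i.
  by rewrite subzn//= -{2}(subnKC li) iterD iter_adjK.
have -> : (Posz i - Posz l)%R = Negz (l - i).-1.
  by rewrite NegzE prednK ?subn_gt0// -opprB subzn// ltnW.
by rewrite /zpower prednK ?subn_gt0// -{2}(subnK (ltnW il)) iterD iter_adjK.
Qed.

(** As U is isometric, powers can be moved so that U^(i-l) has matrix entries
    <U^i x, U^l y>, the shape required by [fejC_expand]. *)
Lemma zpower_dot (i l : nat) x y :
  hdot (zpower U (Posz i - Posz l) x) y = hdot (iter i U x) (iter l U y).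
Proof.
rewrite zpower_sub -(adj_iter _ unitary_opb).
by rewrite -(adjP' (opb_iter l unitary_opb)).
Qed.

Lemma int_sub (k : int) : exists i l : nat, k = Posz i - Posz l.
Proof.
by case: k => n; [exists n, 0%N|exists 0%N, n.+1; rewrite NegzE]; rewrite ?subr0 ?sub0r.
Qed.

Lemma iter_comm a b x : iter a U (iter b (adj U) x) = iter b (adj U) (iter a U x).
Proof.
rewrite -{2}(iter_adjKV b x) -!iterD addnC iterD iter_adjK.
by [].
Qed.

Lemma zpowerD k l x : zpower U k (zpower U l x) = zpower U (k + l) x.
Proof.
have [a [b ->]] := int_sub k; have [c [d ->]] := int_sub l.
have -> : Posz a - Posz b + (Posz c - Posz d) = Posz (a + c) - Posz (b + d) :> int.
  by rewrite !PoszD opprD addrACA.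
by rewrite !zpower_sub iter_comm -!iterD.
Qed.

Lemma zpower_conj k x y : hdot (zpower U k x) y = hdot x (zpower U (- k) y).
Proof.
have [a [b ->]] := int_sub k; rewrite zpower_dot opprB.
by rewrite hdotC -zpower_dot -hdotC.
Qed.

(** Discrete Fejér means evaluated at U in place of z. *)
Definition fejU M w (N : nat) (f : C -> C) (x : K) : K :=
  N%:R^-1 *: \sum_(m < N) dsum m (fun k => dft M w f k *: zpower U k x).

Lemma hdot_dsum m (F : int -> K) y :
  hdot (dsum m F) y = dsum m (fun k => hdot (F k) y).
Proof.
by rewrite (@dsum_morph _ _ m F (fun x => hdot x y)) ?hdot0l// => u v; rewrite hdotDl.
Qed.

Lemma fejU_dot M w N f x y :
  hdot (fejU M w N f x) y = fejC M w N (fun k => hdot (zpower U k x) y) f.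
Proof.
rewrite /fejU /fejC hdotZl hdot_suml; congr (_ * _); apply: eq_bigr => m _.
by rewrite hdot_dsum; apply: dsum_eq => k; rewrite hdotZl.
Qed.

Lemma fejU_lin M w N a f g x :
  fejU M w N (fun z => a * f z + g z) x = a *: fejU M w N f x + fejU M w N g x.
Proof.
apply: hdot_sep => y.
by rewrite hdotDl hdotZl !fejU_dot fejC_lin.
Qed.

Lemma conjXK (u : C) l : Num.conj (Num.conj u ^+ l) = u ^+ l.
Proof. by rewrite rmorphXn /= conjCK. Qed.

Lemma fejU_kernel M w N f x y : unity_root M w ->
  hdot (fejU M w N f x) y = (N%:R * M%:R)^-1 * \sum_(j < M) f (w ^+ j) *
    hdot (\sum_(i < N) Num.conj (w ^+ j) ^+ i *: iter i U x)
         (\sum_(i < N) Num.conj (w ^+ j) ^+ i *: iter i U y).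
Proof.
move=> hw; rewrite fejU_dot.
rewrite (fejC_expand hw _ _ (G := fun i l => hdot (iter i U x) (iter l U y))); last first.
  by move=> i l; rewrite zpower_dot.
congr (_ * _); apply: eq_bigr => j _; congr (_ * _).
rewrite hdot_suml; apply: eq_bigr => i _; rewrite hdot_sumr; apply: eq_bigr => l _.
by rewrite hdotZl hdotZr conjXK mulrA.
Qed.

(** The kernel representation is a positive combination of inner products <S_j
    x, S_j y> whose weights for f = 1 add up to <x, y>. Hence the matrix entry
    at (x, y) is at most B (|x|^2 + |y|^2)/2, and rescaling y to the norm of x
    turns this into B |x| |y|. *)
Lemma fejU_bound M w N f x B : unity_root M w -> (0 < N)%N -> (N <= M)%N -> 0 <= B ->
  (forall z, nrm z = 1 -> nrm (f z) <= B) -> nrm (fejU M w N f x) <= B * nrm x.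
Proof.
move=> hw N0 NM B0 hB; have M0 : (0 < M)%N by rewrite (leq_trans N0).
pose S x j := \sum_(i < N) Num.conj (w ^+ j) ^+ i *: iter i U x.
have mass u : (N%:R * M%:R)^-1 * \sum_(j < M) nrm (S u j) ^+ 2 = nrm u ^+ 2 :> R.
  apply: complexI; rewrite rmorphM rmorph_sum /= fmorphV rmorphM !rmorph_nat.
  have := fejU_kernel N (zp ^~ (Posz 0)) u u hw.
  rewrite fejU_dot fejC_zp ?addn0// subn0 /= -(mulr_natl (hdot _ _) N) mulKf ?pnatr_eq0 -?lt0n//.
  rewrite hdot_nrm => ->; congr (_ * _); apply: eq_bigr => j _.
  by rewrite expr0 mul1r hdot_nrm.
have nw j : nrm (w ^+ j) = 1 by case: hw => h _ _; rewrite nrmX h expr1n.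
have key u v : nrm (hdot (fejU M w N f u) v) <= B * ((nrm u ^+ 2 + nrm v ^+ 2) / 2).
  rewrite fejU_kernel// nrmM nrmV nrmM !nrm_nat -!mass -mulrDr -mulrA mulrCA.
  rewrite ler_wpM2l ?invr_ge0 ?mulr_ge0 ?ler0n//.
  rewrite (le_trans (nrm_sum _ _ _))// -big_split/= mulr_suml mulr_sumr.
  apply: ler_sum => j _; rewrite nrmM ler_pM ?nrm_ge0 ?hB//.
  rewrite (le_trans (hdot_CS _ _))// -/(S u j) -/(S v j).
  have := sqr_ge0 (nrm (S u j) - nrm (S v j)); nra.
set y := fejU M w N f x.
have [x0|x0] := eqVneq (nrm x) 0.
  have := key x y; rewrite x0 expr0n add0r.
  have -> : y = 0; last by rewrite nrm0 mulr0.
  apply: hdot_sep => v; rewrite hdot0l fejU_dot (nrm_eq0 x0) /fejC big1 ?mulr0// => m _.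
  rewrite /dsum; have z k : zpower U k 0 = 0 by case: (zpower_opb k) => l _ _; rewrite lin0.
  by rewrite z hdot0l mulr0 add0r big1// => p _; rewrite !z !hdot0l !mulr0 addr0.
have xp : 0 < nrm x by rewrite lt_def x0 nrm_ge0.
have keyx := key x; rewrite -/y in keyx; clearbody y.
have [y0|y0] := eqVneq (nrm y) 0; first by rewrite y0 mulr_ge0 ?nrm_ge0.
have yp : 0 < nrm y by rewrite lt_def y0 nrm_ge0.
(* The bound of the mean of squares is sharp only for vectors of equal norm.
   *)
have := keyx (((nrm x / nrm y)%:C : C) *: y).
rewrite hdotZr conj_real nrmM hdot_nrm nrmZ (nrm_ger0 (sqr_ge0 (nrm y))).
rewrite (nrm_ger0 (divr_ge0 (ltW xp) (ltW yp))).
have -> : nrm x / nrm y * nrm y = nrm x by rewrite divfK.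
have -> : nrm x / nrm y * nrm y ^+ 2 = nrm x * nrm y by field.
have -> : (nrm x ^+ 2 + nrm x ^+ 2) / 2 = nrm x * nrm x by field.
by rewrite mulrCA ler_pM2l.
Qed.

(** Means of order n+1 with twice as many samples, so that a fixed frequency
    is free of aliasing once n is large. *)
Definition fejn (n : nat) (f : C -> C) (x : K) :=
  fejU (n.+1 + n.+1) (rootM (n.+1 + n.+1)) n.+1 f x.

Lemma fejn_bound n f x B : 0 <= B ->
  (forall z, nrm z = 1 -> nrm (f z) <= B) -> nrm (fejn n f x) <= B * nrm x.
Proof.
by move=> B0 hB; apply: fejU_bound => //; [exact: rootMP|exact: leq_addr].
Qed.

Lemma fejn_lin n a f g x :
  fejn n (fun z => a * f z + g z) x = a *: fejn n f x + fejn n g x.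
Proof. exact: fejU_lin. Qed.

Lemma hdotMn m (x y : K) : hdot (x *+ m) y = hdot x y *+ m.
Proof. by rewrite -scaler_nat hdotZl mulr_natl. Qed.

(** The mean of z^k is U^k with the Fejér weight 1 - |k|/(n+1). *)
Lemma fejn_zp k x : tends (fun n => fejn n (zp ^~ k) x) (zpower U k x).
Proof.
move=> e e0; have [N hN] := @invS_small R (e / (`|k|%:R * nrm x + 1))
  (divr_gt0 e0 (ltr_wpDl (mulr_ge0 (ler0n _ _) (nrm_ge0 _)) ltr01)).
exists (maxn N `|k|) => n; rewrite geq_max => /andP[Nn kn].
have kn1 : (`|k| <= n.+1)%N by rewrite leqW.
have -> : fejn n (zp ^~ k) x = n.+1%:R^-1 *: (zpower U k x *+ (n.+1 - `|k|)).
  apply: hdot_sep => y; rewrite fejU_dot fejC_zp ?leq_add2l//; last exact: rootMP.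
  by rewrite hdotZl hdotMn.
have -> : n.+1%:R^-1 *: (zpower U k x *+ (n.+1 - `|k|)) - zpower U k x =
    - (n.+1%:R^-1 * `|k|%:R) *: zpower U k x.
  rewrite -(scaler_nat _ (zpower U k x)) natrB// scalerA mulrBr mulVf ?pnatr_eq0// scalerBl scale1r.
  by rewrite addrAC subrr add0r scaleNr.
rewrite nrmZ nrmN nrmM nrmV !nrm_nat -mulrA.
have [_ _ hz] := zpower_opb k.
apply: (@le_lt_trans _ _ (n.+1%:R^-1 * (`|k|%:R * nrm x))).
  rewrite ler_wpM2l ?invr_ge0// ler_wpM2l//; have := hz x; rewrite mul1r; exact.
have h1 : n.+1%:R^-1 < e / (`|k|%:R * nrm x + 1) by exact: hN.
have p0 : 0 <= `|k|%:R * nrm x by rewrite mulr_ge0 ?nrm_ge0.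
rewrite (@le_lt_trans _ _ (n.+1%:R^-1 * (`|k|%:R * nrm x + 1)))//.
  by rewrite ler_wpM2l ?invr_ge0// lerDl.
by rewrite -ltr_pdivlMr// ltr_wpDl.
Qed.

(** Convergence on monomials and a uniform bound give convergence for every
    continuous function. *)
Lemma fejn_cvg f x : ucont f -> exists l, tends (fun n => fejn n f x) l.
Proof.
move: f; apply: trig_density => [k|a f g _ _ [l hl] [l' hl']|f uf h].
- by exists (zpower U k x); exact: fejn_zp.
- exists (a *: l + l'); apply: tends_ext (tendsD (tendsZ a hl) hl') => n.
  by rewrite fejn_lin.
apply: ccauchy_tends => e e0.
have x1 : 0 < 3 * (nrm x + 1) by rewrite mulr_gt0// ltr_wpDl ?nrm_ge0.
have [g [ug [l hl] fg]] := h (e / (3 * (nrm x + 1))) (divr_gt0 e0 x1).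
have e3 : 0 < e / 3 by rewrite divr_gt0.
have [N hN] := tends_ccauchy hl e3.
have d n : nrm (fejn n f x - fejn n g x) < e / 3.
  have -> : fejn n f x - fejn n g x = fejn n (fun z => -1 * g z + f z) x.
    by rewrite fejn_lin scaleN1r addrC.
  apply: le_lt_trans (fejn_bound n x (ltW (divr_gt0 e0 x1)) _) _.
    by move=> z hz; rewrite mulN1r addrC fg.
  have -> : e / (3 * (nrm x + 1)) * nrm x = e / 3 * (nrm x / (nrm x + 1)).
    by field; rewrite gt_eqF// ltr_wpDl ?nrm_ge0.
  by rewrite gtr_pMr// ltr_pdivrMr ?mul1r ?ltrDl// ltr_wpDl ?nrm_ge0.
exists N => n m Nn Nm.
have := nrm_tri (fejn n f x) (fejn n g x) (fejn m f x).
have := nrm_tri (fejn n g x) (fejn m g x) (fejn m f x).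
have := d n; have := d m; have := hN _ _ Nn Nm.
by rewrite (nrmB (fejn m f x)); lra.
Qed.

(** The continuous functional calculus of U, as a pointwise limit of Fejér
    means. *)
Definition calc (f : C -> C) (x : K) : K :=
  xget 0 [set l | tends (fun n => fejn n f x) l].

Lemma calcP f x : ucont f -> tends (fun n => fejn n f x) (calc f x).
Proof.
by move=> uf; exact: (@xgetPex _ _ [set l | tends (fun n => fejn n f x) l] (fejn_cvg x uf)).
Qed.

Lemma calc_lin a f g x : ucont f -> ucont g ->
  calc (fun z => a * f z + g z) x = a *: calc f x + calc g x.
Proof.
move=> uf ug; have ufg : ucont (fun z => a * f z + g z).
  exact/ucontD/ug/ucontM/uf/ucont_cst.
apply: (tends_uniq (calcP x ufg)).
by apply: tends_ext (tendsD (tendsZ a (calcP x uf)) (calcP x ug)) => n; rewrite fejn_lin.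
Qed.

Lemma calc_zp k x : calc (zp ^~ k) x = zpower U k x.
Proof. exact: (tends_uniq (calcP x (ucont_zp k)) (fejn_zp k x)). Qed.

Lemma calc_bound f x B : ucont f -> 0 <= B -> (forall z, nrm z = 1 -> nrm (f z) <= B) ->
  nrm (calc f x) <= B * nrm x.
Proof.
move=> uf B0 hB; apply: (tends_bound (calcP x uf) (N := 0%N)) => n _.
exact: fejn_bound.
Qed.

Lemma fejn_linx n f : linear (fejn n f).
Proof.
move=> a x y; apply: hdot_sep => z.
rewrite [RHS]hdotDl [in RHS]hdotZl !fejU_dot /fejC [a * _]mulrCA -mulrDr; congr (_ * _).
rewrite mulr_sumr -big_split; apply: eq_bigr => m _ /=.
rewrite (@dsum_morph _ _ m _ (fun x => a * x)) ?mulr0//; last by move=> u v; rewrite mulrDr.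
rewrite -dsum_add; apply: dsum_eq => k /=.
by case: (zpower_opb k) => l _ _; rewrite l hdotDl hdotZl; ring.
Qed.

Lemma calc_opb f B : ucont f -> 0 <= B -> (forall z, nrm z = 1 -> nrm (f z) <= B) ->
  opb (calc f) B.
Proof.
move=> uf B0 hB; apply: (@opb_tends _ _ _ (fun n => fejn n f) _ _ 0%N).
  by move=> n _; split=> // [|x]; [exact: fejn_linx|exact: fejn_bound].
by move=> x; exact: calcP.
Qed.

Lemma calc_ext f g : (forall z, nrm z = 1 -> f z = g z) -> calc f = calc g.
Proof.
move=> fg; apply/funext => x; rewrite /calc.
suff -> : (fun n => fejn n f x) = (fun n => fejn n g x) by [].
apply/funext => n; apply: hdot_sep => y; rewrite !fejU_dot /fejC; congr (_ * _).
have h := @rootMP R _ (ltn0Sn (n + n.+1)); have nw j : nrm (rootM (n.+1 + n.+1) ^+ j : C) = 1.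
  by case: h => h _ _; rewrite nrmX h expr1n.
apply: eq_bigr => m _; apply: dsum_eq => k; congr (_ * _).
by congr (_ * _); apply: eq_bigr => j _; rewrite fg.
Qed.

Lemma ucont_lin a f g : ucont f -> ucont g -> ucont (fun z : C => a * f z + g z).
Proof. by move=> uf ug; exact/ucontD/ug/ucontM/uf/ucont_cst. Qed.

Lemma lindiff (a p q r s : C) : a * p + q - (a * r + s) = a * (p - r) + (q - s).
Proof. by ring. Qed.

(** Multiplicativity is first proved against a monomial, by density in the
    other factor. *)
Lemma calc_mulz f k x : ucont f -> calc (fun z => f z * zp z k) x = calc f (zpower U k x).
Proof.
move=> uf; apply: hdot_sep => y; apply/eqP; rewrite -subr_eq0; apply/eqP; move: f uf.
apply: (@functional_ext _ _ (2 * (nrm x * nrm y))) => [|l|a f g uf ug|f B uf B0 hB].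
- by rewrite !mulr_ge0 ?nrm_ge0.
- rewrite (@calc_ext _ (zp ^~ (l + k))) => [|z hz]; last by rewrite zp_addC.
  by rewrite !calc_zp zpowerD subrr.
- have uk := ucont_zp k.
  rewrite (@calc_ext _ (fun z => a * (f z * zp z k) + g z * zp z k)); last first.
    by move=> z _; rewrite mulrDl mulrA.
  rewrite !calc_lin//; try exact: ucontM.
  by rewrite !hdotDl !hdotZl lindiff.
- rewrite (le_trans (nrmD _ _))// nrmN.
  have h1 : nrm (calc (fun z => f z * zp z k) x) <= B * nrm x.
    apply: calc_bound => //; first by apply: ucontM => //; exact: ucont_zp.
    by move=> z hz; rewrite nrmM zp_nrm// mulr1 hB.
  have h2 : nrm (calc f (zpower U k x)) <= B * nrm x.
    apply: le_trans (calc_bound _ uf B0 hB) _; rewrite ler_wpM2l//.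
    by have [_ _ h] := zpower_opb k; have := h x; rewrite mul1r.
  have -> : 2 * (nrm x * nrm y) * B = B * nrm x * nrm y + B * nrm x * nrm y by ring.
  by rewrite lerD// (le_trans (hdot_CS _ _))// ler_wpM2r ?nrm_ge0.
Qed.

(** By density in the second factor, from the case of monomials. *)
Lemma calc_mul f g x : ucont f -> ucont g -> calc (fun z => f z * g z) x = calc f (calc g x).
Proof.
move=> uf ug; apply: hdot_sep => y; apply/eqP; rewrite -subr_eq0; apply/eqP; move: g ug.
have [A A0 hA] := ucont_bounded uf.
apply: (@functional_ext _ _ (2 * (A * nrm x * nrm y))) => [|k|a g h ug uh|g B ug B0 hB].
- by rewrite !mulr_ge0 ?nrm_ge0.
- by rewrite calc_mulz// calc_zp subrr.
- rewrite (@calc_ext _ (fun z => a * (f z * g z) + f z * h z)); last first.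
    by move=> z _; rewrite mulrDr mulrCA.
  rewrite !calc_lin//; try exact: ucontM.
  have [lf _ _] := calc_opb uf A0 hA.
  by rewrite lf !hdotDl !hdotZl lindiff.
- rewrite (le_trans (nrmD _ _))// nrmN.
  have h1 : nrm (calc (fun z => f z * g z) x) <= A * B * nrm x.
    apply: calc_bound; [exact: ucontM|by rewrite mulr_ge0|].
    by move=> z hz; rewrite nrmM ler_pM ?nrm_ge0 ?hA ?hB.
  have h2 : nrm (calc f (calc g x)) <= A * B * nrm x.
    apply: le_trans (calc_bound _ uf A0 hA) _; rewrite -mulrA ler_wpM2l//.
    exact: calc_bound.
  have -> : 2 * (A * nrm x * nrm y) * B = A * B * nrm x * nrm y + A * B * nrm x * nrm y by ring.
  by rewrite lerD// (le_trans (hdot_CS _ _))// ler_wpM2r ?nrm_ge0.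
Qed.

Lemma calc_adj f : ucont f -> calc (fun z => Num.conj (f z)) = adj (calc f).
Proof.
move=> uf; apply/esym/adj_uniq => x y; apply/eqP; rewrite -subr_eq0; apply/eqP; move: f uf.
apply: (@functional_ext _ _ (2 * (nrm x * nrm y))) => [|k|a f g uf ug|f B uf B0 hB].
- by rewrite !mulr_ge0 ?nrm_ge0.
- rewrite (@calc_ext (fun z => Num.conj (zp z k)) (zp ^~ (- k))); last first.
    move=> z hz; apply: (@mulfI _ (zp z k)).
      apply/eqP => e0; move: (zp_nrm k hz); rewrite e0 nrm0 => /esym/eqP.
      by rewrite oner_eq0.
    by rewrite zp_addC// subrr /= expr0 conjM1// zp_nrm.
  by rewrite !calc_zp zpower_conj subrr.
- rewrite (@calc_ext (fun z => Num.conj (a * f z + g z)) (fun z => Num.conj a * Num.conj (f z) + Num.conj (g z))); last first.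
    by move=> z _; rewrite rmorphD rmorphM.
  rewrite !calc_lin//; try exact: ucont_conj.
  by rewrite hdotDl hdotDr hdotZl hdotZr conjCK lindiff.
- have h1 := calc_bound x uf B0 hB.
  have h2 : nrm (calc (fun z => Num.conj (f z)) y) <= B * nrm y.
    by apply: calc_bound => //; [exact: ucont_conj|move=> z hz; rewrite nrm_conj hB].
  rewrite (le_trans (nrmD _ _))// nrmN.
  have -> : 2 * (nrm x * nrm y) * B = B * nrm x * nrm y + nrm x * (B * nrm y) by ring.
  rewrite lerD// (le_trans (hdot_CS _ _))//.
    by rewrite ler_wpM2r ?nrm_ge0.
  by rewrite ler_wpM2l ?nrm_ge0.
Qed.

Lemma calc_is_calculus : continuous_calculus U calc.
Proof.
split; last split; last split; last split; last split; last split.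
- move=> f /ucontP uf; have [B B0 hB] := ucont_bounded uf.
  by apply/bounded_linearP; exists B; exact: calc_opb.
- by move=> f g _ _ fg; apply: calc_ext => z /circleE/fg.
- by apply/funext => x; rewrite (@calc_ext _ (zp ^~ (Posz 0))) ?calc_zp.
- by apply/funext => x; rewrite (@calc_ext _ (zp ^~ (Posz 1))) ?calc_zp.
- by move=> a f g /ucontP uf /ucontP ug; apply/funext => x; rewrite calc_lin.
- by move=> f g /ucontP uf /ucontP ug; apply/funext => x; rewrite calc_mul.
- by move=> f /ucontP uf; exact: calc_adj.
Qed.

Section Uniqueness.
Context (Phi : (C -> C) -> K -> K).
Context (hPhi : continuous_calculus U Phi).

Let Pb f : ucont f -> exists M, opb (Phi f) M.
Proof. by case: hPhi => h _ /ucontP/h/bounded_linearP. Qed.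

Lemma Phi_conj f : ucont f -> Phi (fun z => Num.conj (f z)) = adj (Phi f).
Proof. by case: hPhi => _ [_ [_ [_ [_ [_ h]]]]] /ucontP/h. Qed.

Lemma Phi_mul f g x : ucont f -> ucont g -> Phi (fun z => f z * g z) x = Phi f (Phi g x).
Proof. by case: hPhi => _ [_ [_ [_ [_ [h _]]]]] /ucontP uf /ucontP ug; rewrite h. Qed.

Lemma Phi_lin a f g x : ucont f -> ucont g ->
  Phi (fun z => a * f z + g z) x = a *: Phi f x + Phi g x.
Proof. by case: hPhi => _ [_ [_ [_ [h _]]]] /ucontP uf /ucontP ug; rewrite h. Qed.

Lemma Phi_ext f g : ucont f -> ucont g -> (forall z, nrm z = 1 -> f z = g z) -> Phi f = Phi g.
Proof.
by case: hPhi => _ [h _] /ucontP uf /ucontP ug fg; apply: h => // z /circleE/fg.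
Qed.

Lemma Phi_zp k : Phi (zp ^~ k) = zpower U k.
Proof.
case: (hPhi) => _ [_ [h1 [hid _]]].
have pos n : Phi (fun z => z ^+ n) = iter n U.
  elim: n => [|n ih].
    transitivity (Phi (fun=> 1)); last exact: h1.
    by apply: Phi_ext; [exact/ucontX/ucont_id|exact: ucont_cst|].
  apply/funext => x; rewrite (@Phi_ext _ (fun z => z * z ^+ n)).
  - rewrite Phi_mul; [|exact: ucont_id|exact/ucontX/ucont_id].
    by rewrite ih hid.
  - exact/ucontX/ucont_id.
  - by apply: ucontM; [exact: ucont_id|exact/ucontX/ucont_id].
  - by move=> z _; rewrite exprS.
case: k => n /=; first exact: pos.
rewrite -(adj_iter n.+1 unitary_opb) -pos -Phi_conj; last exact/ucontX/ucont_id.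
apply: Phi_ext; first exact/ucontX/ucont_conj/ucont_id.
  exact/ucont_conj/ucontX/ucont_id.
by move=> z _; rewrite rmorphXn.
Qed.

Lemma ucont_sqrt (g : C -> R) : ucont (fun z => (g z)%:C) -> (forall z, 0 <= g z) ->
  ucont (fun z => (Num.sqrt (g z))%:C).
Proof.
move=> ug g0 e e0; have [d d0 hd] := ug (e ^+ 2) (exprn_gt0 2 e0).
exists d => // z w hz hw zw; have := hd _ _ hz hw zw.
rewrite -!rmorphB !nrm_real => h.
rewrite -(@ltr_pXn2r _ 2) ?nnegrE ?(ltW e0)//; apply: le_lt_trans h.
have := g0 z; have := g0 w; move: (g z) (g w) => a b b0 a0.
have ea := sqr_sqrtr a0; have eb := sqr_sqrtr b0.
rewrite -{2}ea -{2}eb subr_sqr normrM expr2 ler_wpM2l//.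
rewrite [leRHS]ger0_norm ?addr_ge0 ?sqrtr_ge0// ler_norml.
have := sqrtr_ge0 a; have := sqrtr_ge0 b; lra.
Qed.

(** Contractivity is automatic: B^2 - |f|^2 = |s|^2 for a continuous s, whence
    |Phi f x|^2 + |Phi s x|^2 = B^2 |x|^2. *)
Lemma Phi_bound f x B : ucont f -> 0 <= B -> (forall z, nrm z = 1 -> nrm (f z) <= B) ->
  nrm (Phi f x) <= B * nrm x.
Proof.
move=> uf B0 hB.
pose g z : R := `|B ^+ 2 - nrm (f z) ^+ 2|.
have g0 z : 0 <= g z by exact: normr_ge0.
have gE z : nrm z = 1 -> (g z)%:C = -1 * (Num.conj (f z) * f z) + (B ^+ 2)%:C.
  move=> hz; rewrite /g ger0_norm; last first.
    by rewrite subr_ge0 lerXn2r ?nnegrE ?nrm_ge0// hB.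
  by rewrite [Num.conj _ * _]mulrC nrmK rmorphB mulN1r addrC.
have uff : ucont (fun z => Num.conj (f z) * f z) by apply: ucontM => //; exact: ucont_conj.
have ucB : ucont (fun=> (B ^+ 2)%:C : C) by exact: ucont_cst.
have ug : ucont (fun z => (g z)%:C).
  by apply: ucont_ext (ucont_lin (-1) uff ucB) => z hz; rewrite gE.
pose s z : C := (Num.sqrt (g z))%:C.
have us : ucont s by exact: ucont_sqrt.
have u1 : ucont (fun=> 1 : C) by exact: ucont_cst.
have uss : ucont (fun z => Num.conj (s z) * s z) by apply: ucontM => //; exact: ucont_conj.
have e1 : Phi (fun z => 1 * (Num.conj (s z) * s z) + Num.conj (f z) * f z) x =
    Phi (fun z => ((B ^+ 2)%:C - 1) * 1 + 1) x.
  congr (_ x); apply: Phi_ext; [exact: ucont_lin|exact: ucont_lin|].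
  move=> z hz; rewrite mul1r mulr1 subrK conj_real -rmorphM -expr2 sqr_sqrtr//=.
  by rewrite gE// mulN1r addrC addrA subrr add0r.
move: e1; rewrite (Phi_lin _ _ uss uff) (Phi_lin _ _ u1 u1) scale1r.
rewrite (Phi_mul x (ucont_conj us) us) (Phi_mul x (ucont_conj uf) uf).
have -> : Phi (fun=> 1) x = x by case: (hPhi) => _ [_ [-> _]].
rewrite scalerBl scale1r subrK => /(congr1 (fun v => hdot v x)).
have [Mf bf] := Pb uf; have [Ms bs] := Pb us.
rewrite (Phi_conj us) (Phi_conj uf) hdotDl hdotZl -(adjP' bs) -(adjP' bf) !hdot_nrm.
rewrite -rmorphM -rmorphD => /complexI h.
rewrite -(@ler_pXn2r _ 2) ?nnegrE ?mulr_ge0 ?nrm_ge0// exprMn -h.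
by rewrite lerDr sqr_ge0.
Qed.

(** Both calculi are contractive and agree on monomials, so their matrix
    entries agree by density. *)
Lemma calculus_uniq f : ucont f -> Phi f = calc f.
Proof.
move=> uf; apply/funext => x; apply: hdot_sep => y.
apply/eqP; rewrite -subr_eq0; apply/eqP; move: f uf.
apply: (@functional_ext _ _ (2 * (nrm x * nrm y))) => [|k|a f g uf ug|f B uf B0 hB].
- by rewrite !mulr_ge0 ?nrm_ge0.
- by rewrite Phi_zp calc_zp subrr.
- by rewrite Phi_lin// calc_lin// !hdotDl !hdotZl lindiff.
- have h1 := calc_bound x uf B0 hB; have h2 := Phi_bound x uf B0 hB.
  rewrite (le_trans (nrmD _ _))// nrmN.
  have -> : 2 * (nrm x * nrm y) * B = B * nrm x * nrm y + B * nrm x * nrm y by ring.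
  by rewrite lerD// (le_trans (hdot_CS _ _))// ler_wpM2r ?nrm_ge0.
Qed.

End Uniqueness.

Lemma unitary_calculusE f : ucont f -> unitary_calculus U f = calc f.
Proof.
move=> uf; rewrite /unitary_calculus.
apply: xget_unique; first by exists calc; split=> //; exact: calc_is_calculus.
by move=> B [Phi [hPhi ->]]; exact: calculus_uniq.
Qed.

End UnitaryCalculus.

(** * The functional calculus of a contraction *)

Section ContractionCalculus.
Context {R : realType} {H : hilbertType R} (T : H -> H) (hT : opb T 1).
Local Notation C := R[i].
Local Notation CC := (contraction_calculus T).

(** For two dilations, the compressions of the two calculi have the same value
    T^k on monomials and are bounded by the sup norm, hence agree by density.
    Fixing one dilation reduces all properties of the calculus of T to the
    unitary case. *)
Lemma contraction_calculusE : exists (K : hilbertType R) (V : H -> K) (U : K -> K),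
  [/\ unitary_dilation T V U, opb V 1 &
      forall f, ucont f -> CC f = adj V \o calc U f \o V].
Proof.
have [K [V [U hd]]] := exists_dilation hT; exists K, V, U.
have iso (K' : hilbertType R) (V' : H -> K') : is_isometry V' -> opb V' 1.
  move=> [lV dV]; split=> // x; rewrite mul1r.
  rewrite -(@ler_pXn2r _ 2) ?nnegrE ?nrm_ge0// -lecR -!hdot_nrm dV.
  exact: lexx.
have [iV uU _] := hd; split=> //; first exact: iso.
move=> f uf; rewrite /contraction_calculus.
apply: xget_unique.
  by exists K, V, U; split=> //; rewrite unitary_calculusE.
move=> A [K' [V' [U' [hd' ->]]]]; have [iV' uU' zT'] := hd'; have [_ _ zT] := hd.
have bV := iso _ _ iV; have bV' := iso _ _ iV'.
rewrite unitary_calculusE//; apply/funext => x; apply: hdot_sep => y.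
apply/eqP; rewrite -subr_eq0; apply/eqP; rewrite /= -(adjP' bV) -(adjP' bV').
move: f uf; apply: (@functional_ext _ _ (2 * (nrm x * nrm y))) => [|k|a f g uf ug|f B uf B0 hB].
- by rewrite !mulr_ge0 ?nrm_ge0.
- rewrite !calc_zp// (adjP' bV) (adjP' bV').
  have := congr1 (fun F => F x) (zT k); rewrite (zT' k) /comp => ->.
  by rewrite subrr.
- by rewrite !calc_lin// !hdotDl !hdotZl lindiff.
- rewrite (le_trans (nrmD _ _))// nrmN.
  have -> : 2 * (nrm x * nrm y) * B = B * nrm x * nrm y + B * nrm x * nrm y by ring.
  have [_ _ hV] := bV; have [_ _ hV'] := bV'.
  have h1 := hV x; have h2 := hV y; have h3 := hV' x; have h4 := hV' y.
  rewrite !mul1r in h1 h2 h3 h4.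
  rewrite lerD// (le_trans (hdot_CS _ _))// ler_pM ?nrm_ge0//.
    by rewrite (le_trans (calc_bound uU' _ uf B0 hB))// ler_wpM2l.
  by rewrite (le_trans (calc_bound uU _ uf B0 hB))// ler_wpM2l.
Qed.

Lemma ccalc_opb f B : ucont f -> 0 <= B -> (forall z, nrm z = 1 -> nrm (f z) <= B) ->
  opb (CC f) B.
Proof.
have [K [V [U [[iV uU _] bV e]]]] := contraction_calculusE => uf B0 hB.
rewrite e// -(mulr1 B) -(mul1r (B * 1)).
apply: (opb_comp (A := adj V) (B := calc U f \o V)); first exact: opb_adj.
by apply: opb_comp => //; exact: calc_opb.
Qed.

Lemma ccalc_lin a f g x : ucont f -> ucont g ->
  CC (fun z => a * f z + g z) x = a *: CC f x + CC g x.
Proof.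
have [K [V [U [[iV uU _] bV e]]]] := contraction_calculusE => uf ug.
have [lV _ _] := opb_adj bV.
rewrite !e//; last exact: ucont_lin.
by rewrite /= calc_lin// lV.
Qed.

Lemma ccalc_zp k : CC (zp ^~ k) = zpower T k.
Proof.
have [K [V [U [[iV uU zT] bV e]]]] := contraction_calculusE.
rewrite e; last exact: ucont_zp.
by rewrite zT; congr (_ \o _ \o _); apply/funext => x; exact: calc_zp.
Qed.

Lemma ccalc_dsum m (c : int -> C) x :
  CC (fun z => dsum m (fun k => c k * zp z k)) x = dsum m (fun k => c k *: zpower T k x).
Proof.
have [K [V [U [[iV uU zT] bV e]]]] := contraction_calculusE.
have u0 : ucont (fun=> 0 : C) by exact: ucont_cst.
have c0 : CC (fun=> 0) x = 0.
  have [_ _ h] : opb (CC (fun=> 0)) 0 by apply: ccalc_opb => // z _; rewrite nrm0.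
  by apply: nrm_eq0; apply/eqP; rewrite eq_le nrm_ge0 andbT (le_trans (h x))// mul0r.
have one k : CC (fun z => c k * zp z k) x = c k *: zpower T k x.
  have := ccalc_lin (c k) x (ucont_zp k) u0; rewrite ccalc_zp c0 addr0 => <-.
  by congr (CC _ x); apply/funext => z; rewrite addr0.
have uk k : ucont (fun z => c k * zp z k) by apply: ucontM; [exact: ucont_cst|exact: ucont_zp].
have add f g : ucont f -> ucont g -> CC (fun z => f z + g z) x = CC f x + CC g x.
  move=> uf ug; have := ccalc_lin 1 x uf ug; rewrite scale1r => <-.
  by congr (CC _ x); apply/funext => z; rewrite mul1r.
suff [] : ucont (fun z => dsum m (fun k => c k * zp z k)) /\
  CC (fun z => dsum m (fun k => c k * zp z k)) x = dsum m (fun k => c k *: zpower T k x) by [].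
elim: m => [|m [um ih]].
  have e0 : (fun z => dsum 0 (fun k => c k * zp z k)) = (fun z => c (Posz 0) * zp z (Posz 0)).
    by apply/funext => z; rewrite /dsum big_ord0 addr0.
  by rewrite e0; split=> //; rewrite one /dsum big_ord0 addr0.
have e1 : (fun z => dsum m.+1 (fun k => c k * zp z k)) = (fun z => dsum m (fun k => c k * zp z k) +
    (c (Posz m.+1) * zp z (Posz m.+1) + c (Negz m) * zp z (Negz m))).
  by apply/funext => z; rewrite dsumS.
rewrite e1; split; first by apply: ucontD => //; exact: ucontD.
by rewrite add ?ih//; last exact: ucontD; rewrite add// !one dsumS.
Qed.

Lemma ucont_dsum m (c : int -> C) : ucont (fun z => dsum m (fun k => c k * zp z k)).
Proof.
have uk k : ucont (fun z => c k * zp z k) by apply: ucontM; [exact: ucont_cst|exact: ucont_zp].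
elim: m => [|m um].
  by apply: ucont_ext (uk (Posz 0)) => z _; rewrite /dsum big_ord0 addr0.
by apply: ucont_ext (ucontD um (ucontD (uk (Posz m.+1)) (uk (Negz m)))) => z _; rewrite dsumS.
Qed.

(** The calculus is contractive for the sup norm, so uniform approximation of
    a function approximates the operator. *)
Lemma ccalc_approx f m (c : int -> C) (e : R) x : ucont f -> 0 <= e ->
  (forall z, nrm z = 1 -> nrm (f z - dsum m (fun k => c k * zp z k)) <= e) ->
  nrm (CC f x - dsum m (fun k => c k *: zpower T k x)) <= e * nrm x.
Proof.
move=> uf e0 h; have ud := ucont_dsum m c.
rewrite -ccalc_dsum addrC -scaleN1r -ccalc_lin//.
have [_ _ ->//] : opb (CC (fun z => -1 * dsum m (fun k => c k * zp z k) + f z)) e.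
by apply: ccalc_opb => //; [exact: ucont_lin|move=> z hz; rewrite mulN1r addrC h].
Qed.

End ContractionCalculus.

(** * Singular values of Hilbert-Schmidt operators *)

Section WeakCompactness.
Context {R : realType}.
Local Notation C := R[i].

(** The limit is the supremum of the t such that g >= t on a set of the
    ultrafilter. *)
Lemma ultra_real_lim (T : Type) (G : set_system T) (g : T -> R) (c : R) :
  UltraFilter G -> G [set x | `|g x| <= c] ->
  exists l : R, forall e : R, 0 < e -> G [set x | `|g x - l| < e].
Proof.
move=> UG Gc; have PG := @ultra_proper _ _ UG.
pose E := [set t : R | G [set x | t <= g x]].
have hE : has_sup E.
  split; first by exists (- c); apply: filterS Gc => x /=; rewrite ler_norml => /andP[].
  exists c => t /= Gt; have [x [/= h1 h2]] := filter_ex (filterI Gc Gt).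
  by rewrite (le_trans h2)// (le_trans (ler_norm _)).
exists (sup E) => e e0.
have [t Et ht] := sup_adherent e0 hE.
have nE : ~ E (sup E + e).
  move=> h; have := ub_le_sup (proj2 hE) h; by rewrite gerDl leNgt e0.
have [h|h] := in_ultra_setVsetC [set x | sup E + e <= g x] UG; first by [].
apply: filterS (filterI Et h) => x [/= h1 h2].
have {}h2 : g x < sup E + e by rewrite ltNge; apply/negP.
by rewrite ltr_norml; apply/andP; split; lra.
Qed.

Lemma ultra_complex_lim (T : Type) (G : set_system T) (g : T -> C) (c : R) :
  UltraFilter G -> G [set x | nrm (g x) <= c] ->
  exists l : C, forall e : R, 0 < e -> G [set x | nrm (g x - l) < e].
Proof.
move=> UG Gc; have PG := @ultra_proper _ _ UG.
have [|a ha] := @ultra_real_lim _ G (fun x => complex.Re (g x)) c UG.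
  by apply: filterS Gc => x /=; apply: le_trans; exact: normRe_le.
have [|b hb] := @ultra_real_lim _ G (fun x => complex.Im (g x)) c UG.
  by apply: filterS Gc => x /=; apply: le_trans; exact: normIm_le.
exists (a +i* b) => e e0; have e2 : 0 < e / 2 by rewrite divr_gt0.
apply: filterS (filterI (ha _ e2) (hb _ e2)) => x [/= h1 h2].
rewrite (le_lt_trans (nrm_le_ReIm _))// [ltRHS]splitr.
by case: (g x) h1 h2 => u v /= *; rewrite ltrD.
Qed.

Context {H K : hilbertType R}.

(** Weak compactness of the unit ball: the limits of the bounded functions x
    |-> <y, x> along the ultrafilter depend linearly and boundedly on y, and
    Riesz represents them by a vector of the ball. *)
Lemma ultra_weak_lim (G : set_system H) : UltraFilter G -> G [set x | nrm x <= 1] ->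
  exists z, nrm z <= 1 /\ forall y (e : R), 0 < e -> G [set x | nrm (hdot (x - z) y) < e].
Proof.
move=> UG G1; have PG := @ultra_proper _ _ UG.
have ex y : exists l : C, forall e : R, 0 < e -> G [set x | nrm (hdot y x - l) < e].
  apply: (@ultra_complex_lim _ _ _ (nrm y)) => //.
  by apply: filterS G1 => x /= h; rewrite (le_trans (hdot_CS _ _))// ler_piMr ?nrm_ge0.
have [phi hphi] := boolp.choice ex.
have small (a : C) : (forall e : R, 0 < e -> nrm a < e) -> a = 0.
  move=> h; apply: nrm_eq0; apply/eqP; rewrite eq_le nrm_ge0 andbT leNgt.
  by apply/negP => /h; rewrite ltxx.
have bphi y : nrm (phi y) <= 1 * nrm y.
  rewrite mul1r; suff key (e : R) : 0 < e -> nrm (phi y) <= nrm y + e by exact/ler_addgt0Pr.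
  move=> e0; have [x [/= h1 h2]] := filter_ex (filterI G1 (hphi y e e0)).
  have h3 : nrm (hdot y x) <= nrm y by rewrite (le_trans (hdot_CS _ _))// ler_piMr ?nrm_ge0.
  by have := nrm_rev (phi y) (hdot y x); rewrite nrmB; move: h2 h3; lra.
have [|z hz] := riesz (phi := phi) _ bphi.
  move=> a x y; apply/eqP; rewrite -subr_eq0; apply/eqP/small => e e0.
  have a1 : 0 < 3 * (nrm a + 1) by rewrite mulr_gt0// ltr_wpDl ?nrm_ge0.
  have [w [/= [h1 h2] h3]] := filter_ex (filterI (filterI (hphi x _ (divr_gt0 e0 a1))
    (hphi y _ (divr_gt0 e0 (ltr0n _ 3)))) (hphi (a *: x + y) _ (divr_gt0 e0 (ltr0n _ 3)))).
  have -> : phi (a *: x + y) - (a * phi x + phi y) =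
     - (hdot (a *: x + y) w - phi (a *: x + y)) + (a * (hdot x w - phi x) + (hdot y w - phi y)).
    by rewrite hdotDl hdotZl; ring.
  rewrite (le_lt_trans (nrmD _ _))// nrmN.
  have h4 : nrm (a * (hdot x w - phi x) + (hdot y w - phi y)) <= e / 3 + e / 3.
    rewrite (le_trans (nrmD _ _))// lerD//; last exact: ltW.
    rewrite nrmM (@le_trans _ _ ((nrm a + 1) * (e / (3 * (nrm a + 1)))))//.
      by rewrite ler_pM ?nrm_ge0 ?lerDl// ltW.
    have q0 : 0 < nrm a + 1 by rewrite ltr_wpDl ?nrm_ge0//.
    by move: q0; move: (nrm a + 1) => q q0; rewrite le_eqVlt; apply/orP; left; apply/eqP; field; rewrite gt_eqF.
  by move: h3 h4; lra.
exists z; split.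
  have := bphi z; rewrite hz hdot_nrm nrm_ger0 ?sqr_ge0// mul1r => h.
  by rewrite leNgt; apply/negP => lt; nra.
move=> y e e0; apply: filterS (hphi y e e0) => x /=.
by rewrite hz -hdotBr hdotC nrm_conj.
Qed.

(** Choose r nearly optimal for the supremum of the Hilbert-Schmidt sums:
    adding one more unit vector orthogonal to r increases the sum by less than
    e^2. *)
Lemma hs_tail (B : H -> K) M (e : R) : hs B M -> 0 < e ->
  exists r : seq H, orthonormal_on r id /\ forall x, (forall v, v \in r -> hdot x v = 0) ->
    nrm (B x) <= e * nrm x.
Proof.
move=> [[N bB] M0 hB] e0; have [lB _ _] := bB.
pose E := [set t : R | exists r : seq H, orthonormal_on r id /\ t = \sum_(v <- r) nrm (B v) ^+ 2].
have hE : has_sup E.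
  split; first by exists 0, [::]; split; rewrite ?big_nil.
  by exists (M ^+ 2) => _ [r [or ->]]; exact: (hB _ r id or).
have [_ [r [or ->]] hr] := sup_adherent (exprn_gt0 2 e0) hE.
exists r; split=> // x hx; have [/eqP|x0] := eqVneq (nrm x) 0.
  by move=> /eqP/nrm_eq0 ->; rewrite lin0// !nrm0 mulr0.
have xp : 0 < nrm x by rewrite lt_def x0 nrm_ge0.
pose u := (nrm x)^-1%:C *: x.
have uu : hdot u u = 1.
  by rewrite hdot_nrm nrmZ nrm_ger0 ?invr_ge0 ?nrm_ge0// mulVf// expr1n rmorph1.
have ur v : v \in r -> hdot u v = 0 by move=> vr; rewrite hdotZl hx ?mulr0.
have or' : orthonormal_on (u :: r) id.
  case: or => ur' gg; split=> /=.
    rewrite ur' andbT; apply/negP => /ur; rewrite uu => /eqP.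
    by rewrite oner_eq0.
  move=> i j; rewrite !inE => /predU1P[->|ri] /predU1P[->|rj].
  - by rewrite eqxx.
  - rewrite ur//; have [e1|//] := eqVneq u j.
    by move: (ur j rj); rewrite -e1 uu.
  - rewrite hdotC ur// rmorph0; have [e1|//] := eqVneq i u.
    by move: (ur i ri); rewrite e1 uu => /eqP; rewrite oner_eq0.
  - exact: gg.
have : \sum_(v <- u :: r) nrm (B v) ^+ 2 <= sup E.
  by apply: ub_le_sup; [case: hE|exists (u :: r)].
rewrite big_cons => h.
have : nrm (B u) <= e.
  rewrite -(@ler_pXn2r _ 2) ?nnegrE ?nrm_ge0 ?(ltW e0)//; move: h hr; lra.
rewrite linZZ// nrmZ nrm_ger0 ?invr_ge0 ?nrm_ge0//.
by rewrite ler_pdivrMl// mulrC.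
Qed.

(** Hilbert-Schmidt operators are compact: split x - z along the finite family
    of [hs_tail], where weak convergence gives norm convergence, and its
    complement, where B is small. *)
Lemma hs_weak_strong (B : H -> K) M (F : set_system H) (c : R) z : hs B M ->
  ProperFilter F -> F [set x | nrm x <= c] ->
  (forall y (e : R), 0 < e -> F [set x | nrm (hdot (x - z) y) < e]) ->
  forall e : R, 0 < e -> F [set x | nrm (B x - B z) < e].
Proof.
move=> hB PF Fc Fz e e0; have [[N bB] _ _] := hB; have [lB N0 NB] := bB.
have c1 : 0 < 2 * (`|c| + nrm z + 1).
  by rewrite mulr_gt0// ltr_wpDl// addr_ge0 ?nrm_ge0.
have [r [or hr]] := hs_tail hB (divr_gt0 e0 c1).
pose d := e / (2 * (N + 1) * (size r).+1%:R).
have N1 : 0 < 2 * (N + 1) by rewrite mulr_gt0// ltr_wpDl.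
have d0 : 0 < d by rewrite divr_gt0// mulr_gt0.
have Fr : F [set x | forall v, v \in r -> nrm (hdot (x - z) v) < d].
  elim: (r) => [|v r' ih]; first by apply: filterS filterT => x _ v.
  apply: filterS (filterI ih (Fz v d d0)) => x [/= h1 h2] w.
  by rewrite inE => /predU1P[->//|/h1].
apply: filterS (filterI Fc Fr) => x [/= xc xr].
rewrite -linBB//; set y := x - z.
have py := proj_orth or y.
have h1 : nrm (B (y - proj r id y)) <= e / (2 * (`|c| + nrm z + 1)) * (`|c| + nrm z).
  apply: (@le_trans _ _ (e / (2 * (`|c| + nrm z + 1)) * nrm (y - proj r id y))).
    apply: hr => v vr; rewrite hdotBl /proj hdot_onsum// subrr//.
  rewrite ler_wpM2l//; first by rewrite divr_ge0// ltW.
  rewrite (le_trans (nrm_subproj_le or y))//.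
  by rewrite (le_trans (nrmD _ _))// nrmN lerD2r (le_trans xc)// ler_norm.
have h2 : nrm (proj r id y) <= (size r)%:R * d.
  rewrite (le_trans (nrm_sum _ _ _))//.
  rewrite (@le_trans _ _ (\sum_(v <- r) d))//; last first.
    by rewrite big_const_seq count_predT iter_addr_0 mulr_natl.
  rewrite big_seq [leRHS]big_seq; apply: ler_sum => v vr.
  have vv : nrm v = 1.
    case: or => _ /(_ v v vr vr); rewrite eqxx hdot_nrm => /complexI h.
    by apply/eqP; rewrite -(@eqrXn2 _ 2) ?nrm_ge0// h expr1n.
  by rewrite nrmZ vv mulr1 ltW// xr.
have -> : B y = B (y - proj r id y) + B (proj r id y) by rewrite -linDD// subrK.
rewrite (le_lt_trans (nrmD _ _))// [ltRHS]splitr ltr_leD//.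
  apply: le_lt_trans h1 _.
  have -> : e / (2 * (`|c| + nrm z + 1)) * (`|c| + nrm z) = e / 2 * ((`|c| + nrm z) / (`|c| + nrm z + 1)).
    by field; rewrite gt_eqF// ltr_wpDl// addr_ge0 ?nrm_ge0.
  have q : 0 < `|c| + nrm z + 1 by rewrite ltr_wpDl// addr_ge0 ?nrm_ge0.
  by rewrite gtr_pMr ?divr_gt0// ltr_pdivrMr// mul1r ltrDl.
apply: (le_trans (NB _)); apply: (@le_trans _ _ ((N + 1) * ((size r).+1%:R * d))).
  rewrite ler_pM ?nrm_ge0 ?lerDl// (le_trans h2)// ler_wpM2r ?(ltW d0)//.
  by rewrite ler_nat.
by rewrite le_eqVlt; apply/orP; left; apply/eqP; rewrite /d; field; rewrite !gt_eqF// ltr_wpDl.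
Qed.

(** A maximising sequence for the norm of B on the unit ball has a weak limit
    along an ultrafilter, and B turns weak into strong convergence. *)
Lemma hs_attain (B : H -> K) M : hs B M ->
  exists e, nrm e <= 1 /\ forall x, nrm (B x) <= nrm (B e) * nrm x.
Proof.
move=> hB; have [[N bB] _ _] := hB; have [lB N0 NB] := bB.
pose E := [set t : R | exists x, nrm x <= 1 /\ t = nrm (B x)].
have hE : has_sup E.
  split; first by exists (nrm (B 0)), 0; rewrite nrm0; split=> //; exact: ler01.
  by exists N => _ [x [x1 ->]]; rewrite (le_trans (NB x))// ler_piMr.
have ex n : exists x, nrm x <= 1 /\ sup E - n.+1%:R^-1 < nrm (B x).
  have n0 : (0 : R) < n.+1%:R^-1 by rewrite invr_gt0.
  by have [_ [x [x1 ->]] hx] := sup_adherent n0 hE; exists x.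
have [u hu] := boolp.choice ex.
have [G [UG FG]] := @ultraFilterLemma _ (u @ \oo) _.
have PG := @ultra_proper _ _ UG.
have G1 : G [set x | nrm x <= 1] by apply: FG; exists 0%N => // n _ /=; case: (hu n).
have [z [z1 hz]] := ultra_weak_lim UG G1.
have Bz := hs_weak_strong hB PG G1 hz.
exists z; split=> //.
have supz : sup E <= nrm (B z).
  suff key (e : R) : 0 < e -> sup E <= nrm (B z) + e by exact/ler_addgt0Pr.
  move=> e0; have e2 : 0 < e / 2 by rewrite divr_gt0.
  have Ge : G [set x | sup E - e / 2 < nrm (B x)].
    have [n0 hn] := invS_small e2; apply: FG; exists n0 => // n /= nn.
    case: (hu n) => _; apply: lt_trans; rewrite ltrD2l ltrN2; exact: hn.
  have [x [/= h1 h2]] := filter_ex (filterI Ge (Bz _ e2)).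
  by have := nrm_rev (B x) (B z); move: h1 h2; lra.
move=> x; have [/eqP|x0] := eqVneq (nrm x) 0.
  by move=> /eqP/nrm_eq0 ->; rewrite lin0// !nrm0 mulr0.
have xp : 0 < nrm x by rewrite lt_def x0 nrm_ge0.
have : nrm (B ((nrm x)^-1%:C *: x)) <= sup E.
  apply: ub_le_sup; first by case: hE.
  exists ((nrm x)^-1%:C *: x); split=> //.
  by rewrite nrmZ nrm_ger0 ?invr_ge0 ?nrm_ge0// mulVf//; exact: lexx.
rewrite linZZ// nrmZ nrm_ger0 ?invr_ge0 ?nrm_ge0// ler_pdivrMl// => h.
by rewrite (le_trans h)// mulrC ler_wpM2r ?(ltW xp).
Qed.

End WeakCompactness.

Section SingularValues.
Context {R : realType} {H : hilbertType R}.
Local Notation C := R[i].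
Implicit Types B : H -> H.

(** A vector of the unit ball at which the norm of B is attained: the first
    right singular vector. *)
Definition topv B : H :=
  xget 0 [set e | nrm e <= 1 /\ forall x, nrm (B x) <= nrm (B e) * nrm x].

Lemma topvP B M : hs B M ->
  nrm (topv B) <= 1 /\ forall x, nrm (B x) <= nrm (B (topv B)) * nrm x.
Proof.
move=> /hs_attain hB.
exact: (@xgetPex _ _ [set e | nrm e <= 1 /\ forall x, nrm (B x) <= nrm (B e) * nrm x] hB).
Qed.

(** B with its leading singular component removed. *)
Definition defl B (x : H) : H := B x - hdot x (topv B) *: B (topv B).

Lemma hs_rank1 (e v : H) : hs (fun x => hdot x e *: v) (nrm e * nrm v).
Proof.
split; rewrite ?mulr_ge0 ?nrm_ge0//.
  exists (nrm e * nrm v); split; rewrite ?mulr_ge0 ?nrm_ge0//.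
    by move=> a x y; rewrite hdotDl hdotZl scalerDl scalerA.
  move=> x; rewrite nrmZ mulrAC ler_wpM2r ?nrm_ge0// mulrC; exact: hdot_CS.
move=> I r g og; under eq_bigr do rewrite nrmZ exprMn.
rewrite -mulr_suml exprMn ler_wpM2r ?sqr_ge0//.
by under eq_bigr do rewrite hdotC nrm_conj; exact: bessel.
Qed.

Lemma hs_defl B M : hs B M -> exists M', hs (defl B) M'.
Proof.
move=> hB; exists (M + nrm (topv B) * nrm (B (topv B))).
by apply: hsD => //; apply: hsN; exact: hs_rank1.
Qed.

Section step.
Context B M (hB : hs B M).
Local Notation e := (topv B).
Let lB : linear B. Proof. by case: hB => -[N []]. Qed.

Lemma topv_nrm : nrm (B e) != 0 -> nrm e = 1.
Proof.
move=> s0; have [e1 h] := topvP hB; apply/eqP; rewrite eq_le e1/= leNgt; apply/negP => lt.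
have := h e; rewrite leNgt => /negP; apply.
by rewrite gtr_pMr// lt_def s0 nrm_ge0.
Qed.

Lemma topv_dot : nrm (B e) != 0 -> hdot e e = 1.
Proof. by move=> /topv_nrm h; rewrite hdot_nrm h expr1n rmorph1. Qed.

(** First order condition at the maximum: perturbing the maximiser e by a
    small multiple of x, chosen with the phase that makes the cross term
    positive, would increase the ratio of norms if <B x, B e> were not 0. *)
Lemma topv_orth x : hdot x e = 0 -> hdot (B x) (B e) = 0.
Proof.
move=> xe; have [e1 h] := topvP hB; set d := hdot (B x) (B e).
pose k := nrm (B e) ^+ 2 * nrm x ^+ 2.
have k0 : 0 <= k by rewrite mulr_ge0 ?sqr_ge0.
have k1 : 0 < k + 1 by rewrite ltr_wpDl.
(* Since t k <= 1, the second order term t^2 k |d|^2 cannot compensate the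
   first order term 2 t |d|^2. *)
pose t := (k + 1)^-1; have t0 : 0 < t by rewrite invr_gt0.
pose c : C := t%:C * Num.conj d.
have : nrm (B (c *: x + e)) ^+ 2 <= (nrm (B e) * nrm (c *: x + e)) ^+ 2.
  by rewrite lerXn2r ?nnegrE ?mulr_ge0 ?nrm_ge0.
rewrite lB exprMn !nrmD_sq !hdotZl xe mulr0 /= mulr0 addr0 -/d.
have -> : complex.Re (c * d) = t * nrm d ^+ 2.
  by rewrite /c -mulrA (mulrC (Num.conj d)) nrmK -rmorphM.
rewrite !nrmZ nrmM nrm_conj (nrm_ger0 (ltW t0)) => hh.
have e2 : nrm e ^+ 2 <= 1 by rewrite expr_le1 ?nrm_ge0.
have hh' : 2 * (t * nrm d ^+ 2) <= (t * nrm d) ^+ 2 * k.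
  have : nrm (B e) ^+ 2 * nrm e ^+ 2 <= nrm (B e) ^+ 2 by rewrite ler_piMr ?sqr_ge0.
  have := sqr_ge0 (t * nrm d * nrm (B x)).
  move: hh; rewrite /k mulrDr !exprMn !mulrA; lra.
apply: nrm_eq0; apply/eqP; rewrite -sqrf_eq0 eq_le sqr_ge0 andbT.
have tk : t * k <= 1 by rewrite mulrC ler_pdivrMr// mul1r lerDl; exact: ler01.
have : t * nrm d ^+ 2 * (2 - t * k) <= 0.
  by rewrite mulrBr subr_le0; move: hh'; rewrite exprMn; nra.
have p : 0 < 2 - t * k by lra.
by rewrite pmulr_lle0// pmulr_rle0.
Qed.

(** The component of y along e must vanish, since B maps the rest to the
    orthogonal complement of B e. *)
Lemma topv_ker y : nrm (B e) != 0 -> B y = 0 -> hdot y e = 0.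
Proof.
move=> s0 By0.
have := @topv_orth (y - hdot y e *: e).
rewrite hdotBl hdotZl topv_dot// mulr1 subrr => /(_ erefl).
rewrite linBB// linZZ// By0 sub0r hdotNl hdotZl hdot_nrm => /eqP.
rewrite oppr_eq0 mulf_eq0 => /orP[/eqP//|/eqP/complexI/eqP].
by rewrite sqrf_eq0 (negPf s0).
Qed.

Lemma defl_ker y : B y = 0 -> defl B y = 0.
Proof.
move=> By0; rewrite /defl By0 sub0r; have [s0|s0] := eqVneq (nrm (B e)) 0.
  by rewrite (nrm_eq0 s0) scaler0 oppr0.
by rewrite topv_ker// scale0r oppr0.
Qed.

Lemma defl_topv : defl B e = 0.
Proof.
rewrite /defl; have [s0|s0] := eqVneq (nrm (B e)) 0.
  by rewrite (nrm_eq0 s0) scaler0 subr0.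
by rewrite topv_dot// scale1r subrr.
Qed.

Lemma defl_orth x : hdot (defl B x) (B e) = 0.
Proof.
have [s0|s0] := eqVneq (nrm (B e)) 0; first by rewrite (nrm_eq0 s0) hdot0r.
rewrite /defl -linZZ// -linBB//; apply: topv_orth.
by rewrite hdotBl hdotZl topv_dot// mulr1 subrr.
Qed.

Lemma defl_nrm x : nrm (defl B x) <= nrm (B e) * nrm x.
Proof.
have [e1 h] := topvP hB; have [s0|s0] := eqVneq (nrm (B e)) 0.
  by rewrite /defl (nrm_eq0 s0) scaler0 subr0 nrm0 mul0r (le_trans (h x))// s0 mul0r.
rewrite /defl -linZZ// -linBB// (le_trans (h _))// ler_wpM2l ?nrm_ge0//.
have og : orthonormal_on [:: e] id.
  by split=> // i j; rewrite !inE => /eqP -> /eqP ->; rewrite topv_dot// eqxx.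
by have := nrm_subproj_le og x; rewrite /proj big_seq1.
Qed.

End step.

Section svd.
Context B M (hB : hs B M).

Let Bn n := iter n defl B.
Let e n := topv (Bn n).
Let s n := nrm (Bn n (e n)).
Let f n := (s n)^-1%:C *: Bn n (e n).

Lemma svd_hs n : exists M', hs (Bn n) M'.
Proof. by elim: n => [|n [M' h]]; [exists M|exact: hs_defl h]. Qed.

Lemma svd_ker m n y : (m <= n)%N -> Bn m y = 0 -> Bn n y = 0.
Proof.
move=> /subnK <-; elim: (n - m)%N => // k ih /ih h.
by have [M' h'] := svd_hs (k + m); rewrite addSn; exact: (defl_ker h').
Qed.

Lemma svd_kere m n : (m < n)%N -> Bn n (e m) = 0.
Proof.
move=> mn; apply: (svd_ker mn); have [M' h'] := svd_hs m; exact: (defl_topv h').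
Qed.

Lemma svd_orth_ran m n v : (m <= n)%N -> (forall x, hdot (Bn m x) v = 0) ->
  forall x, hdot (Bn n x) v = 0.
Proof.
move=> /subnK <-; elim: (n - m)%N => // k ih h x.
by rewrite addSn /Bn /= /defl hdotBl hdotZl !ih// mulr0 subr0.
Qed.

(** Later deflations vanish on earlier vectors e_m and have range orthogonal
    to earlier f_m, while each e_n is orthogonal to the kernel of the n-th
    deflation. *)
Lemma svd_ortho m n : s m != 0 -> s n != 0 ->
  hdot (e m) (e n) = (m == n)%:R /\ hdot (f m) (f n) = (m == n)%:R.
Proof.
wlog mn : m n / (m <= n)%N => [hw sm sn|sm sn].
  have [/hw|/ltnW/hw] := leqP m n; first exact.
  move=> /(_ sn sm)[h1 h2]; rewrite hdotC h1 (hdotC (f m)) h2 eq_sym.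
  by rewrite rmorph_nat.
have [M' hn] := svd_hs n.
have [<-|ne] := eqVneq m n.
  split; first by have [M'' hm] := svd_hs m; exact: (topv_dot hm).
  rewrite hdot_nrm nrmZ nrm_ger0 ?invr_ge0 ?nrm_ge0// mulVf//.
  by rewrite expr1n rmorph1.
have {ne} mn' : (m < n)%N by rewrite ltn_neqAle ne.
split; first by apply: (topv_ker hn sn); exact: svd_kere.
rewrite hdotZl hdotZr hdotC (_ : hdot (Bn n (e n)) _ = 0) ?rmorph0 ?mulr0//.
apply: (svd_orth_ran mn') => x.
by have [M'' hm] := svd_hs m; exact: (defl_orth hm).
Qed.

Lemma svd_partial n x :
  \sum_(0 <= k < n) ((s k)%:C * hdot x (e k)) *: f k = B x - Bn n x.
Proof.
elim: n => [|n ih]; first by rewrite big_geq// subrr.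
rewrite big_nat_recr//= ih /defl -/(e n) -/(Bn n) opprB addrA [RHS]addrAC; congr (_ + _).
rewrite /f scalerA mulrAC -rmorphM /=; have [s0|s0] := eqVneq (s n) 0.
  by rewrite s0 mul0r rmorph0 mul0r (nrm_eq0 s0) !scaler0.
by rewrite divff// rmorph1 mul1r.
Qed.

Lemma svd_mono : nonincreasing_seq s.
Proof.
apply/nonincreasing_seqP => n.
have [M1 h1] := svd_hs n; have [M2 h2] := svd_hs n.+1.
have [e1 _] := topvP h2.
have := defl_nrm h1 (e n.+1); rewrite -/(Bn n) -/(e n) -/(s n) => h.
by rewrite (le_trans h)// ler_piMr ?nrm_ge0.
Qed.

(** The n-th deflation differs from B by components along the earlier e_k,
    which are orthogonal to e_n; so the singular values can be read off from B
    itself. *)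
Lemma svd_val n : s n != 0 -> Bn n (e n) = B (e n).
Proof.
move=> sn; have := svd_partial n (e n); rewrite big_nat_cond big1.
  by move/esym/eqP; rewrite subr_eq0 => /eqP.
move=> k /andP[/andP[_ kn] _].
have sk : s k != 0.
  have := svd_mono (ltnW kn); apply: contraTneq => ->; rewrite -ltNge.
  by rewrite lt_def sn nrm_ge0.
by rewrite (svd_ortho sn sk).1 gtn_eqF// mulr0 scale0r.
Qed.

Definition svd_idx n := [seq k <- iota 0 n | s k != 0].

Lemma svd_on n : orthonormal_on (svd_idx n) e /\ orthonormal_on (svd_idx n) f.
Proof.
have u : uniq (svd_idx n) by rewrite filter_uniq// iota_uniq.
by split; split=> // i j; rewrite !mem_filter => /andP[si _] /andP[sj _];
  have [] := svd_ortho si sj.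
Qed.

Lemma svd_sq n : \sum_(0 <= k < n) s k ^+ 2 <= M ^+ 2.
Proof.
case: (hB) => _ _ h; have := h _ _ _ (svd_on n).1; apply: le_trans.
rewrite big_filter /index_iota subn0 (bigID (fun k => s k == 0))/= big1 ?add0r.
  by rewrite le_eqVlt; apply/orP; left; apply/eqP/eq_bigr => k sk; rewrite -svd_val.
by move=> k /eqP ->; rewrite expr0n.
Qed.

(** A nonincreasing square-summable sequence satisfies (n+1) s_n^2 <= M^2.
    Hence the deflations, of norm s_n, tend to 0. *)
Lemma svd_null (eps : R) : 0 < eps -> exists N, forall n, (N <= n)%N -> s n < eps.
Proof.
move=> eps0; have e2 : 0 < eps ^+ 2 / (M ^+ 2 + 1).
  by rewrite divr_gt0 ?exprn_gt0// ltr_wpDl ?sqr_ge0.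
have [N hN] := invS_small e2; exists N => n Nn.
have h1 : n.+1%:R * s n ^+ 2 <= M ^+ 2.
  apply: le_trans (svd_sq n.+1); rewrite -[n.+1 in leLHS]subn0 mulr_natl -sumr_const_nat.
  rewrite !big_nat; apply: ler_sum => k /andP[_ kn].
  by rewrite lerXn2r ?nnegrE ?nrm_ge0// svd_mono.
have := hN n Nn; rewrite -div1r ltr_pdivrMr// => h2.
rewrite -(@ltr_pXn2r _ 2) ?nnegrE ?nrm_ge0 ?(ltW eps0)//.
have n0 : (0 : R) < n.+1%:R by rewrite ltr0n.
rewrite -(ltr_pM2l n0); apply: le_lt_trans h1 _.
have M1 : 0 < M ^+ 2 + 1 by rewrite ltr_wpDl ?sqr_ge0.
move: h2; rewrite mulrAC ltr_pdivlMr// mul1r mulrC => h2.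
by rewrite (lt_trans _ h2)// ltrDl.
Qed.

(** Besides the expansion, the partial sums of singular values are expressed
    as sums of <B e_k, f_k> over orthonormal families: this is how their
    boundedness is tested for products. *)
Lemma hs_svd : exists s e f, singular_value_expansion B s e f /\
  forall n, exists r : seq nat, [/\ orthonormal_on r e, orthonormal_on r f &
    \sum_(0 <= k < n) s k = complex.Re (\sum_(k <- r) hdot (B (e k)) (f k))].
Proof.
exists s, e, f; split.
  split; [exact: svd_mono|by move=> n; exact: nrm_ge0|exact: svd_ortho|].
  move=> x; apply/tends_cvg => eps eps0.
  have x1 : 0 < nrm x + 1 by rewrite ltr_wpDl ?nrm_ge0.
  have [N hN] := svd_null (divr_gt0 eps0 x1); exists N => n Nn.
  rewrite /series /= svd_partial addrAC subrr add0r nrmN.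
  have [M' h'] := svd_hs n; have [_ h] := topvP h'.
  rewrite (le_lt_trans (h x))// -/(e n) -/(s n).
  rewrite (@le_lt_trans _ _ (s n * (nrm x + 1)))//.
    by rewrite ler_wpM2l ?nrm_ge0// lerDl; exact: ler01.
  by rewrite -ltr_pdivlMr// hN.
move=> n; exists (svd_idx n); have [h1 h2] := svd_on n; split=> //.
rewrite (_ : \sum_(k <- _) _ = (\sum_(0 <= k < n) s k)%:C)//.
rewrite rmorph_sum /= big_filter /index_iota subn0 [RHS](bigID (fun k => s k == 0))/=.
rewrite [X in _ = X + _]big1 ?add0r => [|k /eqP ->//].
apply: eq_bigr => k sk; rewrite /f hdotZr conj_real -svd_val// hdot_nrm -rmorphM.
by rewrite expr2 mulrA mulVf// mul1r.
Qed.

End svd.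

(** The sum of the first singular values of A X is the real part of the sum of
    the <X e_k, A' f_k>, with A' the adjoint, which is bounded by half the sum
    of the squared Hilbert-Schmidt norms of X and A'. *)
Lemma hs_comp_schatten1 (A X : H -> H) M N : hs A M -> hs X N -> schatten 1 (A \o X).
Proof.
move=> hA hX; have [[M' bA] _ _] := hA; have [[N' bX] _ _] := hX.
have hAX := hs_compl bA hX.
split; first by apply/bounded_linearP; exists (M' * N'); exact: opb_comp.
have [s [e [f [sve hr]]]] := hs_svd hAX.
exists s, e, f; split=> //.
have [_ s0 _ _] := sve.
apply: nondecreasing_is_cvgn.
  by apply: nondecreasing_series => // n _ _; rewrite powR_ge0.
exists ((M ^+ 2 + N ^+ 2) / 2) => _ [n _ <-].
rewrite /series /=; under eq_bigr do rewrite powRr1//.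
have [r [oe of' ->]] := hr n.
rewrite (le_trans (Re_le_nrm _))// (le_trans (nrm_sum _ _ _))//.
have [_ _ /(_ _ _ _ of') hA'] := hs_adj hA; have [_ _ /(_ _ _ _ oe) hX'] := hX.
apply: (@le_trans _ _ (\sum_(k <- r) (2^-1 * nrm (adj A (f k)) ^+ 2 + 2^-1 * nrm (X (e k)) ^+ 2))).
  apply: ler_sum => k _; rewrite /= (adjP bA).
  have := hdot_CS (X (e k)) (adj A (f k)).
  have := sqr_ge0 (nrm (X (e k)) - nrm (adj A (f k))); nra.
by rewrite big_split/= -!mulr_sumr; lra.
Qed.

End SingularValues.

(** * Traces of products of Hilbert-Schmidt operators *)

Section TraceFormula.
Context {R : realType} {H : hilbertType R}.
Local Notation C := R[i].

(** With bounds A, B enlarged to positive s, t, apply 2ab <= (t/s) a^2 + (s/t)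
    b^2 termwise, then let the enlargement tend to 0. *)
Lemma sum_CS I (r : seq I) (a b : I -> R) (A B : R) :
  (forall i, 0 <= a i) -> (forall i, 0 <= b i) -> 0 <= A -> 0 <= B ->
  \sum_(i <- r) a i ^+ 2 <= A ^+ 2 -> \sum_(i <- r) b i ^+ 2 <= B ^+ 2 ->
  \sum_(i <- r) a i * b i <= A * B.
Proof.
move=> a0 b0 A0 B0 hA hB.
have key e : 0 < e -> \sum_(i <- r) a i * b i <= (A + e) * (B + e).
  move=> e0; set s := A + e; set t := B + e.
  have s0 : 0 < s by rewrite ltr_wpDl.
  have t0 : 0 < t by rewrite ltr_wpDl.
  apply: (@le_trans _ _ (\sum_(i <- r) (t / (2 * s) * a i ^+ 2 + s / (2 * t) * b i ^+ 2))).
    apply: ler_sum => i _.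
    have : 0 <= (t / (2 * s)) * (a i - s / t * b i) ^+ 2.
      by rewrite mulr_ge0 ?sqr_ge0// divr_ge0 ?mulr_ge0// ltW.
    have -> : t / (2 * s) * (a i - s / t * b i) ^+ 2 =
      t / (2 * s) * a i ^+ 2 + s / (2 * t) * b i ^+ 2 - a i * b i.
      by field; rewrite !gt_eqF.
    by rewrite subr_ge0.
  rewrite big_split/= -!mulr_sumr.
  apply: (@le_trans _ _ (t / (2 * s) * s ^+ 2 + s / (2 * t) * t ^+ 2)).
    have p1 : 0 <= t / (2 * s) by rewrite divr_ge0 ?mulr_ge0// ltW.
    have p2 : 0 <= s / (2 * t) by rewrite divr_ge0 ?mulr_ge0// ltW.
    rewrite lerD// ler_wpM2l//.
      by rewrite (le_trans hA)// lerXn2r ?nnegrE ?(ltW s0)// lerDl ltW.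
    by rewrite (le_trans hB)// lerXn2r ?nnegrE ?(ltW t0)// lerDl ltW.
  by rewrite le_eqVlt; apply/orP; left; apply/eqP; field; rewrite !gt_eqF.
suff key' (e : R) : 0 < e -> \sum_(i <- r) a i * b i <= A * B + e by exact/ler_addgt0Pr.
move=> e0; have p : 0 < A + B + 1 by rewrite ltr_wpDl// addr_ge0.
pose d := Num.min 1 (e / (A + B + 1)).
have d0 : 0 < d by rewrite lt_min ltr01 divr_gt0.
have d1 : d <= 1 by rewrite ge_min lexx.
have d2 : d * (A + B + 1) <= e by rewrite -ler_pdivlMr// ge_min lexx orbT.
by apply: le_trans (key d d0) _; nra.
Qed.

Context (X : H -> H) (s : R^nat) (e f : nat -> H).
Context (sve : singular_value_expansion X s e f).
Context (S : R) (hS : forall n, \sum_(0 <= k < n) s k ^+ 2 <= S).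

Let s0 n : 0 <= s n. Proof. by case: sve. Qed.

(** Only the indices of nonzero singular values carry orthonormal vectors. *)
Definition sidx (m n : nat) := [seq k <- index_iota m n | s k != 0].

Lemma sve_on m n : orthonormal_on (sidx m n) e /\ orthonormal_on (sidx m n) f.
Proof.
have u : uniq (sidx m n) by rewrite filter_uniq// iota_uniq.
have [_ _ h _] := sve.
by split; split=> // i j; rewrite !mem_filter => /andP[si _] /andP[sj _];
  have [] := h _ _ si sj.
Qed.

Lemma sum_sidx (V : zmodType) (F : nat -> V) m n : (forall k, s k = 0 -> F k = 0) ->
  \sum_(m <= k < n) F k = \sum_(k <- sidx m n) F k.
Proof.
move=> h; rewrite big_filter (bigID (fun k => s k == 0))/= big1 ?add0r//.
by move=> k /eqP/h.
Qed.

Lemma sve_tends x :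
  tends (fun n => \sum_(k <- sidx 0 n) ((s k)%:C * hdot x (e k)) *: f k) (X x).
Proof.
have [_ _ _ /(_ x)/tends_cvg h] := sve.
apply: tends_ext h => n; rewrite /series /= sum_sidx// => k ->.
by rewrite rmorph0 mul0r scale0r.
Qed.

(** Exchange the sums over the test family and over the singular values, and
    apply Bessel's inequality to each e_k. *)
Lemma sve_hs : (exists N, opb X N) -> hs X (Num.sqrt S).
Proof.
move=> bX; have S0 : 0 <= S by rewrite (le_trans _ (hS 0))// big_geq.
split; rewrite ?sqrtr_ge0// => I r g og; rewrite sqr_sqrtr//.
apply: (tends_sqsum (fun i => sve_tends (g i)) (N := 0%N)) => n _.
have [oe of'] := sve_on 0 n.
under eq_bigr do rewrite (nrm_onsum of').
rewrite exchange_big/=; apply: le_trans (hS n).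
rewrite (sum_sidx (F := fun k => s k ^+ 2)) => [|k ->]; last by rewrite expr0n.
rewrite big_seq [leRHS]big_seq; apply: ler_sum => k ks.
under eq_bigr do rewrite nrmM nrm_ger0// exprMn hdotC nrm_conj.
rewrite -mulr_sumr ler_piMr ?sqr_ge0// (le_trans (bessel og _))//.
case: oe => _ /(_ k k ks ks); rewrite eqxx hdot_nrm -[1](rmorph1 (real_complex R)).
by move=> /complexI ->.
Qed.

Lemma tail_small (d : R) : 0 < d -> exists N, forall n, \sum_(N <= k < n) s k ^+ 2 <= d.
Proof.
move=> d0; pose E := range (fun n => \sum_(0 <= k < n) s k ^+ 2).
have hE : has_sup E by split; [exists (\sum_(0 <= k < 0) s k ^+ 2), 0%N|exists S => _ [n _ <-]].
have [_ [N _ <-] hN] := sup_adherent d0 hE.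
exists N => n; have [Nn|nN] := leqP N n; last by rewrite big_geq ?ltW// ltnW.
have : \sum_(0 <= k < n) s k ^+ 2 <= sup E by apply: ub_le_sup; [case: hE|exists n].
by rewrite (big_cat_nat _ Nn)//= => h; move: hN; lra.
Qed.

Context (A : H -> H) (M : R) (hA : hs A M).

(** The trace of A X expanded along the singular values of X: a sequence that
    does not refer to a basis, to which the diagonal sums over every basis are
    shown to converge. *)
Definition tau_partial n : C := \sum_(k <- sidx 0 n) (s k)%:C * hdot (A (f k)) (e k).

Lemma sum_tail_bound m n (d : R) : 0 <= d -> \sum_(m <= k < n) s k ^+ 2 <= d ^+ 2 ->
  \sum_(k <- sidx m n) s k * nrm (A (f k)) <= d * M.
Proof.
move=> d0 hd; have [_ M0 hh] := hA.
apply: sum_CS => //; [by move=> i; exact: nrm_ge0| |exact: (hh _ _ _ (sve_on m n).2)].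
by rewrite -(sum_sidx (F := fun k => s k ^+ 2))// => k ->; rewrite expr0n.
Qed.

Lemma nrm_e k : s k != 0 -> nrm (e k) = 1.
Proof.
move=> sk; have [_ _ h _] := sve; have [] := h _ _ sk sk; rewrite eqxx hdot_nrm.
rewrite -[1](rmorph1 (real_complex R)) => /complexI h1 _.
by apply/eqP; rewrite -(@eqrXn2 _ 2) ?nrm_ge0// h1 expr1n.
Qed.

Lemma sidx_cat m n p : (m <= n)%N -> (n <= p)%N -> sidx m p = sidx m n ++ sidx n p.
Proof.
move=> mn np; rewrite /sidx -filter_cat /index_iota.
have -> : (p - m = (n - m) + (p - n))%N by rewrite addnC addnBA// subnK.
by rewrite iotaD subnKC.
Qed.

(** The tail is bounded by Cauchy-Schwarz between the singular values of X and
    the numbers |A f_k|. The vectors y_k are A f_k for the trace itself, and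
    errors of projections of A f_k for its diagonal sums. *)
Lemma tau_tail (y : nat -> H) m n (d : R) : (m <= n)%N -> 0 <= d ->
  (forall k, nrm (y k) <= nrm (A (f k))) -> \sum_(m <= k < n) s k ^+ 2 <= d ^+ 2 ->
  nrm (\sum_(k <- sidx 0 n) (s k)%:C * hdot (y k) (e k)) <=
  \sum_(k <- sidx 0 m) s k * nrm (y k) + d * M.
Proof.
move=> mn d0 hy hd; rewrite (sidx_cat (leq0n m) mn) big_cat/=.
have st r : (forall k, k \in r -> s k != 0) -> nrm (\sum_(k <- r) (s k)%:C * hdot (y k) (e k)) <= \sum_(k <- r) s k * nrm (y k).
  move=> hr; rewrite (le_trans (nrm_sum _ _ _))// big_seq [leRHS]big_seq.
  apply: ler_sum => k kr; rewrite nrmM nrm_ger0// ler_wpM2l//.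
  by rewrite (le_trans (hdot_CS _ _))// nrm_e ?mulr1//; exact: hr.
have hm a b k : k \in sidx a b -> s k != 0 by rewrite mem_filter => /andP[].
rewrite (le_trans (nrmD _ _))// lerD//; first by apply: st => k; exact: hm.
apply: le_trans (st _ (@hm m n)) _; apply: le_trans (sum_tail_bound d0 hd).
by apply: ler_sum => k _; rewrite ler_wpM2l.
Qed.

Lemma tail_all (eps : R) : 0 < eps -> exists N d, [/\ 0 <= d, d * M < eps &
  forall m n, (N <= m)%N -> \sum_(m <= k < n) s k ^+ 2 <= d ^+ 2].
Proof.
move=> eps0; have [_ M0 _] := hA; have M1 : 0 < M + 1 by rewrite ltr_wpDl.
have d0 : 0 < eps / (M + 1) by rewrite divr_gt0.
have [N hN] := tail_small (exprn_gt0 2 d0); exists N, (eps / (M + 1)).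
split; first exact: ltW.
  by rewrite mulrAC ltr_pdivrMr// ltr_pM2l// ltrDl.
move=> m n Nm; have [mn|nm] := leqP m n; last first.
  by rewrite big_geq ?sqr_ge0// ltnW.
apply: le_trans (hN n); rewrite (big_cat_nat Nm mn)//= lerDr.
by rewrite sumr_ge0// => k _; rewrite sqr_ge0.
Qed.

Lemma tau_cauchy : exists t, tends tau_partial t.
Proof.
apply: complex_ccauchy => eps eps0.
have [N [d [d0 dM hd]]] := tail_all eps0; exists N.
have key m n : (N <= m)%N -> (m <= n)%N -> nrm (tau_partial n - tau_partial m) < eps.
  move=> Nm mn; rewrite /tau_partial (sidx_cat (leq0n m) mn) big_cat/= addrAC subrr add0r.
  apply: le_lt_trans dM; apply: le_trans (sum_tail_bound d0 (hd m n Nm)).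
  rewrite (le_trans (nrm_sum _ _ _))// big_seq [leRHS]big_seq; apply: ler_sum => k.
  rewrite mem_filter => /andP[sk _].
  rewrite nrmM nrm_ger0// ler_wpM2l// (le_trans (hdot_CS _ _))//.
  by rewrite nrm_e// mulr1.
move=> n m Nn Nm; have [nm|/ltnW mn] := leqP n m; last exact: key.
by rewrite nrmB key.
Qed.

Section basis.
Context (I : choiceType) (g : I -> H) (og : orthonormal_basis g).

(** A finite diagonal sum is the same expansion with A f_k replaced by its
    projection onto the span of the basis vectors involved. *)
Lemma diag_sum_tends (J : seq I) :
  tends (fun n => \sum_(k <- sidx 0 n) (s k)%:C * hdot (proj J g (A (f k))) (e k))
        (\sum_(i <- J) hdot (A (X (g i))) (g i)).
Proof.
have [[N bA] _ _] := hA; have [lA _ _] := bA.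
have t i := tends_hdotl (g i) (tends_opb bA (sve_tends (g i))).
have := tends_sum (P := xpredT) J (fun i _ => t i).
apply: tends_ext => n; under eq_bigr do rewrite lin_sum// hdot_suml.
rewrite exchange_big/=; apply: eq_bigr => k _.
rewrite /proj hdot_suml mulr_sumr; apply: eq_bigr => i _.
by rewrite linZZ// !hdotZl; ring.
Qed.

(** Cut the expansion at N: the tail is small whatever the finite part J of
    the basis is, and for the first N terms J is taken large enough to
    approximate the vectors A f_k. *)
Lemma diag_sum_approx t (eps : R) : tends tau_partial t -> 0 < eps ->
  exists J0 : seq I, forall J, uniq J -> {subset J0 <= J} ->
    nrm (\sum_(i <- J) hdot (A (X (g i))) (g i) - t) <= eps.
Proof.
move=> ht eps0; have e2 : 0 < eps / 2 by rewrite divr_gt0.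
have [N [d [d0 dM hd]]] := tail_all e2.
have p k : 0 < eps / (2 * (size (sidx 0 N)).+1%:R * (s k + 1)).
  by rewrite divr_gt0// !mulr_gt0// ltr_wpDl.
have [J hJ] := boolp.choice (fun k => onb_dense (A (f k)) og (p k)).
exists (flatten [seq J k | k <- sidx 0 N]) => J' uJ sJ.
have oJ := onb_on og uJ.
apply: (@tends_bound _ _ _ _ _ N (tendsB (diag_sum_tends J') ht)) => n Nn.
rewrite /tau_partial -sumrB.
under eq_bigr do rewrite -mulrBr -hdotBl.
apply: le_trans (tau_tail (y := fun k => proj J' g (A (f k)) - A (f k)) Nn d0 _ (hd N n (leqnn _))) _.
  by move=> k; rewrite nrmB; exact: nrm_subproj_le.
rewrite [leRHS]splitr lerD ?(ltW dM)//.
apply: (@le_trans _ _ (\sum_(k <- sidx 0 N) eps / 2 / (size (sidx 0 N)).+1%:R)); last first.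
  rewrite big_const_seq count_predT iter_addr_0 -[_ *+ size _]mulr_natr -mulrA.
  by rewrite ler_piMr ?(ltW e2)// mulrC ler_pdivrMr// mul1r ler_nat.
rewrite big_seq [leRHS]big_seq; apply: ler_sum => k kN.
have h : nrm (A (f k) - proj J' g (A (f k))) < eps / (2 * (size (sidx 0 N)).+1%:R * (s k + 1)).
  apply: hJ => // i iJ; apply: sJ; apply/flattenP; exists (J k) => //; exact: map_f.
have s1 : 0 < s k + 1 by rewrite ltr_wpDl.
rewrite nrmB; apply: (@le_trans _ _ ((s k + 1) * (eps / (2 * (size (sidx 0 N)).+1%:R * (s k + 1))))).
  by rewrite ler_pM ?nrm_ge0 ?lerDl// ltW.
rewrite le_eqVlt; apply/orP; left; apply/eqP.
have L0 : (0 : R) < (size (sidx 0 N)).+1%:R by rewrite ltr0n.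
by move: s1 L0; move: (s k + 1) ((size _).+1%:R) => q L q0 L0; field; rewrite !gt_eqF.
Qed.

Lemma diag_sum_cvg t : tends tau_partial t ->
  summability.partial_sum (fun i => hdot (A (X (g i))) (g i) : R[i]^o)
      @ @summability.totally I --> (t : R[i]^o).
Proof.
move=> ht; have PF := @summability.totally_filter I.
apply/cvgrPdist_lt => eps eps0.
have ee : eps = (complex.Re eps)%:C by rewrite RRe_real// gtr0_real.
have e2 : 0 < complex.Re eps / 2 by rewrite divr_gt0// -ltcR -ee.
have [J0 hJ0] := diag_sum_approx ht e2.
exists [fset i in J0]%fset => // J /= J0J.
have -> : summability.partial_sum (fun i => hdot (A (X (g i))) (g i) : R[i]^o) J =
    \sum_(i <- J) hdot (A (X (g i))) (g i).
  by rewrite /summability.partial_sum big_seq_fsetE.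
rewrite nrmE ee ltcR nrmB.
apply: le_lt_trans (hJ0 J (fset_uniq _) _) _.
  by move=> i iJ0; move/fsubsetP: J0J; apply; rewrite inE.
by rewrite ltr_pdivrMr// ltr_pMr ?ltr1n// -ltcR -ee.
Qed.
End basis.

(** The diagonal sums over any basis converge to the same number, so the
    choice of a basis in the definition of the trace does not matter. *)
Lemma traceE t : tends tau_partial t -> trace (A \o X) = t.
Proof.
move=> ht; rewrite /trace; apply: xget_unique.
  have [I [g og]] := @exists_onb _ H.
  by exists I, g; split=> //; exact: diag_sum_cvg.
move=> u [I [g [og hu]]]; have h := diag_sum_cvg og ht.
have PF := @summability.totally_filter I.
exact: (cvg_unique (@norm_hausdorff _ _) hu h).
Qed.

End TraceFormula.

(** * Complex integrals over a period *)

Section ComplexIntegral.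
Context {R : realType}.
Local Notation C := R[i].
Local Notation mu := (@lebesgue_measure R).
Local Notation D := (`[0, 2 * pi]%classic : set R).
Local Notation cint := (cintegrable D).
Local Notation ci := (cintegral D).
Local Notation Re := complex.Re.
Local Notation Im := complex.Im.
Implicit Types (g h : R -> C) (t : R) (a : C).

(** Continuity of real and imaginary parts, the form in which it is stated for
    complex-valued functions of a real variable. *)
Definition ccont g := continuous (fun t => Re (g t)) /\ continuous (fun t => Im (g t)).

Lemma mD : measurable (D : set (measurableTypeR R)).
Proof. exact: measurable_itv. Qed.

Lemma twopi_gt0 : 0 < 2 * pi :> R.
Proof. by rewrite mulr_gt0// pi_gt0. Qed.

Lemma rint_cont (u : R -> R) : continuous u -> mu.-integrable D (EFin \o u).
Proof.
move=> cu; apply: continuous_compact_integrable; first exact: segment_compact.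
exact: continuous_subspaceT.
Qed.

Lemma rint_mul (u v : R -> R) : continuous u -> mu.-integrable D (EFin \o v) ->
  mu.-integrable D (EFin \o (fun t => u t * v t)).
Proof.
move=> cu iv; rewrite (_ : EFin \o _ = ((EFin \o u) \* (EFin \o v))%E)//.
apply: integrableMr => //.
  by apply/measurable_funTS; exact: measurable_realfun.continuous_measurable_fun.
have : bounded_set (u @` D).
  apply: compact_bounded; apply: continuous_compact; last exact: segment_compact.
  exact: continuous_subspaceT.
by move=> [M [Mr h]]; exists M; split=> // y My x Dx; apply: (h y My); exists x.
Qed.

Lemma rintD (u v : R -> R) : mu.-integrable D (EFin \o u) -> mu.-integrable D (EFin \o v) ->
  mu.-integrable D (EFin \o (fun t => u t + v t)).
Proof. move=> iu iv; rewrite (_ : EFin \o _ = ((EFin \o u) \+ (EFin \o v))%E)//.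
exact: integrableD. Qed.

Lemma rintZ (c : R) (u : R -> R) : mu.-integrable D (EFin \o u) ->
  mu.-integrable D (EFin \o (fun t => c * u t)).
Proof. by move=> iu; apply: rint_mul => //; exact: cst_continuous. Qed.

Lemma cint_cont g : ccont g -> cint g.
Proof. by case=> ? ?; split; exact: rint_cont. Qed.

Lemma ReM a b : Re (a * b) = Re a * Re b - Im a * Im b.
Proof. by case: a b => [? ?] [? ?]. Qed.
Lemma ImM a b : Im (a * b) = Re a * Im b + Im a * Re b.
Proof. by case: a b => [? ?] [? ?]. Qed.

Lemma cint_mul g h : ccont g -> cint h -> cint (fun t => g t * h t).
Proof.
move=> [c1 c2] [i1 i2]; split.
  rewrite (_ : (fun t => _) = EFin \o (fun t => Re (g t) * Re (h t) + (-1) * (Im (g t) * Im (h t)))).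
    by apply: rintD; [exact: rint_mul|apply: rintZ; exact: rint_mul].
  by apply/funext => t /=; rewrite ReM mulN1r.
rewrite (_ : (fun t => _) = EFin \o (fun t => Re (g t) * Im (h t) + Im (g t) * Re (h t))).
  by apply: rintD; exact: rint_mul.
by apply/funext => t /=; rewrite ImM.
Qed.

Lemma ccont_cst a : ccont (fun=> a).
Proof. by split; exact: cst_continuous. Qed.

Lemma ccontD g h : ccont g -> ccont h -> ccont (fun t => g t + h t).
Proof.
move=> [c1 c2] [d1 d2]; split => t.
  rewrite (_ : (fun t => _) = (fun t => Re (g t) + Re (h t))); last first.
    by apply/funext => s; rewrite raddfD.
  by apply: cvgD; [exact: c1|exact: d1].
rewrite (_ : (fun t => _) = (fun t => Im (g t) + Im (h t))); last first.
  by apply/funext => s; rewrite raddfD.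
by apply: cvgD; [exact: c2|exact: d2].
Qed.

Lemma ccontM g h : ccont g -> ccont h -> ccont (fun t => g t * h t).
Proof.
move=> [c1 c2] [d1 d2]; split => t.
  rewrite (_ : (fun t => _) = (fun t => Re (g t) * Re (h t) - Im (g t) * Im (h t))); last first.
    by apply/funext => s; rewrite ReM.
  by apply: cvgB; apply: cvgM; [exact: c1|exact: d1|exact: c2|exact: d2].
rewrite (_ : (fun t => _) = (fun t => Re (g t) * Im (h t) + Im (g t) * Re (h t))); last first.
  by apply/funext => s; rewrite ImM.
by apply: cvgD; apply: cvgM; [exact: c1|exact: d2|exact: c2|exact: d1].
Qed.

Lemma cintD g h : cint g -> cint h -> cint (fun t => g t + h t).
Proof.
move=> [i1 i2] [j1 j2]; split.
  rewrite (_ : (fun t => _) = EFin \o (fun t => Re (g t) + Re (h t))); first exact: rintD.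
  by apply/funext => t /=; rewrite raddfD.
rewrite (_ : (fun t => _) = EFin \o (fun t => Im (g t) + Im (h t))); first exact: rintD.
by apply/funext => t /=; rewrite raddfD.
Qed.

Lemma cint_lin a g h : cint g -> cint h -> cint (fun t => a * g t + h t).
Proof.
move=> ig ih; apply: cintD => //.
by apply: (@cint_mul (fun=> a)) => //; exact: ccont_cst.
Qed.

Lemma ci_lin a g h : cint g -> cint h -> ci (fun t => a * g t + h t) = a * ci g + ci h.
Proof.
move=> [i1 i2] [j1 j2]; rewrite /cintegral.
rewrite (_ : (fun t => Re _) = (fun t => (Re a * Re (g t) + (- Im a) * Im (g t)) + Re (h t))); last first.
  by apply/funext => t; rewrite raddfD /= ReM mulNr.
rewrite (_ : (fun t => Im _) = (fun t => (Re a * Im (g t) + Im a * Re (g t)) + Im (h t))); last first.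
  by apply/funext => t; rewrite raddfD /= ImM.
have ia := rintZ (Re a) i1; have ib := rintZ (- Im a) i2.
have ic := rintZ (Re a) i2; have id := rintZ (Im a) i1.
rewrite !RintegralD//; try exact: rintD.
rewrite !RintegralZl//; try exact: mD.
apply/eqP; rewrite eq_complex /=.
case: a {ia ib ic id} => a b /=; rewrite mulNr; apply/andP; split; apply/eqP; ring.
Qed.

Lemma ci_ext g h : (forall t, 0 <= t <= 2 * pi -> g t = h t) -> ci g = ci h.
Proof.
move=> gh; rewrite /cintegral; congr (_ +i* _).
  by apply: eq_Rintegral => t; rewrite inE /= in_itv /= => /gh ->.
by apply: eq_Rintegral => t; rewrite inE /= in_itv /= => /gh ->.
Qed.

Lemma ci0 : ci (fun=> 0) = 0.
Proof. by rewrite /cintegral /= Rintegral_cst ?mul0r//; exact: mD. Qed.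

Lemma ciZ a g : cint g -> ci (fun t => a * g t) = a * ci g.
Proof.
move=> ig; have i0 : cint (fun=> 0) by exact/cint_cont/ccont_cst.
have := ci_lin a ig i0; rewrite ci0 addr0 => <-.
by apply: ci_ext => t _; rewrite addr0.
Qed.

Lemma ciD g h : cint g -> cint h -> ci (fun t => g t + h t) = ci g + ci h.
Proof.
move=> ig ih; have := ci_lin 1 ig ih; rewrite mul1r => <-.
by apply: ci_ext => t _; rewrite mul1r.
Qed.

Lemma ciB g h : cint g -> cint h -> ci (fun t => g t - h t) = ci g - ci h.
Proof.
move=> ig ih; have := ci_lin (-1) ih ig; rewrite mulN1r addrC => <-.
by apply: ci_ext => t _; rewrite mulN1r addrC.
Qed.

Lemma ci_cst a : ci (fun=> a) = (2 * pi)%:C * a.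
Proof.
rewrite /cintegral !Rintegral_cst; try exact: mD.
have e x : x * fine (mu D) = x * (2 * pi).
  by rewrite lebesgue_measure_itv /= lte_fin twopi_gt0 /= oppr0 addr0.
transitivity (Re a * (2 * pi) +i* (Im a * (2 * pi))).
  by congr (_ +i* _); exact: e.
by apply/eqP; rewrite eq_complex ReM ImM /= !mul0r subr0 addr0 !(mulrC (2 * pi)) !eqxx.
Qed.

Lemma ci_re (u : R -> R) : ci (fun t => (u t)%:C) = (Rintegral mu D u)%:C.
Proof. by rewrite /cintegral /= Rintegral_cst ?mul0r//; exact: mD. Qed.

(** Bounds the integral by the L1 norm of h times the bound on g; the norm of
    a complex number is replaced by the sum of the absolute values of its
    parts, which costs a factor 2. *)
Lemma ci_bound g h (B : R) : ccont g -> cint h -> 0 <= B ->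
  (forall t, nrm (g t) <= B) ->
  nrm (ci (fun t => g t * h t)) <=
    2 * (Rintegral mu D (fun t => `|Re (h t)| + `|Im (h t)|)) * B.
Proof.
move=> cg ih B0 gB; have [k1 k2] := cint_mul cg ih.
case: (ih) => i1 i2; rewrite (le_trans (nrm_le_ReIm _))// /cintegral /=.
have iA : mu.-integrable D (EFin \o (fun t => `|Re (h t)| + `|Im (h t)|)).
  by apply: rintD; [exact: (integrable_norm i1)|exact: (integrable_norm i2)].
have rA : Rintegral mu D (fun t => B * (`|Re (h t)| + `|Im (h t)|)) =
  B * Rintegral mu D (fun t => `|Re (h t)| + `|Im (h t)|).
  by rewrite RintegralZl//; exact: mD.
have hh t : nrm (g t * h t) <= B * (`|Re (h t)| + `|Im (h t)|).
  by rewrite nrmM ler_pM ?nrm_ge0// nrm_le_ReIm.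
have b1 : `|Rintegral mu D (fun t => Re (g t * h t))| <= B * Rintegral mu D (fun t => `|Re (h t)| + `|Im (h t)|).
  rewrite -rA (le_trans (le_normr_Rintegral mD k1))//; apply: le_Rintegral; first exact: mD.
  - exact: (integrable_norm k1).
  - exact: rintZ.
  - by move=> t _; rewrite (le_trans (normRe_le _)).
have b2 : `|Rintegral mu D (fun t => Im (g t * h t))| <= B * Rintegral mu D (fun t => `|Re (h t)| + `|Im (h t)|).
  rewrite -rA (le_trans (le_normr_Rintegral mD k2))//; apply: le_Rintegral; first exact: mD.
  - exact: (integrable_norm k2).
  - exact: rintZ.
  - by move=> t _; rewrite (le_trans (normIm_le _)).
have -> : 2 * Rintegral mu D (fun t => `|Re (h t)| + `|Im (h t)|) * B =
 B * Rintegral mu D (fun t => `|Re (h t)| + `|Im (h t)|) + B * Rintegral mu D (fun t => `|Re (h t)| + `|Im (h t)|) by ring.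
exact: lerD.
Qed.

Definition cisd g t a := is_derive t 1 (fun s => Re (g s)) (Re a) /\
  is_derive t 1 (fun s => Im (g s)) (Im a).

Lemma cisd_derive g t a : cisd g t a -> cderivable g t /\ cderive g t = a.
Proof.
move=> [[d1 e1] [d2 e2]]; split; first by split.
by rewrite /cderive !derive1E e1 e2; case: (a).
Qed.

Lemma cderivable_cisd g t : cderivable g t -> cisd g t (cderive g t).
Proof. by move=> [d1 d2]; split; rewrite /cderive /= derive1E; exact: derivableP. Qed.

Lemma is_derive_lin2 (u v w : R -> R) t (a b du dv dw : R) :
  is_derive t 1 u du -> is_derive t 1 v dv -> is_derive t 1 w dw ->
  is_derive t 1 (fun s => a * u s + b * v s + w s) (a * du + b * dv + dw).
Proof.
move=> hu hv hw.
exact: (is_deriveD (is_deriveD (is_deriveZ a hu) (is_deriveZ b hv)) hw).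
Qed.

Lemma cisd_lin g h t a b c : cisd g t a -> cisd h t b -> cisd (fun t => c * g t + h t) t (c * a + b).
Proof.
move=> [d1 d2] [d3 d4]; split.
  rewrite (_ : (fun s => _) = (fun s => Re c * Re (g s) + (- Im c) * Im (g s) + Re (h s))); last first.
    by apply/funext => s; rewrite raddfD /= ReM mulNr.
  by rewrite raddfD /= ReM -mulNr; exact: is_derive_lin2.
rewrite (_ : (fun s => _) = (fun s => Re c * Im (g s) + Im c * Re (g s) + Im (h s))); last first.
  by apply/funext => s; rewrite raddfD /= ImM.
by rewrite raddfD /= ImM; exact: is_derive_lin2.
Qed.

Lemma ci_FTC g dg : (forall t, cisd g t (dg t)) -> ccont dg ->
  ci dg = g (2 * pi) - g 0.
Proof.
move=> dd [c1 c2].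
have real (u v : R -> R) : (forall t, is_derive t 1 u (v t)) -> continuous v ->
    Rintegral mu D v = u (2 * pi) - u 0.
  move=> duv cv; have du t : derivable u t 1 by case: (duv t).
  rewrite /Rintegral (@continuous_FTC2 _ v u 0 (2 * pi) twopi_gt0)//.
  - exact: continuous_subspaceT.
  - split=> //.
    + by apply: cvg_at_right_filter; exact: differentiable_continuous (proj1 (derivable1_diffP _ _) (du _)).
    + by apply: cvg_at_left_filter; exact: differentiable_continuous (proj1 (derivable1_diffP _ _) (du _)).
  - by move=> t _; rewrite derive1E; case: (duv t).
have r1 := real (fun t => Re (g t)) (fun t => Re (dg t)) (fun t => proj1 (dd t)) c1.
have r2 := real (fun t => Im (g t)) (fun t => Im (dg t)) (fun t => proj2 (dd t)) c2.
rewrite /cintegral r1 r2.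
by case: (g (2 * pi)) => ? ?; case: (g 0) => ? ?.
Qed.

(** The factor by which differentiation in the angle multiplies z^k. *)
Definition imul (k : int) : C := 0 +i* k%:~R.

Lemma imul_eq0 k : k != 0 -> imul k != 0.
Proof. by move=> k0; rewrite eq_complex /= eqxx /= intr_eq0. Qed.

Lemma nrm_imul k : nrm (imul k) = `|k%:~R|.
Proof. by rewrite /nrm normc_def /= expr0n add0r sqrtr_sqr. Qed.

Lemma zp_expi t k : zp (expi t) k = expi (k%:~R * t).
Proof.
case: k => n /=; rewrite -?rmorphXn expiX -mulr_natl//.
rewrite NegzE rmorphN /= mulNr conjE /expi /= cosN sinN.
by [].
Qed.

Lemma cisd_zp k t : cisd (zp ^~ k \o expi) t (imul k * zp (expi t) k).
Proof.
rewrite (_ : zp ^~ k \o expi = fun t => expi (k%:~R * t)); last first.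
  by apply/funext => s; rewrite /= zp_expi.
rewrite zp_expi.
have dl : is_derive t (1 : R) (fun s : R => k%:~R * s) k%:~R.
  have := @is_deriveZ _ _ _ (id : R -> R) k%:~R t 1 1 (is_derive_id _ _).
  by rewrite /GRing.scale /= mulr1.
split; rewrite ?ReM ?ImM /= ?mul0r ?sub0r ?add0r.
  rewrite -mulrN mulrC.
  exact: (@is_derive1_comp _ cos (fun s => k%:~R * s)).
rewrite mulrC.
exact: (@is_derive1_comp _ sin (fun s => k%:~R * s)).
Qed.

Lemma ucont_ccont f : ucont f -> ccont (f \o expi).
Proof.
move=> uf.
have key t (e : R) : 0 < e -> \forall s \near t, nrm (f (expi t) - f (expi s)) < e.
  move=> e0; have [d d0 hd] := uf e e0.
  have /cvgrPdist_lt/(_ d%:C) := @expi_continuous R t.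
  rewrite ltcR d0 => /(_ isT); apply: filterS => s; rewrite nrmE ltcR => h.
  by apply: hd => //; exact: nrm_expi.
split=> t; apply/cvgrPdist_lt => e e0; apply: filterS (key t e e0) => s h /=.
  by apply: le_lt_trans h; rewrite -raddfB; exact: normRe_le.
by apply: le_lt_trans h; rewrite -raddfB; exact: normIm_le.
Qed.

(** Conversely a function of z is continuous as soon as it is continuous in
    the angle: near z = expi s, the point w is expi (s + u) with u the arcsine
    of the imaginary part of w/z, and u is continuous in w. *)
Lemma ccont_ucont f : ccont (f \o expi) -> ucont f.
Proof.
move=> [c1 c2]; apply/ucontP/subspace_continuousP => z /circleE zc.
apply/cvgrPdist_lt => e e0.
have ee : e = (Re e)%:C by rewrite RRe_real// gtr0_real.
have [s [_ zs]] := circle_expi zc.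
have e2 : 0 < Re e / 2 by rewrite divr_gt0// -ltcR -ee.
have /cvgrPdist_lt/(_ _ e2)/nbhs_ballP[d1 /= d10 h1] := c1 s.
have /cvgrPdist_lt/(_ _ e2)/nbhs_ballP[d2 /= d20 h2] := c2 s.
have dm : 0 < Num.min d1 d2 by rewrite lt_min d10.
have /cvgrPdist_lt/(_ _ dm)/nbhs_ballP[d3 /= d30 h3] : {for (0 : R), continuous asin}.
  by apply: continuous_asin; rewrite ltrN10 ltr01.
have asin0 : asin (0 : R) = 0 by rewrite -[X in asin X](@sin0 R) sinK// in_itv /= oppr_le0 divr_ge0 ?pi_ge0.
apply/nbhs_ballP; exists (Num.min d3 1)%:C; first by rewrite /= ltcR lt_min d30 ltr01.
move=> w; rewrite -ball_normE/= nrmE ltcR lt_min => /andP[zw1 zw2] /circleE wc.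
pose v := w * Num.conj z; pose u := asin (Im v).
have nv : nrm (v - 1) = nrm (z - w).
  by rewrite /v -(conjM1 zc) -mulrBl nrmM nrm_conj zc mulr1 nrmB.
have vc : nrm v = 1 by rewrite nrmM nrm_conj zc wc mulr1.
have Rv : 0 < Re v.
  have := normRe_le (v - 1); rewrite nv raddfB /= => h.
  by have := ler_norm (- (Re v - 1)); rewrite normrN; move: zw2 h; lra.
have v2 : Re v ^+ 2 + Im v ^+ 2 = 1 by rewrite -nrm_sqE vc expr1n.
have Iv : -1 <= Im v <= 1 by have := sqr_ge0 (Re v); nra.
have vu : v = expi u.
  rewrite /expi /u cos_asin// asinK; last by rewrite in_itv.
  rewrite -v2 addrK sqrtr_sqr gtr0_norm//; by case: (v).
have wsu : w = expi (s + u).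
  by rewrite expiD -vu -zs /v mulrCA conjM1// mulr1.
have us : `|u| < Num.min d1 d2.
  have := h3 (Im v); rewrite -ball_normE /= asin0 !sub0r !normrN; apply.
  have := normIm_le (v - 1); rewrite nv raddfB /= subr0 => h; exact: le_lt_trans h zw1.
move: us; rewrite lt_min => /andP[u1 u2].
rewrite nrmE ee ltcR (le_lt_trans (nrm_le_ReIm _))// !raddfB /= [ltRHS]splitr zs wsu ltrD//.
  by apply: h1; rewrite -ball_normE /= opprD addrA subrr sub0r normrN.
by apply: h2; rewrite -ball_normE /= opprD addrA subrr sub0r normrN.
Qed.

End ComplexIntegral.

(** * Bernstein's inequality for Lipschitz functions *)

Section Bernstein.
Context {R : realType}.
Local Notation C := R[i].
Local Notation Re := complex.Re.
Local Notation Im := complex.Im.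

Lemma pi_lt4 : pi < 4 :> R.
Proof.
by have := @pihalf_lt2 R; lra.
Qed.

(** The mean value theorem. *)
Lemma derive_lip (u v : R -> R) (B : R) : (forall t : R, is_derive t 1 u (v t)) ->
  (forall t, `|v t| <= B) -> forall s t, `|u s - u t| <= B * `|s - t|.
Proof.
move=> duv vB.
have key s t : t <= s -> `|u s - u t| <= B * `|s - t|.
  move=> ts; have [|c _ ->] := @MVT_segment _ u v t s ts.
    apply: continuous_subspaceT => x.
    apply: differentiable_continuous; apply/derivable1_diffP; by case: (duv x).
  by rewrite normrM ler_wpM2r.
move=> s t; have [ts|/ltW st] := leP t s; first exact: key.
by rewrite distrC (distrC s); exact: key.
Qed.

Lemma cisd_lip (g dg : R -> C) (B : R) : (forall t, cisd g t (dg t)) ->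
  (forall t, nrm (dg t) <= B) -> forall s t, nrm (g s - g t) <= 2 * B * `|s - t|.
Proof.
move=> dd dB s t; rewrite (le_trans (nrm_le_ReIm _))// !raddfB.
have h1 := derive_lip (fun t => proj1 (dd t)) (fun t => le_trans (normRe_le _) (dB t)) s t.
have h2 := derive_lip (fun t => proj2 (dd t)) (fun t => le_trans (normIm_le _) (dB t)) s t.
by rewrite -mulrA mulr_natl mulr2n lerD.
Qed.

Lemma sin_ge_lin (x : R) : 0 <= x <= 1 -> cos 1 * x <= sin x.
Proof.
move=> /andP[x0 x1]; have [|c cx h] := @MVT_segment _ sin cos 0 x x0.
  by apply: continuous_subspaceT; exact: continuous_sin.
move: h; rewrite sin0 !subr0 => ->; rewrite ler_wpM2r//.
move: cx; rewrite in_itv /= => /andP[c0 cx].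
have p2 := @pi_ge2 R; have c1 := le_trans cx x1.
have [->//|c1'] := eqVneq c 1.
by apply/ltW; rewrite ltr_cos ?in_itv /= ?ler01 ?c0 ?lt_neqAle ?c1' ?c1//; lra.
Qed.

(** Lipschitz condition in the angle. It is weaker than that for the chordal
    distance and is controlled by the derivative along the circle. *)
Definition alip (f : C -> C) (L : R) :=
  forall s t : R, nrm (f (expi s) - f (expi t)) <= L * `|s - t|.

Lemma alip_conj f L : alip f L -> alip (fun z => Num.conj (f z)) L.
Proof. by move=> fL s t; rewrite -rmorphB nrm_conj. Qed.

Lemma alip_ge0 f L : alip f L -> 0 <= L.
Proof.
by move=> /(_ 1 0); rewrite subr0 normr1 mulr1; apply: le_trans; exact: nrm_ge0.
Qed.

Lemma alip_ucont f L : alip f L -> ucont f.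
Proof.
move=> fL; have L0 := alip_ge0 fL.
have key t (e : R) : 0 < e -> \forall s \near t, nrm (f (expi t) - f (expi s)) < e.
  move=> e0; have L1 : 0 < L + 1 by rewrite ltr_wpDl.
  apply/nbhs_ballP; exists (e / (L + 1)); first by rewrite /= divr_gt0.
  move=> s; rewrite -ball_normE /= ltr_pdivlMr// => h.
  by rewrite (le_lt_trans (fL _ _))// (le_lt_trans _ h)// mulrC ler_wpM2l// lerDl.
apply: ccont_ucont; split=> t; apply/cvgrPdist_lt => e e0; apply: filterS (key t e e0) => s h /=.
  by apply: le_lt_trans h; rewrite -raddfB; exact: normRe_le.
by apply: le_lt_trans h; rewrite -raddfB; exact: normIm_le.
Qed.

(** The chord is at most twice the arc; the factor 2 comes from treating real
    and imaginary parts separately. *)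
Lemma lipschitz_alip f : lipschitz_circle f -> exists L, alip f L.
Proof.
move=> [M [Mr hM]]; pose K : R := `|Re M| + 1.
have MK : M < K%:C.
  have -> : M = (Re M)%:C by rewrite RRe_real.
  by rewrite ltcR /K (le_lt_trans (ler_norm _))// ltrDl.
exists (K * 2) => s t.
have := hM _ MK (expi s, expi t) (conj (proj2 (circleE _) (nrm_expi s)) (proj2 (circleE _) (nrm_expi t))).
rewrite /= !nrmE -rmorphM lecR => h; apply: (le_trans h).
rewrite -mulrA ler_wpM2l ?addr_ge0//.
have := @cisd_lip (zp ^~ (Posz 1) \o expi) _ 1 (cisd_zp (Posz 1)).
rewrite mulr1; apply=> r; rewrite nrmM zp_nrm ?nrm_expi// mulr1 nrm_imul.
by rewrite normr1.
Qed.

Section cyclic.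
Context (M : nat) (w : C) (hw : unity_root M w) (M0 : (0 < M)%N).

(** The trigonometric polynomial p with the coefficients of g is its
    orthogonal projection for the inner product given by sampling, so the
    squared norm of g - p is the difference of both sides, up to a factor M.
    *)
Lemma dft_bessel (g : C -> C) m : (m <= M)%N ->
  \sum_(k < m) nrm (dft M w g (Posz k)) ^+ 2 <= M%:R^-1 * \sum_(j < M) nrm (g (w ^+ j)) ^+ 2.
Proof.
move=> mM; pose b (k : 'I_m) := dft M w g (Posz k).
pose p z := \sum_(k < m) b k * zp z (Posz k).
have Mn0 : (M%:R : C) != 0 by rewrite pnatr_eq0 -lt0n.
have inner h : \sum_(j < M) h (w ^+ j) * Num.conj (p (w ^+ j)) =
    M%:R * \sum_(k < m) dft M w h (Posz k) * Num.conj (b k).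
  rewrite mulr_sumr; under eq_bigr do rewrite rmorph_sum mulr_sumr.
  rewrite exchange_big; apply: eq_bigr => k _ /=.
  rewrite /dft 2!mulrA mulfV// mul1r mulr_suml; apply: eq_bigr => j _.
  rewrite -mulrA; congr (_ * _); rewrite rmorphM mulrC; congr (_ * _).
  by rewrite /= rmorphXn.
have dp (k : 'I_m) : dft M w p (Posz k) = b k.
  transitivity (\sum_(l < m) b l * dft M w (zp ^~ (Posz l)) (Posz k)).
    rewrite /dft; under [RHS]eq_bigr do rewrite mulrCA mulr_sumr.
    rewrite -mulr_sumr exchange_big; congr (_ * _); apply: eq_bigr => j _.
    by rewrite mulr_suml; apply: eq_bigr => l _; rewrite mulrA.
  rewrite (bigD1 k)// dft_zp ?subrr// eqxx mulr1 big1 => [|l lk]; first exact: addr0.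
  rewrite dft_zp//; last first.
    have lM := leq_trans (ltn_ord l) mM; have kM := leq_trans (ltn_ord k) mM.
    have [h|/ltnW h] := leqP (k : nat) l.
      by rewrite subzn// (leq_ltn_trans (leq_subr _ _)).
    by rewrite -abszN opprB subzn// (leq_ltn_trans (leq_subr _ _)).
  by rewrite eqz_nat eq_sym (negPf (lk : (l : nat) != k)) mulr0.
pose B := M%:R * \sum_(k < m) nrm (b k) ^+ 2.
have BC : (B%:C : C) = M%:R * \sum_(k < m) b k * Num.conj (b k).
  rewrite rmorphM rmorph_nat rmorph_sum; congr (_ * _).
  by apply: eq_bigr => k _; rewrite nrmK.
have e1 : \sum_(j < M) g (w ^+ j) * Num.conj (p (w ^+ j)) = B%:C by rewrite inner BC.
have e2 : \sum_(j < M) p (w ^+ j) * Num.conj (p (w ^+ j)) = B%:C.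
  by rewrite inner BC; congr (_ * _); apply: eq_bigr => k _; rewrite dp.
have e3 : \sum_(j < M) p (w ^+ j) * Num.conj (g (w ^+ j)) = B%:C.
  rewrite -[RHS]conj_real -e1 rmorph_sum; apply: eq_bigr => j _.
  by rewrite rmorphM /= conjCK mulrC.
have : 0 <= \sum_(j < M) nrm (g (w ^+ j) - p (w ^+ j)) ^+ 2.
  by apply: sumr_ge0 => j _; exact: sqr_ge0.
have -> : \sum_(j < M) nrm (g (w ^+ j) - p (w ^+ j)) ^+ 2 =
    \sum_(j < M) nrm (g (w ^+ j)) ^+ 2 - B.
  apply: (@complexI R); rewrite rmorphB !rmorph_sum /=.
  transitivity (\sum_(j < M) (g (w ^+ j) * Num.conj (g (w ^+ j)) - g (w ^+ j) * Num.conj (p (w ^+ j))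
     - p (w ^+ j) * Num.conj (g (w ^+ j)) + p (w ^+ j) * Num.conj (p (w ^+ j)))).
    by apply: eq_bigr => j _; rewrite -nrmK rmorphB; ring.
  rewrite big_split/= !sumrB e1 e2 e3 subrK; congr (_ - _).
  by apply: eq_bigr => j _; rewrite -nrmK.
rewrite subr_ge0 /B => h.
by rewrite ler_pdivlMl// ltr0n.
Qed.

(** Rotation by w permutes the sample points. *)
Lemma dft_rot (f : C -> C) k : dft M w (fun z => f (w * z)) k = zp w k * dft M w f k.
Proof.
case: hw => w1 wM _; rewrite /dft mulrCA; congr (_ * _); rewrite mulr_sumr.
pose F z := zp w k * (f z * zp (Num.conj z) k).
transitivity (\sum_(j < M) F (w ^+ j.+1)).
  apply: eq_bigr => j _; rewrite /F exprS rmorphM zpM mulrCA [zp w k * _]mulrA.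
  by rewrite zp_inv// mul1r.
transitivity (\sum_(j < M) F (w ^+ j)); last by [].
apply: (@addrI _ (F (w ^+ 0))); rewrite -(big_ord_recl M (fun j => F (w ^+ j))).
by rewrite big_ord_recr /= wM expr0 addrC.
Qed.

Lemma dft_neg (f : C -> C) n :
  dft M w f (Negz n) = Num.conj (dft M w (fun z => Num.conj (f z)) (Posz n.+1)).
Proof.
rewrite /dft rmorphM fmorphV rmorph_nat rmorph_sum; congr (_ * _).
apply: eq_bigr => j _; rewrite [RHS]rmorphM /=; congr (_ * _); first by rewrite conjCK.
by rewrite -[RHS]/(Num.conj (_ ^+ _)) [RHS]rmorphXn.
Qed.

End cyclic.

(** Apply Bessel's inequality to f(w z) - f(z), whose values at the samples
    are at most L times the mesh 2 pi/M and whose k-th coefficient is that of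
    f times w^k - 1. With 8m samples the angle 2 pi k/M is at most 1 for k <
    m, so |w^k - 1| is at least its sine, hence at least cos 1 times it. *)
Lemma bernstein_sq f (L : R) m : alip f L ->
  \sum_(k < m) (k%:R * nrm (dft (8 * m) (rootM (8 * m)) f (Posz k))) ^+ 2 <= (L / cos 1) ^+ 2.
Proof.
move=> fL; have L0 := alip_ge0 fL; have c1 := @cos1_gt0 R.
case: m => [|m]; first by rewrite big_ord0 sqr_ge0.
set M := (8 * m.+1)%N; set w := rootM M.
have M0 : (0 < M)%N by [].
have MR : (0 : R) < M%:R by rewrite ltr0n.
have hw : unity_root M w by exact: rootMP.
have mM : (m.+1 <= M)%N by rewrite leq_pmull.
have := dft_bessel hw M0 (fun z => -1 * f z + f (w * z)) mM.
have dk k : dft M w (fun z => -1 * f z + f (w * z)) k = (-1 + zp w k) * dft M w f k.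
  by rewrite dft_lin (dft_rot hw) mulrDl.
under eq_bigr do rewrite dk nrmM.
have hj (j : 'I_M) : nrm (-1 * f (w ^+ j) + f (w * w ^+ j)) ^+ 2 <= (L * (2 * pi / M%:R)) ^+ 2.
  rewrite lerXn2r ?nnegrE ?nrm_ge0 ?mulr_ge0 ?divr_ge0 ?pi_ge0//.
  rewrite mulN1r addrC /w /rootM expiX -expiD (le_trans (fL _ _))//.
  by rewrite addrK ger0_norm// divr_ge0// mulr_ge0// pi_ge0.
move=> h; have {}h := le_trans h (ler_wpM2l (ltW _) (ler_sum _ (fun j _ => hj j))).
have {h} : \sum_(k < m.+1) (nrm (-1 + zp w (Posz k)) * nrm (dft M w f (Posz k))) ^+ 2 <= (L * (2 * pi / M%:R)) ^+ 2.
  apply: (le_trans (h _)); first by rewrite invr_gt0.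
  set X := (L * _) ^+ 2; rewrite sumr_const card_ord -(mulr_natl X M).
  by rewrite (mulrA _ _ X) mulVf ?gt_eqF// mul1r.
(* A lower bound for |w^k - 1| is r k, and the mesh cancels against r. *)
pose r : R := cos 1 * (2 * pi / M%:R).
have r0 : 0 < r by rewrite mulr_gt0// divr_gt0// mulr_gt0// pi_gt0.
move=> h; have : \sum_(k < m.+1) r ^+ 2 * (k%:R * nrm (dft M w f (Posz k))) ^+ 2 <= (L * (2 * pi / M%:R)) ^+ 2.
  apply: le_trans h; apply: ler_sum => k _; rewrite -exprMn mulrA.
  have rk : 0 <= r * k%:R by rewrite mulr_ge0// ltW.
  apply: lerXn2r; rewrite ?nnegrE; first exact: (mulr_ge0 rk (nrm_ge0 _)).
    exact: (mulr_ge0 (nrm_ge0 _) (nrm_ge0 _)).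
  rewrite ler_wpM2r ?nrm_ge0//.
  rewrite /= /w /rootM expiX -(mulr_natr (2 * pi / M%:R) k).
  apply: (@le_trans _ _ (sin (2 * pi / M%:R * k%:R))).
    rewrite /r -(mulrA (cos 1)); apply: sin_ge_lin; rewrite mulr_ge0 ?divr_ge0 ?mulr_ge0 ?pi_ge0//=.
    rewrite mulrAC ler_pdivrMr// mul1r.
    apply: (@le_trans _ _ (8 * k%:R)).
      by rewrite ler_wpM2r//; have := pi_lt4; lra.
    by rewrite /M natrM ler_wpM2l// ler_nat ltnW.
  have /(_ R) := normIm_le (-1 + expi (2 * pi / M%:R * k%:R)).
  rewrite (_ : Im _ = sin (2 * pi / M%:R * k%:R)) ?[Im _]/= ?oppr0 ?add0r//.
  by apply: le_trans; exact: ler_norm.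
rewrite -mulr_sumr -ler_pdivlMl ?exprn_gt0// => /le_trans; apply.
rewrite le_eqVlt; apply/orP; left; apply/eqP; rewrite /r.
move: (pi : R) (M%:R : R) (@pi_gt0 R) MR => p q p0 q0; field.
by rewrite !gt_eqF.
Qed.

Lemma sum_inv_sq n : \sum_(k < n) (k.+1%:R^-1 : R) ^+ 2 <= 2.
Proof.
suff h : \sum_(k < n.+1) (k.+1%:R^-1 : R) ^+ 2 <= 2 - n.+1%:R^-1.
  case: n h => [|n] h; first by rewrite big_ord0.
  apply: (@le_trans _ _ (2 - n.+2%:R^-1)); last by rewrite gerBl invr_ge0.
  by apply: le_trans h; rewrite [leRHS]big_ord_recr /= lerDl sqr_ge0.
elim: n => [|n ih]; first by rewrite big_ord1 invr1 expr1n; lra.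
rewrite big_ord_recr /= (le_trans (lerD ih (lexx _)))//.
have a0 : (0 : R) < n.+1%:R by rewrite ltr0n.
rewrite -[n.+2%:R]natr1; move: (n.+1%:R : R) a0 => a a0.
have -> : 2 - a^-1 + (a + 1)^-1 ^+ 2 = 2 - (a + 1)^-1 - (a * (a + 1) ^+ 2)^-1.
  by field; rewrite !gt_eqF// ?ltr_wpDl// ltW.
by rewrite gerBl invr_ge0 mulr_ge0 ?sqr_ge0// ltW.
Qed.

(** Cauchy-Schwarz with the square-summable sequence 1/k. *)
Lemma bernstein_sum f (L : R) m : alip f L ->
  \sum_(p < m) nrm (dft (8 * m.+1) (rootM (8 * m.+1)) f (Posz p.+1)) <= 2 * (L / cos 1).
Proof.
move=> fL; have L0 := alip_ge0 fL; have c1 := @cos1_gt0 R.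
have e (p : 'I_m) : nrm (dft (8 * m.+1) (rootM (8 * m.+1)) f (Posz p.+1)) =
  p.+1%:R^-1 * (p.+1%:R * nrm (dft (8 * m.+1) (rootM (8 * m.+1)) f (Posz p.+1))).
  by rewrite mulrA mulVf ?mul1r// pnatr_eq0.
under eq_bigr do rewrite e.
apply: sum_CS.
- by move=> i; rewrite invr_ge0.
- by move=> i; rewrite mulr_ge0 ?nrm_ge0.
- by [].
- by rewrite divr_ge0// ltW.
- by rewrite (le_trans (sum_inv_sq m))// expr2; lra.
- have := bernstein_sq m.+1 fL; rewrite big_ord_recl /= mul0r expr0n add0r.
  by apply: le_trans.
Qed.

Lemma sum_dsum (V : zmodType) (F : int -> V) N :
  \sum_(m < N) dsum m F = dsum N (fun k => F k *+ (N - `|k|)).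
Proof.
elim: N => [|N ih]; first by rewrite big_ord0 /dsum big_ord0 mulr0n addr0.
rewrite big_ord_recr /= ih dsumS /= subnn !mulr0n !addr0 -dsum_add.
by apply: dsum_eq_in => k kN; rewrite subSn// mulrSr.
Qed.

Lemma fejC_dsum M (w : C) N f z : fejC M w N (zp z) f =
  dsum N (fun k => dft M w f k * ((N - `|k|)%:R / N%:R) * zp z k).
Proof.
rewrite /fejC sum_dsum (dsum_morph N _ (h := fun x => N%:R^-1 * x)) ?mulr0//; last exact: mulrDr.
by apply: dsum_eq => k /=; rewrite -[in LHS](mulr_natr _ (N - `|k|)); ring.
Qed.

Lemma trig_approx f (e : R) : ucont f -> 0 < e -> exists m (c : int -> C),
  forall z, nrm z = 1 -> nrm (f z - dsum m (fun k => c k * zp z k)) <= e.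
Proof.
move=> uf e0; have [N0 hN] := fejer_approx uf e0.
exists N0.+1, (fun k => dft N0.+1 (rootM N0.+1) f k * ((N0.+1 - `|k|)%:R / N0.+1%:R)) => z hz.
rewrite nrmB -fejC_dsum; apply: hN => //.
exact: rootMP.
Qed.

(** Fejér means with enough samples for the Bernstein bound; damping by the
    Fejér weights only decreases the coefficients. The coefficients of
    negative index are those of the conjugate function. The constant
    coefficient, which Bernstein's inequality does not control, contributes
    nothing to differences f(T1) - f(T0). *)
Lemma alip_approx f (L e : R) : alip f L -> 0 < e -> exists m (c : int -> C),
  (forall z, nrm z = 1 -> nrm (f z - dsum m (fun k => c k * zp z k)) <= e) /\
  \sum_(p < m) (nrm (c (Posz p.+1)) + nrm (c (Negz p))) <= 4 * (L / cos 1).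
Proof.
move=> fL e0; have [N0 hN] := fejer_approx (alip_ucont fL) e0.
pose N := N0.+1; pose M := (8 * N.+1)%N; pose w : C := rootM M.
have hw : unity_root M w by exact: rootMP.
have NM : (N <= M)%N by rewrite (leq_trans (leqnSn N))// leq_pmull.
pose c k := dft M w f k * ((N - `|k|)%:R / N%:R).
have hc k : nrm (c k) <= nrm (dft M w f k).
  rewrite /c nrmM [nrm (_ / _)]nrmM nrmV !nrm_nat ler_piMr ?nrm_ge0// ler_pdivrMr ?ltr0n// mul1r ler_nat.
  exact: leq_subr.
exists N, c; split.
  move=> z hz; rewrite nrmB -fejC_dsum.
  exact: (hN _ _ _ _ (leqnSn N0)).
apply: (@le_trans _ _ (\sum_(p < N) nrm (dft M w f (Posz p.+1)) +
    \sum_(p < N) nrm (dft M w (fun z => Num.conj (f z)) (Posz p.+1)))).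
  rewrite -big_split; apply: ler_sum => p _; apply: (lerD (hc _)).
  by apply: (le_trans (hc _)); rewrite dft_neg; rewrite nrm_conj.
have h1 := bernstein_sum N fL; have h2 := bernstein_sum N (alip_conj fL).
by apply: le_trans (lerD h1 h2) _; lra.
Qed.

End Bernstein.

(** * Differences of functions of two contractions *)

Section Differences.
Context {R : realType} {H : hilbertType R}.
Local Notation C := R[i].
Context (T0 T1 : H -> H) (h0 : opb T0 1) (h1 : opb T1 1).
Context (r d : R) (r0 : 0 <= r) (r1 : r < 1) (hd : hs (fun x => T1 x - T0 x) d).
Context (strict : opb T0 r \/ opb T1 r).

Let l1r : 0 < 1 - r. Proof. by rewrite subr_gt0. Qed.
Let d0 : 0 <= d. Proof. by case: hd. Qed.

Let opb1_iter (T : H -> H) n : opb T 1 -> opb (iter n T) 1.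
Proof. by move=> /(opb_iter n); rewrite expr1n. Qed.

(** Telescoping: if T0 is strict, T1^(n+1) - T0^(n+1) = T1 (T1^n - T0^n) + (T1
    - T0) T0^n, and symmetrically if T1 is. The Hilbert-Schmidt bounds then
    add up to a geometric series, which is where strictness of one contraction
    enters. *)
Lemma iter_diff_hs n : hs (fun x => iter n T1 x - iter n T0 x) (d / (1 - r)).
Proof.
suff h : hs (fun x => iter n T1 x - iter n T0 x) (d * ((1 - r ^+ n) / (1 - r))).
  apply: hs_le h; rewrite ler_wpM2l// ler_pdivrMr// mulVf ?gt_eqF//.
  by rewrite gerBl exprn_ge0.
elim: n => [|n ih].
  rewrite expr0 subrr mul0r mulr0 (_ : (fun x => _) = fun=> 0); first exact: hs0.
  by apply/funext => x; rewrite subrr.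
(* Two ways to split the geometric sum, one for each position of the strict
   factor. *)
have e : d * ((1 - r ^+ n.+1) / (1 - r)) = 1 * (d * ((1 - r ^+ n) / (1 - r))) + d * r ^+ n.
  by rewrite exprS; field; rewrite gt_eqF.
have e' : d * ((1 - r ^+ n.+1) / (1 - r)) = r ^+ n * d + d * ((1 - r ^+ n) / (1 - r)) * 1.
  by rewrite exprS; field; rewrite gt_eqF.
case: strict => hr.
  rewrite e; have := hsD (hs_compl h1 ih) (hs_compr hd (opb_iter n hr)).
  rewrite (_ : (fun x => _) = (fun x => iter n.+1 T1 x - iter n.+1 T0 x))//.
  have [l1 _ _] := h1; apply/funext => x /=; rewrite (linBB l1).
  exact: subrKA.
rewrite e'; have := hsD (hs_compl (opb_iter n hr) hd) (hs_compr ih h0).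
rewrite (_ : (fun x => _) = (fun x => iter n.+1 T1 x - iter n.+1 T0 x))//.
have [l1 _ _] := opb_iter n h1; apply/funext => x; rewrite 2!iterSr /= (linBB l1).
exact: subrKA.
Qed.

(** Negative powers are the adjoints of positive ones. *)
Lemma zpower_diff_hs k : hs (fun x => zpower T1 k x - zpower T0 k x) (d / (1 - r)).
Proof.
case: k => n; first exact: iter_diff_hs.
have := hs_adj (iter_diff_hs n.+1).
rewrite (_ : adj _ = (fun x => zpower T1 (Negz n) x - zpower T0 (Negz n) x))//.
apply: adj_uniq => x y; rewrite hdotBl (adjP (opb1_iter n.+1 h1)) (adjP (opb1_iter n.+1 h0)).
by rewrite (adj_iter _ h1) (adj_iter _ h0) hdotBr.
Qed.

(** The term of index 0 is the difference of two identities. *)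
Lemma dsum_diff_hs m (c : int -> C) :
  hs (fun x => dsum m (fun k => c k *: (zpower T1 k x - zpower T0 k x)))
    (\sum_(p < m) (nrm (c (Posz p.+1)) + nrm (c (Negz p))) * (d / (1 - r))).
Proof.
have hk k := hsZ (c k) (zpower_diff_hs k).
have := hs_sum (index_enum 'I_m) (fun p : 'I_m => hsD (hk (Posz p.+1)) (hk (Negz p))).
rewrite (_ : (fun x => _) = (fun x => dsum m (fun k => c k *: (zpower T1 k x - zpower T0 k x)))).
  by under eq_bigr do rewrite -mulrDl.
by apply/funext => x; rewrite /dsum /= subrr scaler0 add0r.
Qed.

Definition cdiff (f : C -> C) (x : H) := contraction_calculus T1 f x - contraction_calculus T0 f x.

Lemma cdiff_opb f : ucont f -> exists M, opb (cdiff f) M.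
Proof.
move=> uf; have [B B0 hB] := ucont_bounded uf; exists (B + B).
by apply: opbB; exact: ccalc_opb.
Qed.

Lemma cdiff_lin a f g x : ucont f -> ucont g ->
  cdiff (fun z => a * f z + g z) x = a *: cdiff f x + cdiff g x.
Proof.
move=> uf ug; rewrite /cdiff !ccalc_lin// scalerBr opprD addrACA.
by [].
Qed.

Lemma cdiff_zp k x : cdiff (zp ^~ k) x = zpower T1 k x - zpower T0 k x.
Proof. by rewrite /cdiff !ccalc_zp. Qed.

(** Approximate f by trigonometric polynomials whose nonconstant coefficients
    have uniformly bounded sum ([alip_approx]); the corresponding differences
    are uniformly bounded in Hilbert-Schmidt norm and converge pointwise to
    that of f. *)
Lemma cdiff_hs f L : alip f L -> hs (cdiff f) (4 * (L / cos 1) * (d / (1 - r))).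
Proof.
move=> fL; have uf := alip_ucont fL.
have ex n : exists mc : nat * (int -> C),
    (forall z, nrm z = 1 -> nrm (f z - dsum mc.1 (fun k => mc.2 k * zp z k)) <= n.+1%:R^-1) /\
    \sum_(p < mc.1) (nrm (mc.2 (Posz p.+1)) + nrm (mc.2 (Negz p))) <= 4 * (L / cos 1).
  have n0 : (0 : R) < n.+1%:R^-1 by rewrite invr_gt0.
  by have [m [c hc]] := alip_approx fL n0; exists (m, c).
have [mc hmc] := boolp.choice ex.
pose A n x := dsum (mc n).1 (fun k => (mc n).2 k *: (zpower T1 k x - zpower T0 k x)).
apply: (@hs_tends _ _ _ A _ _ 0%N); first exact: cdiff_opb.
  move=> n _; apply: hs_le (dsum_diff_hs _ _).
  have [_ h] := hmc n; rewrite -mulr_suml ler_wpM2r//.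
  by rewrite divr_ge0// ltW.
move=> x e e0; have x1 : 0 < 2 * (nrm x + 1) by rewrite mulr_gt0// ltr_wpDl ?nrm_ge0.
have [N hN] := invS_small (divr_gt0 e0 x1); exists N => n Nn.
have n0 : (0 : R) <= n.+1%:R^-1 by rewrite invr_ge0.
have [ha _] := hmc n.
have k1 := ccalc_approx h1 x uf n0 ha; have k0 := ccalc_approx h0 x uf n0 ha.
have -> : A n x - cdiff f x =
  (contraction_calculus T0 f x - dsum (mc n).1 (fun k => (mc n).2 k *: zpower T0 k x)) -
  (contraction_calculus T1 f x - dsum (mc n).1 (fun k => (mc n).2 k *: zpower T1 k x)).
  have -> : A n x = dsum (mc n).1 (fun k => (mc n).2 k *: zpower T1 k x) -
      dsum (mc n).1 (fun k => (mc n).2 k *: zpower T0 k x).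
    rewrite -[dsum _ (fun k => _ *: zpower T0 k x)]opprK opprK.
    rewrite (dsum_morph _ _ (h := fun v : H => - v)) ?oppr0//; last by move=> u v; rewrite opprD.
    by rewrite -dsum_add; apply: dsum_eq => k /=; rewrite scalerBr.
  rewrite /cdiff !opprB.
  by rewrite addrACA [RHS]addrACA; congr (_ + _); exact: addrC.
rewrite (le_lt_trans (nrmD _ _))// nrmN (le_lt_trans (lerD k0 k1))//.
have := hN n Nn; rewrite ltr_pdivlMr// => h; apply: le_lt_trans h.
by rewrite -mulrDr ler_wpM2l//; lra.
Qed.

End Differences.

Section TraceFunctional.
Context {R : realType} {H : hilbertType R}.
Local Notation C := R[i].
Context (X : H -> H) (s : R^nat) (e f : nat -> H).
Context (sve : singular_value_expansion X s e f).
Context (S : R) (hS : forall n, \sum_(0 <= k < n) s k ^+ 2 <= S).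

(** The case m = 0 of [tau_tail]: Cauchy-Schwarz for the Hilbert-Schmidt inner
    product. *)
Lemma trace_bound A M : hs A M -> nrm (trace (A \o X)) <= Num.sqrt S * M.
Proof.
move=> hA; have [t ht] := tau_cauchy sve hS hA; rewrite (traceE sve hS hA ht).
have S0 : 0 <= S by rewrite (le_trans _ (hS 0))// big_geq.
apply: (tends_bound (N := 0%N) ht) => n _.
have := tau_tail sve hA (y := fun k => A (f k)) (leq0n n) (sqrtr_ge0 S) (fun k => lexx _).
rewrite sqr_sqrtr// => /(_ (hS n)) h; apply: (le_trans h).
by rewrite /sidx /index_iota subnn /= big_nil add0r.
Qed.

Lemma trace_lin a A B M N : hs A M -> hs B N ->
  trace ((fun x => a *: A x + B x) \o X) = a * trace (A \o X) + trace (B \o X).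
Proof.
move=> hA hB; have [t ht] := tau_cauchy sve hS hA; have [u hu] := tau_cauchy sve hS hB.
rewrite (traceE sve hS hA ht) (traceE sve hS hB hu).
apply: (traceE sve hS (hsD (hsZ a hA) hB)).
apply: tends_ext (tendsD (tendsMl a ht) hu) => n.
rewrite /tau_partial mulr_sumr -big_split; apply: eq_bigr => k _ /=.
by rewrite hdotDl hdotZl mulrDr mulrCA.
Qed.

End TraceFunctional.

(** * Almost everywhere limits of sequences with summable L1 increments *)

Section L1Limit.
Context {R : realType}.
Local Notation mu := (@lebesgue_measure R).
Local Notation D := (`[0, 2 * pi]%classic : set R).

Lemma ae_imp (P Q : R -> Prop) : (forall t, P t -> Q t) ->
  (\forall t \ae mu, P t) -> \forall t \ae mu, Q t.
Proof. by move=> PQ; apply: negligibleS; apply: subsetC => t; exact: PQ. Qed.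

(** The sum V of the absolute increments is integrable by monotone
    convergence, hence finite almost everywhere, where the sequence converges.
    As |u_n| <= |u_0| + V, dominated convergence applies against any
    continuous g. This replaces completeness of L1. *)
Lemma L1_limit (u : nat -> R -> R) (K : R) : (forall j, continuous (u j)) ->
  (forall n, \sum_(j < n) Rintegral mu D (fun t => `|u j.+1 t - u j t|) <= K) ->
  exists h : R -> R, mu.-integrable D (EFin \o h) /\ forall g : R -> R, continuous g ->
    (fun n => Rintegral mu D (fun t => g t * u n t)) @ \oo --> Rintegral mu D (fun t => g t * h t).
Proof.
move=> cu hK.
have cv j : continuous (fun t => `|u j.+1 t - u j t|).
  by move=> t; apply: cvg_norm; apply: cvgB; exact: cu.
have meas (w : R -> R) : continuous w -> measurable_fun D w.
  by move=> cw; apply/measurable_funTS; exact: measurable_realfun.continuous_measurable_fun.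
pose v (j : nat) (t : R) : \bar R := (`|u j.+1 t - u j t|)%:E.
pose V (t : R) : \bar R := (\sum_(0 <= j <oo) v j t)%E.
have mv j : measurable_fun D (v j) by apply/measurable_EFinP; exact: meas.
have v0 j t : (0%R <= v j t)%E by rewrite lee_fin.
have mV : measurable_fun D V by exact: (@ge0_emeasurable_sum _ _ _ D v xpredT).
have V0 t : (0%R <= V t)%E by exact: nneseries_ge0.
have iv j : mu.-integrable D (v j) by exact: (rint_cont (cv j)).
have iV : mu.-integrable D V.
  apply/integrableP; split=> //.
  under eq_integral do rewrite gee0_abs//.
  rewrite integral_nneseries//; apply: (@le_lt_trans _ _ K%:E); last exact: ltry.
  apply: lime_le; first by apply: is_cvg_nneseries => n _ _; exact: integral_ge0.
  apply: nearW => n; rewrite /= big_mkord.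
  rewrite (eq_bigr (fun j : 'I_n => (Rintegral mu D (fun t => `|u j.+1 t - u j t|))%:E)); last first.
    by move=> j _; rewrite fineK//; apply: (integrable_fin_num _ (iv j)).
  by rewrite sumEFin lee_fin; exact: hK.
pose G (t : R) : \bar R := ((`|u 0%N t|)%:E + V t)%E.
have iu0 : mu.-integrable D (fun t => (`|u 0%N t|)%:E).
  by apply: (@rint_cont _ (fun t => `|u 0%N t|)) => t; apply: cvg_norm; exact: cu.
have iG : mu.-integrable D G by exact: integrableD.
have mG : forall t, V t \is a fin_num -> cvgn (u ^~ t).
  move=> t Vf; have : cvgn [normed series (fun j => u j.+1 t - u j t)].
    apply: nondecreasing_is_cvgn.
      by apply/nondecreasing_seqP => n; rewrite /= /series /= big_nat_recr//= lerDl.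
    exists (fine (V t)) => _ [n _ <-]; rewrite -lee_fin fineK// /= /series /= -sumEFin.
    exact: (nneseries_lim_ge (P := xpredT)).
  move=> /normed_cvg; have e : u ^~ t = (fun n => series (fun j => u j.+1 t - u j t) n + u 0%N t).
    by apply/funext => n; rewrite /series /= telescope_sumr// subrK.
  move=> c; rewrite e; apply: is_cvgD => //; exact: is_cvg_cst.
have uG t n : ((`|u n t|)%:E <= G t)%E.
  have hV : (\sum_(0 <= j < n) v j t <= V t)%E by exact: (nneseries_lim_ge (P := xpredT)).
  apply: (@le_trans _ _ ((`|u 0%N t|)%:E + \sum_(0 <= j < n) v j t)%E); last exact: leeD2l.
  rewrite /v sumEFin -EFinD lee_fin -{1}(subrK (u 0%N t) (u n t)) addrC.
  rewrite (le_trans (ler_normD _ _))// lerD2l -(telescope_sumr (u ^~ t) (leq0n n)).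
  exact: ler_norm_sum.
pose h t := fine (limn_esup (fun n => (u n t)%:E)).
have mh : measurable_fun D h.
  apply: (measurableT_comp (fine_measurable measurableT)).
  apply: measurable_fun_limn_esup => n.
  by apply/measurable_EFinP; exact: meas.
have uh t : V t \is a fin_num -> u ^~ t @ \oo --> h t.
  move=> /mG c; suff -> : h t = limn (u ^~ t) by [].
  have c' : (fun n => (u n t)%:E) @ \oo --> (limn (u ^~ t))%:E by apply: cvg_EFin => //; exact: nearW.
  rewrite /h is_cvg_limn_esupE; last by apply/cvg_ex; exists (limn (u ^~ t))%:E.
  by rewrite (cvg_lim _ c').
have ae : \forall t \ae mu, D t -> V t \is a fin_num by exact: integrable_ae.
have dct (g : R -> R) : continuous g -> mu.-integrable D (EFin \o (fun t => g t * h t)) /\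
    (fun n => Rintegral mu D (fun t => g t * u n t)) @ \oo --> Rintegral mu D (fun t => g t * h t).
  move=> cg; have [B gB] : exists B : R, forall t, D t -> `|g t| <= B.
    have : bounded_set (g @` D).
      apply: compact_bounded; apply: continuous_compact; last exact: segment_compact.
      exact: continuous_subspaceT.
    move=> [M [Mr hM]]; exists (`|M| + 1) => t Dt; apply: (hM (`|M| + 1)); last by exists t.
    by rewrite (le_lt_trans (ler_norm _))// ltrDl.
  have [|||||h1 _ h3] := @dominated_convergence _ _ _ mu D (measurable_itv _)
     (fun n t => (g t * u n t)%:E) (fun t => (g t * h t)%:E) (fun t => (B%:E * G t)%E).
  - by move=> n; apply/measurable_EFinP; apply: measurable_funM; exact: meas.
  - by apply/measurable_EFinP; apply: measurable_funM => //; exact: meas.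
  - apply: ae_imp ae => t ht Dt; apply: cvg_EFin; first exact: nearW.
    by apply: cvgM; [exact: cvg_cst|exact: uh (ht Dt)].
  - exact: integrableZl.
  - apply: aeW => t n Dt; rewrite abse_EFin normrM EFinM.
    apply: lee_pmul => //; by rewrite ?lee_fin// gB.
  split=> //; have := h3; rewrite -[(\int[mu]_(x in D) _)%E]fineK; last exact: integrable_fin_num.
  by move=> /fine_cvg.
exists h; split; last by move=> g /dct[].
have [] := dct (fun=> 1) (fun=> @cst_continuous _ _ _ _).
by rewrite (_ : (fun t => 1 * h t) = h)//; apply/funext => t; rewrite mul1r.
Qed.

End L1Limit.

(** * Integrable functions with prescribed derivative coefficients *)

Section FourierSeries.
Context {R : realType}.
Local Notation C := R[i].
Local Notation mu := (@lebesgue_measure R).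
Local Notation D := (`[0, 2 * pi]%classic : set R).
Local Notation ci := (cintegral D).
Local Notation Re := complex.Re.
Local Notation Im := complex.Im.

Lemma zp_ccont k : ccont (fun t : R => zp (expi t) k).
Proof. exact: (ucont_ccont (@ucont_zp R k)). Qed.

Lemma trig_ccont n (c : int -> C) : ccont (fun t => dsum n (fun k => c k * zp (expi t) k)).
Proof. exact: (ucont_ccont (ucont_dsum n c)). Qed.

Lemma expi0_2pi k : zp (expi (2 * pi)) k = zp (expi 0 : C) k.
Proof. by rewrite expi_2pi expi0. Qed.

(** For k <> 0 the exponential has a periodic primitive. *)
Lemma ci_zp k : ci (fun t => zp (expi t) k) = if k == 0 then (2 * pi)%:C else 0.
Proof.
have [->|k0] := eqVneq k 0.
  rewrite -[RHS]mulr1 -ci_cst; apply: ci_ext => t _.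
  by [].
have := ci_FTC (cisd_zp k) (ccontM (ccont_cst (imul k)) (zp_ccont k)).
rewrite /comp expi0_2pi subrr ciZ; last exact/cint_cont/zp_ccont.
by move/eqP; rewrite mulf_eq0 (negPf (imul_eq0 k0)) => /eqP.
Qed.

Lemma ci_bigsum I (r : seq I) (F : I -> R -> C) : (forall i, cintegrable D (F i)) ->
  ci (fun t => \sum_(i <- r) F i t) = \sum_(i <- r) ci (F i).
Proof.
move=> iF; suff [] : cintegrable D (fun t => \sum_(i <- r) F i t) /\
  ci (fun t => \sum_(i <- r) F i t) = \sum_(i <- r) ci (F i) by [].
elim: r => [|i r [ih1 ih2]].
  rewrite (_ : (fun t => _) = fun=> 0); last by apply/funext => t; rewrite big_nil.
  by rewrite ci0 big_nil; split=> //; exact/cint_cont/ccont_cst.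
rewrite (_ : (fun t => _) = fun t => F i t + \sum_(i <- r) F i t); last first.
  by apply/funext => t; rewrite big_cons.
by split; [exact: cintD|rewrite ciD// ih2 big_cons].
Qed.

Lemma dsum_sub (V : zmodType) n m (F : int -> V) : (n <= m)%N ->
  dsum m F = dsum n F + \sum_(n <= p < m) (F (Posz p.+1) + F (Negz p)).
Proof.
move=> nm; rewrite /dsum -addrA; congr (_ + _).
by rewrite -(big_mkord xpredT (fun p => F (Posz p.+1) + F (Negz p))) (big_cat_nat _ nm)// big_mkord.
Qed.

Lemma ci_zp_trig n (c : int -> C) l :
  ci (fun t => zp (expi t) l * dsum n (fun k => c k * zp (expi t) k)) =
    if (`|l| <= n)%N then (2 * pi)%:C * c (- l) else 0.
Proof.
have one k : ci (fun t => c k * (zp (expi t) l * zp (expi t) k)) =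
    if k == - l then (2 * pi)%:C * c (- l) else 0.
  rewrite ciZ; last by apply/cint_cont/ccontM; exact: zp_ccont.
  rewrite (@ci_ext _ _ (fun t => zp (expi t) (l + k))); last first.
    by move=> t _; rewrite zp_addC// nrm_expi.
  rewrite ci_zp addrC addr_eq0; case: eqP => [->|_]; last by rewrite mulr0.
  by rewrite mulrC.
have ic k : cintegrable D (fun t => c k * (zp (expi t) l * zp (expi t) k)).
  by apply/cint_cont/ccontM; [exact: ccont_cst|apply: ccontM; exact: zp_ccont].
transitivity (dsum n (fun k => if k == - l then (2 * pi)%:C * c (- l) else 0)); last first.
  rewrite (@dsum_single _ _ _ (- l)) => [|k /negPf ->//].
  by rewrite abszN eqxx.
transitivity (ci (fun t => c (Posz 0) * (zp (expi t) l * zp (expi t) (Posz 0)) +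
   \sum_(p < n) (c (Posz p.+1) * (zp (expi t) l * zp (expi t) (Posz p.+1)) +
      c (Negz p) * (zp (expi t) l * zp (expi t) (Negz p))))).
  apply: ci_ext => t _; rewrite /dsum mulrDr mulr_sumr; congr (_ + _); first exact: mulrCA.
  by apply: eq_bigr => p _; rewrite mulrDr; congr (_ + _); exact: mulrCA.
have iS n' : cintegrable D (fun t => \sum_(p < n') (c (Posz p.+1) * (zp (expi t) l * zp (expi t) (Posz p.+1)) +
      c (Negz p) * (zp (expi t) l * zp (expi t) (Negz p)))).
  elim: n' => [|n' ih].
    rewrite (_ : (fun t => _) = fun=> 0); last by apply/funext => t; rewrite big_ord0.
    exact/cint_cont/ccont_cst.
  rewrite (_ : (fun t => _) = (fun t => \sum_(p < n') (c (Posz p.+1) * (zp (expi t) l * zp (expi t) (Posz p.+1)) +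
      c (Negz p) * (zp (expi t) l * zp (expi t) (Negz p))) +
     (c (Posz n'.+1) * (zp (expi t) l * zp (expi t) (Posz n'.+1)) + c (Negz n') * (zp (expi t) l * zp (expi t) (Negz n'))))); last first.
    by apply/funext => t; rewrite big_ord_recr.
  by apply: cintD => //; exact: cintD.
rewrite ciD// /dsum one; congr (_ + _).
rewrite (@ci_bigsum _ (index_enum 'I_n) (fun p : 'I_n => fun t => c (Posz p.+1) * (zp (expi t) l * zp (expi t) (Posz p.+1)) +
      c (Negz p) * (zp (expi t) l * zp (expi t) (Negz p)))); last by move=> p; exact: cintD.
by apply: eq_bigr => p _; rewrite ciD// !one.
Qed.

Lemma sum_inv_sq_tail n m : (0 < n)%N -> (n <= m)%N ->
  \sum_(n <= p < m) (p.+1%:R^-1 : R) ^+ 2 <= n%:R^-1.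
Proof.
move=> n0 nm; suff h : \sum_(n <= p < m) (p.+1%:R^-1 : R) ^+ 2 <= n%:R^-1 - m%:R^-1.
  by rewrite (le_trans h)// gerBl invr_ge0.
elim: m nm => [|m ih]; first by rewrite leqn0 => /eqP n00; rewrite n00 in n0.
rewrite leq_eqVlt => /predU1P[->|]; first by rewrite big_geq// subrr.
rewrite ltnS => nm; rewrite big_nat_recr//= (le_trans (lerD (ih nm) (lexx _)))//.
have m0 : (0 : R) < m%:R by rewrite ltr0n (leq_trans n0).
rewrite -[m.+1%:R]natr1; move: (m%:R : R) m0 (n%:R^-1 : R) => a a0 b.
have -> : b - a^-1 + (a + 1)^-1 ^+ 2 = b - (a + 1)^-1 - (a * (a + 1) ^+ 2)^-1.
  by field; rewrite !gt_eqF// ltr_wpDl// ltW.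
by rewrite gerBl invr_ge0 mulr_ge0 ?sqr_ge0// ltW.
Qed.

Section series.
Context (b : int -> C) (B : R) (B0 : 0 <= B).
Context (hb : forall k, k != 0 -> nrm (b k) <= B / `|k|%:R).

Let S n t := dsum n (fun k => b k * zp (expi t) k).

(** Parseval for a block of frequencies between n and m: the integral is the
    sum of 2 pi |b k|^2 over n < |k| <= m, and |b k| <= B/|k|. *)
Lemma block_sq n m : (0 < n)%N -> (n <= m)%N ->
  Rintegral mu D (fun t => nrm (S m t - S n t) ^+ 2) <= 4 * pi * B ^+ 2 / n%:R.
Proof.
move=> n0 nm; pose W t := S m t - S n t.
have cW : ccont W.
  have := ccontD (trig_ccont m b) (ccontM (ccont_cst (-1)) (trig_ccont n b)).
  by rewrite (_ : (fun t => _) = W)//; apply/funext => t; rewrite mulN1r.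
have conjzp (t : R) k : Num.conj (zp (expi t) k) = zp (expi t) (- k).
  apply: (@mulfI _ (zp (expi t) k)).
    apply/eqP => e0; move: (zp_nrm k (nrm_expi t)); rewrite e0 nrm0 => /esym/eqP.
    by rewrite oner_eq0.
  by rewrite conjM1 ?zp_nrm ?nrm_expi// zp_addC ?nrm_expi// subrr.
have iW l : (n < `|l| <= m)%N -> ci (fun t => W t * zp (expi t) (- l)) = (2 * pi)%:C * b l.
  move=> /andP[nl lm].
  rewrite (@ci_ext _ _ (fun t => zp (expi t) (- l) * S m t - zp (expi t) (- l) * S n t)); last first.
    by move=> t _; rewrite -mulrBr mulrC.
  rewrite ciB; try by apply/cint_cont/ccontM; [exact: zp_ccont|exact: trig_ccont].
  by rewrite !ci_zp_trig abszN lm leqNgt nl /= subr0 opprK.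
have WE t : Num.conj (W t) = \sum_(n <= p < m) (Num.conj (b (Posz p.+1)) * zp (expi t) (- Posz p.+1) +
    Num.conj (b (Negz p)) * zp (expi t) (- Negz p)).
  rewrite /W /S (dsum_sub _ nm) addrAC subrr add0r rmorph_sum; apply: eq_bigr => p _.
  by rewrite rmorphD; congr (_ + _); rewrite rmorphM; congr (_ * _); exact: conjzp.
pose F (p : nat) t := Num.conj (b (Posz p.+1)) * (W t * zp (expi t) (- Posz p.+1)) +
    Num.conj (b (Negz p)) * (W t * zp (expi t) (- Negz p)).
have iWz l : cintegrable D (fun t => W t * zp (expi t) l).
  by apply/cint_cont/ccontM => //; exact: zp_ccont.
have iZ (a : C) l : cintegrable D (fun t => a * (W t * zp (expi t) l)).
  by apply: (@cint_mul _ (fun=> a)) => //; exact: ccont_cst.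
have e : ci (fun t => W t * Num.conj (W t)) = \sum_(n <= p < m) ci (F p).
  rewrite -ci_bigsum => [|p]; last exact: cintD.
  apply: ci_ext => t _; rewrite WE mulr_sumr; apply: eq_bigr => p _.
  by rewrite mulrDr; congr (_ + _); exact: mulrCA.
have e2 : ci (fun t => W t * Num.conj (W t)) =
  (\sum_(n <= p < m) 2 * pi * (nrm (b (Posz p.+1)) ^+ 2 + nrm (b (Negz p)) ^+ 2))%:C.
  rewrite e rmorph_sum !big_nat; apply: eq_bigr => p /andP[np pm].
  have l1 : (n < `|Posz p.+1| <= m)%N by rewrite /= ltnS np.
  have l2 : (n < `|Negz p| <= m)%N by rewrite /= ltnS np.
  rewrite /F (ciD (iZ _ _) (iZ _ _)) (ciZ _ (iWz _)) (ciZ _ (iWz _)) (iW _ l1) (iW _ l2).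
  transitivity ((2 * pi)%:C * ((nrm (b (Posz p.+1)) ^+ 2)%:C + (nrm (b (Negz p)) ^+ 2)%:C)); last first.
    by rewrite [RHS]rmorphM rmorphD.
  rewrite -!nrmK [RHS]mulrDr; congr (_ + _); rewrite mulrCA; congr (_ * _); exact: mulrC.
have e3 : ci (fun t => W t * Num.conj (W t)) = (Rintegral mu D (fun t => nrm (W t) ^+ 2))%:C.
  by rewrite -ci_re; apply: ci_ext => t _; rewrite nrmK.
move: e2; rewrite e3 => /complexI; rewrite {1}/W => ->.
apply: (@le_trans _ _ (\sum_(n <= p < m) 4 * pi * B ^+ 2 * (p.+1%:R^-1) ^+ 2)).
  apply: ler_sum => p _.
  have h1 : nrm (b (Posz p.+1)) ^+ 2 <= B ^+ 2 * (p.+1%:R^-1) ^+ 2.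
    by rewrite -exprMn lerXn2r ?nnegrE ?nrm_ge0 ?mulr_ge0 ?invr_ge0// hb.
  have h2 : nrm (b (Negz p)) ^+ 2 <= B ^+ 2 * (p.+1%:R^-1) ^+ 2.
    by rewrite -exprMn lerXn2r ?nnegrE ?nrm_ge0 ?mulr_ge0 ?invr_ge0// hb.
  have -> : 4 * pi * B ^+ 2 * (p.+1%:R^-1) ^+ 2 =
      2 * pi * (B ^+ 2 * (p.+1%:R^-1) ^+ 2 + B ^+ 2 * (p.+1%:R^-1) ^+ 2).
    by move: (pi : R) (p.+1%:R^-1 : R) => x y; ring.
  by rewrite ler_wpM2l ?lerD// mulr_ge0// pi_ge0.
rewrite -mulr_sumr ler_wpM2l ?mulr_ge0 ?sqr_ge0 ?pi_ge0//.
exact: sum_inv_sq_tail.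
Qed.

(** From |W| <= (e + |W|^2/e)/2 integrated over the period. The map u is the
    real or the imaginary part. *)
Lemma block_abs n m (e : R) (u : C -> R) : (forall z, `|u z| <= nrm z) ->
  continuous (fun t => u (S m t - S n t)) -> (0 < n)%N -> (n <= m)%N -> 0 < e ->
  Rintegral mu D (fun t => `|u (S m t - S n t)|) <= (2 * pi * e + 4 * pi * B ^+ 2 / n%:R / e) / 2.
Proof.
move=> hu cu n0 nm e0; pose W t := S m t - S n t.
have cW : ccont W.
  have := ccontD (trig_ccont m b) (ccontM (ccont_cst (-1)) (trig_ccont n b)).
  by rewrite (_ : (fun t => _) = W)//; apply/funext => t; rewrite mulN1r.
have cN : continuous (fun t => nrm (W t) ^+ 2).
  case: cW => c1 c2; rewrite (_ : (fun t => _) = (fun t => Re (W t) * Re (W t) + Im (W t) * Im (W t))).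
    by move=> t; exact: (cvgD (cvgM (c1 t) (c1 t)) (cvgM (c2 t) (c2 t))).
  by apply/funext => t; rewrite nrm_sqE !expr2.
have i1 : mu.-integrable D (EFin \o (fun t => `|u (W t)|)).
  by apply: rint_cont => t; apply: cvg_norm; exact: cu.
have i2 := rintZ ((2 * e)^-1) (rint_cont cN).
have i3 : mu.-integrable D (EFin \o (fun=> e / 2 : R)) by apply: rint_cont; exact: cst_continuous.
apply: (@le_trans _ _ (Rintegral mu D (fun t => e / 2 + (2 * e)^-1 * nrm (W t) ^+ 2))).
  apply: le_Rintegral => //; first exact: rintD.
  move=> t _; rewrite (le_trans (hu _))// -/(W t); have := nrm_ge0 (W t).
  move: (nrm (W t)) => x x0; have -> : e / 2 + (2 * e)^-1 * x ^+ 2 = x + (2 * e)^-1 * (x - e) ^+ 2.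
    by field; rewrite gt_eqF.
  by rewrite lerDl mulr_ge0 ?sqr_ge0// invr_ge0 mulr_ge0// ltW.
rewrite RintegralD// [X in _ + X <= _]RintegralZl//; last exact: rint_cont.
have -> : Rintegral mu D (fun=> e / 2) = 2 * pi * e / 2.
  have := ci_cst (e / 2)%:C; rewrite ci_re -rmorphM => /complexI ->.
  by rewrite !mulrA.
have := block_sq n0 nm; rewrite -/(W _) => h.
rewrite [leRHS]mulrDl lerD2l.
rewrite (_ : _ / e / 2 = (2 * e)^-1 * (4 * pi * B ^+ 2 / n%:R)).
  by rewrite ler_wpM2l// invr_ge0 mulr_ge0// ltW.
by rewrite -[LHS]mulrA -invfM [LHS]mulrC (mulrC e).
Qed.

Lemma four_le j : (4 ^ j <= 4 ^ j.+1)%N.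
Proof. by rewrite leq_exp2l. Qed.

(** Along the powers of 4 the squared L2 norm of the j-th block is of order
    4^-j; the weight e = 2^-j balances both terms in [block_abs], so the L1
    norms of the blocks decrease geometrically. *)
Lemma block_lacunary (u : C -> R) : (forall z, `|u z| <= nrm z) ->
  (forall m n, continuous (fun t => u (S m t - S n t))) ->
  forall N, \sum_(j < N) Rintegral mu D (fun t => `|u (S (4 ^ j.+1) t - S (4 ^ j) t)|) <=
    2 * pi + 4 * pi * B ^+ 2.
Proof.
move=> hu cu N; set K := _ + _.
have K0 : 0 <= K by rewrite addr_ge0 ?mulr_ge0 ?sqr_ge0 ?pi_ge0.
apply: (@le_trans _ _ (\sum_(j < N) K / 2 * 2^-1 ^+ j)).
  apply: ler_sum => j _.
  have p0 : (0 : R) < 2^-1 ^+ j by rewrite exprn_gt0// invr_gt0.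
  have f0 : (0 < 4 ^ j)%N by rewrite expn_gt0.
  apply: le_trans (block_abs hu (cu _ _) f0 (four_le j) p0) _.
  have -> : (4 ^ j)%:R = (2^-1 ^+ j)^-1 ^+ 2 :> R.
    by rewrite natrX (exprVn 2 j) invrK -exprM mulnC exprM; congr (_ ^+ j); rewrite expr2 -natrM.
  move: (2^-1 ^+ j : R) p0 => p p0; rewrite le_eqVlt; apply/orP; left; apply/eqP; rewrite /K.
  by move: (pi : R) => q; field; rewrite gt_eqF.
rewrite -mulr_sumr; have h : \sum_(j < N) (2^-1 : R) ^+ j <= 2.
  suff -> : \sum_(j < N) (2^-1 : R) ^+ j = 2 - 2 * 2^-1 ^+ N.
    by rewrite gerBl mulr_ge0// exprn_ge0// invr_ge0.
  elim: N => [|N ih]; first by rewrite big_ord0 expr0 mulr1 subrr.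
  by rewrite big_ord_recr /= ih exprS; field.
by rewrite (le_trans (ler_wpM2l _ h)) ?divr_ge0// divfK.
Qed.

(** The lacunary partial sums converge almost everywhere to an integrable
    function, and their integrals against a continuous g pass to the limit. In
    the applications these integrals are eventually constant. *)
Lemma fourier_integrable : exists eta : R -> C, cintegrable D eta /\
  forall (g : R -> C) c N, ccont g ->
    (forall n, (N <= n)%N -> ci (fun t => g t * S n t) = c) -> ci (fun t => g t * eta t) = c.
Proof.
have cS n : ccont (S n) by exact: trig_ccont.
have cRe m n : continuous (fun t => Re (S m t - S n t)).
  have [h _] := ccontD (cS m) (ccontM (ccont_cst (-1)) (cS n)).
  by move=> t; have := h t; under eq_fun do rewrite mulN1r.
have cIm m n : continuous (fun t => Im (S m t - S n t)).
  have [_ h] := ccontD (cS m) (ccontM (ccont_cst (-1)) (cS n)).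
  by move=> t; have := h t; under eq_fun do rewrite mulN1r.
have bRe := block_lacunary (fun z => normRe_le z) cRe.
have bIm := block_lacunary (fun z => normIm_le z) cIm.
have [|h1 [ih1 l1]] := @L1_limit R (fun j t => Re (S (4 ^ j) t)) (2 * pi + 4 * pi * B ^+ 2) (fun j => (cS _).1).
  by move=> n; apply: le_trans (bRe n); apply: ler_sum => j _; under eq_Rintegral do rewrite -raddfB.
have [|h2 [ih2 l2]] := @L1_limit R (fun j t => Im (S (4 ^ j) t)) (2 * pi + 4 * pi * B ^+ 2) (fun j => (cS _).2).
  by move=> n; apply: le_trans (bIm n); apply: ler_sum => j _; under eq_Rintegral do rewrite -raddfB.
exists (fun t => h1 t +i* h2 t); split; first by split.
move=> g c N [g1 g2] hc.
have hc' : \forall j \near \oo, ci (fun t => g t * S (4 ^ j) t) = c.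
  exists N => // j /= Nj; apply: hc; apply: (leq_trans Nj).
  by apply/ltnW/ltn_expl.
have iS j : mu.-integrable D (EFin \o (fun t => Re (S (4 ^ j) t))) by apply: rint_cont; exact: (cS _).1.
have iS' j : mu.-integrable D (EFin \o (fun t => Im (S (4 ^ j) t))) by apply: rint_cont; exact: (cS _).2.
have lR := cvgB (l1 _ g1) (l2 _ g2) (FF := eventually_filter); have lI := cvgD (l2 _ g1) (l1 _ g2) (FF := eventually_filter).
have eR : Re (ci (fun t => g t * (h1 t +i* h2 t))) =
    Rintegral mu D (fun t => Re (g t) * h1 t) - Rintegral mu D (fun t => Im (g t) * h2 t).
  rewrite -RintegralB//; try exact: rint_mul.
  by rewrite /cintegral /=; apply: eq_Rintegral => t _; rewrite ReM.
have eI : Im (ci (fun t => g t * (h1 t +i* h2 t))) =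
    Rintegral mu D (fun t => Re (g t) * h2 t) + Rintegral mu D (fun t => Im (g t) * h1 t).
  rewrite -RintegralD//; try exact: rint_mul.
  by rewrite /cintegral /=; apply: eq_Rintegral => t _; rewrite ImM.
apply/eqP; rewrite eq_complex eR eI; apply/andP; split; apply/eqP.
  rewrite -(cvg_lim (@Rhausdorff R) lR); apply: cvg_lim => //; apply: cvg_near_cst; apply: filterS hc' => j <-.
  rewrite -[LHS]RintegralB//; try exact: rint_mul.
  by rewrite /cintegral /=; apply: eq_Rintegral => t _; rewrite ReM.
rewrite -(cvg_lim (@Rhausdorff R) lI); apply: cvg_lim => //; apply: cvg_near_cst; apply: filterS hc' => j <-.
rewrite -[LHS]RintegralD//; try exact: rint_mul.
by rewrite /cintegral /=; apply: eq_Rintegral => t _; rewrite ImM.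
Qed.

End series.

(** Divide by the derivative factor i k: the coefficients then decrease like
    1/|k| and define an integrable function. The signs of the indices are
    reversed because the integral of z^k against z^l is nonzero only for l =
    -k. *)
Lemma exists_density (a : int -> C) (A : R) : 0 <= A -> a (Posz 0) = 0 ->
  (forall k, nrm (a k) <= A) ->
  exists eta : R -> C, cintegrable D eta /\
    forall k, ci (fun t => imul k * zp (expi t) k * eta t) = a k.
Proof.
move=> A0 a0 hA; pose b k := a (- k) / ((2 * pi)%:C * imul (- k)).
have p2 := @twopi_gt0 R.
have hb k : k != 0 -> nrm (b k) <= A / (2 * pi) / `|k|%:R.
  move=> k0; rewrite nrmM nrmV nrmM nrm_imul nrm_ger0 ?(ltW p2)//.
  have -> : `|(- k)%:~R| = (`|k|%N)%:R :> R by rewrite rmorphN normrN -intr_norm -abszE.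
  have k1 : (0 : R) < `|k|%N%:R by rewrite ltr0n absz_gt0.
  by rewrite invfM mulrA ler_wpM2r ?invr_ge0 ?(ltW k1)// ler_wpM2r ?invr_ge0 ?(ltW p2).
have [eta [ie he]] := fourier_integrable (divr_ge0 A0 (ltW p2)) hb.
exists eta; split=> // k.
apply: (he _ _ `|k|%N); first by apply: ccontM; [exact: ccont_cst|exact: zp_ccont].
move=> n kn; rewrite (@ci_ext _ _ (fun t => imul k * (zp (expi t) k * dsum n (fun k => b k * zp (expi t) k)))); last first.
  by move=> t _; rewrite mulrA.
rewrite ciZ; last by apply/cint_cont/ccontM; [exact: zp_ccont|exact: trig_ccont].
rewrite ci_zp_trig kn /b !opprK; have [->|k0] := eqVneq k 0.
  by rewrite (a0 : a 0 = 0) mul0r ?mulr0.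
have p2' : (2 * pi)%:C != 0 :> C by rewrite eq_complex /= gt_eqF.
have := @imul_eq0 R k k0; move: (imul k) (a k) p2' => x y p0 x0.
by rewrite mulrA mulrCA (mulrC x) mulfV ?mulr1// mulf_neq0.
Qed.

End FourierSeries.

(** * Uniqueness from Fourier coefficients *)

Section Uniqueness.
Context {R : realType}.
Local Notation C := R[i].
Local Notation mu := (@lebesgue_measure R).
Local Notation D := (`[0, 2 * pi]%classic : set R).
Local Notation ci := (cintegral D).
Local Notation Re := complex.Re.
Local Notation Im := complex.Im.

Lemma cos_le_abs (y z : R) : `|y| <= z -> z <= pi -> cos z <= cos y.
Proof.
move=> yz zp; have -> : cos y = cos `|y| by case: (ger0P y) => // _; rewrite cosN.
have [->//|ne] := eqVneq `|y| z.
by apply/ltW; rewrite ltr_cos ?in_itv /= ?normr_ge0 ?(le_trans _ yz) ?zp ?(le_trans yz zp)// lt_neqAle ne.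
Qed.

Lemma cos_lt_far (y z : R) : 0 <= z -> z < y -> y < 2 * pi - z -> cos y < cos z.
Proof.
move=> z0 zy yz; have [yp|py] := leP y pi.
  by rewrite ltr_cos// in_itv /= ?z0 ?yp ?(ltW (le_lt_trans z0 zy))//; lra.
have -> : cos y = cos (2 * pi - y).
  by rewrite cosB mulr_natl cos2pi sin2pi mul1r mul0r addr0.
rewrite ltr_cos ?in_itv /=; by [lra|apply/andP; split; lra].
Qed.

(** A continuous function on the circle, equal to 1 on the arc of angles from
    0 to x, where cos (t - x/2) >= cos (x/2), and vanishing where cos (t -
    x/2) <= cos (x/2) - 1/n. For increasing n it decreases to the indicator of
    the arc. *)
Definition arc (x : R) (n : nat) (z : C) : R :=
  Num.min 1 (Num.max 0 (1 + n%:R * (Re (z * expi (- (x / 2))) - cos (x / 2)))).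

Lemma arc_expi x n t : arc x n (expi t) =
  Num.min 1 (Num.max 0 (1 + n%:R * (cos (t - x / 2) - cos (x / 2)))).
Proof. by rewrite /arc -expiD. Qed.

Lemma arc_bound x n z : 0 <= arc x n z <= 1.
Proof. by rewrite le_min ler01 le_max lexx ge_min lexx. Qed.

Lemma arc_cont x n : continuous (fun t => arc x n (expi t)).
Proof.
rewrite (_ : (fun t => _) = (cst 1) \min ((cst 0) \max (fun t => 1 + n%:R * (cos (t - x / 2) - cos (x / 2))))).
  have c1 : continuous (fun t : R => 1 + n%:R * (cos (t - x / 2) - cos (x / 2))).
    move=> t; apply: cvgD; first exact: cvg_cst.
    apply: cvgM; first exact: cvg_cst.
    apply: cvgB; last exact: cvg_cst.
    apply: (@continuous_comp _ _ _ (fun t => t - x / 2) cos); last exact: continuous_cos.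
    by apply: cvgB; [exact: cvg_id|exact: cvg_cst].
  apply: min_fun_continuous; first exact: cst_continuous.
  by apply: max_fun_continuous => //; exact: cst_continuous.
by apply/funext => t; rewrite arc_expi.
Qed.

Lemma arc_ucont x n : ucont (fun z => (arc x n z)%:C).
Proof. by apply: ccont_ucont; split; [exact: arc_cont|exact: cst_continuous]. Qed.

Lemma arc_in x n t : 0 < x -> x < 2 * pi -> 0 <= t -> t <= x -> arc x n (expi t) = 1.
Proof.
move=> x0 x1 t0 tx; rewrite arc_expi; apply/min_idPl; rewrite le_max; apply/orP; right.
rewrite lerDl mulr_ge0// subr_ge0 cos_le_abs//; last lra.
by rewrite ler_norml; apply/andP; split; lra.
Qed.

Lemma arc_out x t : 0 < x -> x < 2 * pi -> x < t -> t < 2 * pi ->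
  exists N, forall n, (N <= n)%N -> arc x n (expi t) = 0.
Proof.
move=> x0 x1 xt t1; have dd : 0 < cos (x / 2) - cos (t - x / 2).
  by rewrite subr_gt0; apply: cos_lt_far; lra.
exists (Num.truncn ((cos (x / 2) - cos (t - x / 2))^-1)).+1 => n Nn.
rewrite arc_expi; have h : 1 + n%:R * (cos (t - x / 2) - cos (x / 2)) <= 0.
  rewrite -[cos (t - _) - _]opprB mulrN subr_le0 -ler_pdivrMr// mul1r.
  by rewrite (le_trans (ltW (truncnS_gt _)))// ler_nat.
by rewrite (max_idPl h) min_r.
Qed.

Lemma negligible_point (a : R) : mu.-negligible [set a].
Proof. by exists [set a]; split=> //; exact: lebesgue_measure_set1. Qed.

Lemma cont_measurable (w : R -> R) : continuous w -> measurable_fun D w.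
Proof. by move=> cw; apply/measurable_funTS; exact: measurable_realfun.continuous_measurable_fun. Qed.

Section real.
Context (u : R -> R) (iu : mu.-integrable D (EFin \o u)).
Context (hu : forall phi : C -> R, ucont (fun z => (phi z)%:C) ->
  Rintegral mu D (fun t => phi (expi t) * u t) = 0).

(** Dominated convergence for the functions [arc x n] as n tends to infinity.
    *)
Lemma arc_integral0 (x : R) : 0 < x -> x < 2 * pi ->
  (\int[mu]_(t in D) ((EFin \o u) \_ (`[0%R, x]%classic : set R)) t = 0)%E.
Proof.
move=> x0 x1; have mE : measurable_fun D (EFin \o u) by case/integrableP: iu.
have mu_ : measurable_fun D u by apply/measurable_EFinP; case/integrableP: iu.
have mg n : measurable_fun D (fun t : R => arc x n (expi t)).
  by apply: cont_measurable; exact: arc_cont.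
(* At the endpoint 2 pi the approximate indicators do not tend to 0, being
   equal to 1 at the point 1 of the circle. *)
have ae : \forall t \ae mu, t != 2 * pi.
  by apply: negligibleS (negligible_point (2 * pi)) => t /= /negP; rewrite negbK => /eqP.
have [|||||_ _ h] := @dominated_convergence _ _ _ mu D (measurable_itv _)
    (fun n t => (arc x n (expi t) * u t)%:E) ((EFin \o u) \_ (`[0%R, x]%classic : set R)) (fun t => `|(u t)%:E|%E).
- move=> n; apply/measurable_EFinP; apply: measurable_funM => //.
  exact: mg.
- apply/measurable_restrict => //.
  by apply: measurable_funS mE; [exact: measurable_itv|exact: subIsetl].
- apply: ae_imp ae => t t2 Dt; move: (Dt); rewrite /= in_itv /= => /andP[t0 t1].
  rewrite patchE; case: ifPn; rewrite ?inE /= ?notin_setE /= in_itv /= t0 /=.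
    move=> tx; apply: cvg_near_cst; apply: nearW => n.
    by rewrite arc_in// mul1r.
  move=> /negP; rewrite -ltNge => xt; have tp : t < 2 * pi by rewrite lt_neqAle t2.
  have [N hN] := arc_out x0 x1 xt tp.
  by apply: cvg_near_cst; exists N => // n /= Nn; rewrite hN ?mul0r.
- exact: integrable_abse.
- apply: aeW => t n _; rewrite abse_EFin normrM lee_fin ler_piMl//.
  by have /andP[a0 a1] := arc_bound x n (expi t); rewrite ger0_norm.
have h0 n : (\int[mu]_(t in D) (arc x n (expi t) * u t)%:E = 0)%E.
  have := hu (arc_ucont x n); rewrite /Rintegral => e.
  rewrite -[LHS]fineK ?e//; apply: integrable_fin_num => //.
  exact: (rint_mul (@arc_cont x n) iu).
have := cvg_lim _ h; rewrite (_ : (fun n => _) = cst 0%E); last by apply/funext => n; rewrite h0.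
by rewrite lim_cst// => <-.
Qed.

(** The integrals over the intervals from 0 to x all vanish, and by Lebesgue's
    differentiation theorem u is almost everywhere the derivative of such
    integrals. *)
Lemma real_ae0 : \forall t \ae mu, D t -> u t = 0.
Proof.
pose f := u \_ D.
have fE : EFin \o f = (EFin \o u) \_ D by rewrite restrict_EFin.
have iT : mu.-integrable setT (EFin \o f) by rewrite fE -integrable_mkcond.
have int y : mu.-integrable [set` Interval (BLeft 0) (BRight y)] (EFin \o f).
  by apply: (integrableS _ _ _ iT).
have lf : locally_integrable setT f by exact: integrable_locally.
have hF := FTC1 int lf.
have F0 (x : R) : 0 < x -> x < 2 * pi ->
    Rintegral mu [set` Interval (BLeft 0) (BRight x)] f = 0.
  move=> x0 x1; rewrite /Rintegral.
  have := arc_integral0 x0 x1; rewrite -integral_mkcondr setIC.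
  move=> h; transitivity (fine (\int[mu]_(t in [set` Interval (BLeft 0%R) (BRight x)]) (EFin \o f) t)%E); first by [].
  by rewrite fE -integral_mkcondr h.
apply: negligibleS (negligibleU hF (negligibleU (negligible_point 0) (negligible_point (2 * pi)))) => t /= nt.
have [->|t0] := eqVneq t 0; first by right; left.
have [->|t2] := eqVneq t (2 * pi); first by right; right.
left => hh; apply: nt => Dt; move: (Dt); rewrite /= in_itv /= => /andP[t0' t2'].
have tp : 0 < t by rewrite lt_neqAle eq_sym t0.
have tq : t < 2 * pi by rewrite lt_neqAle t2.
have hx : (0%:E < t%:E)%E by rewrite lte_fin.
have [_ ] := hh hx.
rewrite {2}/f patchE mem_set// => <-.
rewrite derive1E (near_eq_derive (g := cst 0)) ?derive_cst ?oner_neq0//.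
have : \forall y \near t, y \in `]0, (2 * pi)[ by apply: near_in_itvoo; rewrite in_itv /= tp.
by apply: filterS => y; rewrite in_itv /= => /andP[y0 y1]; rewrite F0.
Qed.

End real.

Lemma ci_real_mul (phi : R -> R) (h : R -> C) :
  ci (fun t => (phi t)%:C * h t) = Rintegral mu D (fun t => phi t * Re (h t)) +i*
     Rintegral mu D (fun t => phi t * Im (h t)).
Proof.
rewrite /cintegral; congr (_ +i* _).
  by apply: eq_Rintegral => t _; rewrite ReM /= mul0r subr0.
by apply: eq_Rintegral => t _; rewrite ImM /= mul0r addr0.
Qed.

(** After subtraction of the mean all Fourier coefficients vanish; by density
    the function is orthogonal to every continuous function on the circle, in
    particular to approximate indicators of arcs. *)
Lemma fourier_const (h : R -> C) : cintegrable D h ->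
  (forall k, k != 0 -> ci (fun t => zp (expi t) k * h t) = 0) ->
  exists c, \forall t \ae mu, D t -> h t = c.
Proof.
move=> ih h0; have p2 : (2 * pi)%:C != 0 :> C by rewrite eq_complex /= gt_eqF ?twopi_gt0.
pose c := ci h / (2 * pi)%:C; exists c.
pose g t := h t - c.
have ig : cintegrable D g.
  have := cintD ih (cint_cont (ccont_cst (- c))); exact.
have izg f : ucont f -> cintegrable D (fun t => f (expi t) * g t).
  by move=> uf; apply: cint_mul => //; exact: (ucont_ccont uf).
have L0 f : ucont f -> ci (fun t => f (expi t) * g t) = 0.
  move: f; apply: (@functional_ext _ (fun f => ci (fun t => f (expi t) * g t)) (2 * (Rintegral mu D (fun t => `|Re (g t)| + `|Im (g t)|)))).
  - by rewrite mulr_ge0// Rintegral_ge0// => t _; rewrite addr_ge0.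
  - move=> k; rewrite (@ci_ext _ _ (fun t => (- c) * zp (expi t) k + zp (expi t) k * h t)); last first.
      by move=> t _; rewrite /g mulrBr addrC mulNr (mulrC c).
    have iz : cintegrable D (fun t => zp (expi t) k * h t) by apply: cint_mul => //; exact: zp_ccont.
    rewrite ci_lin//; last exact/cint_cont/zp_ccont.
    rewrite ci_zp; have [->|k0] := eqVneq k 0; last by rewrite mulr0 add0r h0.
    rewrite (@ci_ext _ _ h); last by move=> t _; rewrite /= expr0 mul1r.
    by rewrite mulNr /c divfK// addNr.
  - move=> a f f' uf uf'; rewrite -ci_lin; [|exact: izg|exact: izg].
    by apply: ci_ext => t _; rewrite mulrDl mulrA.
  - move=> f B uf B0 hB; apply: (ci_bound (g := fun t => f (expi t))) => //.
      exact: (ucont_ccont uf).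
    by move=> t; rewrite hB ?nrm_expi.
have real0 (phi : C -> R) : ucont (fun z => (phi z)%:C) ->
    Rintegral mu D (fun t => phi (expi t) * Re (g t)) = 0 /\
    Rintegral mu D (fun t => phi (expi t) * Im (g t)) = 0.
  by move=> /L0; rewrite ci_real_mul => -[-> ->].
case: (ig) => i1 i2.
have a1 := real_ae0 i1 (fun phi hphi => proj1 (real0 phi hphi)).
have a2 := real_ae0 i2 (fun phi hphi => proj2 (real0 phi hphi)).
apply: negligibleS (negligibleU a1 a2) => t /= nt.
apply: contrapT => /not_orP[/contrapT h1 /contrapT h2]; apply: nt => Dt.
apply/eqP; rewrite -subr_eq0 eq_complex; apply/andP; split; apply/eqP.
  exact: h1.
exact: h2.
Qed.

End Uniqueness.

(** * The trace formula for continuously differentiable functions *)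

Section TraceFormulaC1.
Context {R : realType} {H : hilbertType R}.
Local Notation C := R[i].
Local Notation mu := (@lebesgue_measure R).
Local Notation D := (`[0, 2 * pi]%classic : set R).
Local Notation ci := (cintegral D).
Local Notation Re := complex.Re.
Local Notation Im := complex.Im.
Context (T0 T1 : H -> H) (h0 : opb T0 1) (h1 : opb T1 1).
Context (r d : R) (r0 : 0 <= r) (r1 : r < 1) (hd : hs (fun x => T1 x - T0 x) d).
Context (strict : opb T0 r \/ opb T1 r).
Context (X : H -> H) (s : R^nat) (e f : nat -> H).
Context (sve : singular_value_expansion X s e f).
Context (S : R) (hS : forall n, \sum_(0 <= k < n) s k ^+ 2 <= S).

Let K := d / (1 - r).
Let tr F := trace (cdiff T0 T1 F \o X).

Let cdhs F L : alip F L -> hs (cdiff T0 T1 F) (4 * (L / cos 1) * K).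
Proof. by move=> FL; exact: (cdiff_hs h0 h1 r0 r1 hd strict FL). Qed.

(** Continuity of f |-> Tr ((f(T1) - f(T0)) X) for the Lipschitz constant of
    f. *)
Lemma tr_bound F L : alip F L -> nrm (tr F) <= Num.sqrt S * (4 * (L / cos 1) * K).
Proof. by move=> FL; exact: (trace_bound sve hS (cdhs FL)). Qed.

Lemma tr_lin a F G L L' : alip F L -> alip G L' ->
  tr (fun z => a * F z + G z) = a * tr F + tr G.
Proof.
move=> FL GL; rewrite /tr -(trace_lin sve hS a (cdhs FL) (cdhs GL)).
by congr (trace (_ \o X)); apply/funext => x; rewrite (cdiff_lin h0 h1)//; exact: alip_ucont; eauto.
Qed.

Let cdiff_zpE k : cdiff T0 T1 (zp ^~ k) = fun x => zpower T1 k x - zpower T0 k x.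
Proof. by apply/funext => x; rewrite (cdiff_zp h0 h1). Qed.

(** The traces for the monomials z^k are bounded, uniformly in k, because one
    of the contractions is strict, and the one for k = 0 vanishes. *)
Lemma exists_trace_density : exists eta : R -> C, cintegrable D eta /\
  forall k, ci (fun t => imul k * zp (expi t) k * eta t) = tr (zp ^~ k).
Proof.
have [_ d0 _] := hd.
apply: (@exists_density _ _ (Num.sqrt S * K)).
- by rewrite mulr_ge0 ?sqrtr_ge0// divr_ge0// subr_ge0 ltW.
- apply: nrm_eq0; apply/eqP; rewrite eq_le nrm_ge0 andbT /tr cdiff_zpE /=.
  rewrite (_ : (fun x => x - x) = fun=> 0 : H); last by apply/funext => x; rewrite subrr.
  by rewrite (le_trans (trace_bound sve hS (hs0 H H)))// mulr0.
- move=> k; rewrite /tr cdiff_zpE; apply: (trace_bound sve hS).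
  exact: (zpower_diff_hs h0 h1 r0 r1 hd strict).
Qed.

Context (eta : R -> C) (ieta : cintegrable D eta).
Context (heta : forall k, ci (fun t => imul k * zp (expi t) k * eta t) = tr (zp ^~ k)).

Let J (df : C -> C) := ci (fun t => df (expi t) * eta t).

(** The derivative with respect to the angle, read as a function on the
    circle, so that it can be approximated by trigonometric polynomials. *)
Definition angle_derivative (F df : C -> C) :=
  (forall t, cisd (F \o expi) t (df (expi t))) /\ ucont df.

Lemma angle_derivative_alip F df B : angle_derivative F df ->
  (forall z, nrm z = 1 -> nrm (df z) <= B) -> alip F (2 * B).
Proof.
move=> [dF _] hB; apply: (cisd_lip (g := F \o expi) dF) => t.
by apply: hB; exact: nrm_expi.
Qed.

Lemma angle_derivative_lin a F G dF dG : angle_derivative F dF -> angle_derivative G dG ->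
  angle_derivative (fun z => a * F z + G z) (fun z => a * dF z + dG z).
Proof.
move=> [F1 F2] [G1 G2]; split; last exact: ucont_lin.
by move=> t; exact: (cisd_lin a (F1 t) (G1 t)).
Qed.

Let integrable_J df : ucont df -> cintegrable D (fun t => df (expi t) * eta t).
Proof. by move=> uf; apply: cint_mul => //; exact: (ucont_ccont uf). Qed.

Lemma J_lin a dF dG : ucont dF -> ucont dG ->
  J (fun z => a * dF z + dG z) = a * J dF + J dG.
Proof.
move=> uF uG; rewrite /J -ci_lin; [|exact: integrable_J|exact: integrable_J].
by apply: ci_ext => t _; rewrite mulrDl mulrA.
Qed.

Let ok F dF := angle_derivative F dF /\ tr F = J dF.

Let ok_lin a F G dF dG : ok F dF -> ok G dG ->
  ok (fun z => a * F z + G z) (fun z => a * dF z + dG z).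
Proof.
move=> [F1 F2] [G1 G2]; split; first exact: angle_derivative_lin.
have [_ uF] := F1; have [_ uG] := G1.
have [A A0 hA] := ucont_bounded uF; have [B B0 hB] := ucont_bounded uG.
rewrite (tr_lin a (angle_derivative_alip F1 hA) (angle_derivative_alip G1 hB)).
by rewrite J_lin// F2 G2.
Qed.

Let ok_zp k : ok (zp ^~ k) (fun z => imul k * zp z k).
Proof.
split; last by rewrite -heta.
split; first by move=> t; exact: cisd_zp.
by apply: ucontM; [exact: ucont_cst|exact: ucont_zp].
Qed.

Let ok_trig m (c : int -> C) :
  ok (fun z => dsum m (fun k => c k * zp z k)) (fun z => dsum m (fun k => c k * imul k * zp z k)).
Proof.
have ok0 : ok (fun=> 0) (fun=> 0).
  have := ok_lin (-1) (ok_zp 0) (ok_zp 0).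
  rewrite (_ : (fun z => -1 * zp z 0 + zp z 0) = fun=> 0); last first.
    by apply/funext => z; rewrite mulN1r addNr.
  rewrite (_ : (fun z => -1 * _ + _) = fun=> 0)//.
  by apply/funext => z; rewrite mulN1r addNr.
elim: m => [|m ih].
  have := ok_lin (c 0) (ok_zp 0) ok0.
  congr ok; apply/funext => z; rewrite /dsum big_ord0//.
  by rewrite mulrA.
have := ok_lin (c (Posz m.+1)) (ok_zp (Posz m.+1)) (ok_lin (c (Negz m)) (ok_zp (Negz m)) ih).
by congr ok; apply/funext => z; rewrite dsumS ?mulrA; ring.
Qed.

Lemma derive1_expi_shift (u : C -> R) (a b : R) : expi a = expi b ->
  derive1 (u \o expi) a = derive1 (u \o expi) b.
Proof.
move=> ab; rewrite /derive1; apply: (congr1 (fun g => lim (g @ 0^'))); apply/funext => t /=.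
by rewrite !expiD ab.
Qed.

(** The derivative depends on the angle only through the point of the circle,
    since a translation by a period of [expi] does not change the function. *)
Lemma C1_angle_derivative F : C1_circle F -> exists dF, angle_derivative F dF /\
  forall t, cderive (F \o expi) t = dF (expi t).
Proof.
move=> [dF c1 c2]; pose arg (z : C) : R := xget 0 [set t | z = expi t].
have argP t : expi (arg (expi t)) = expi t.
  by have := @xgetPex _ 0 [set a | expi t = expi a] (ex_intro _ t erefl) => /= <-.
pose G z := cderive (F \o expi) (arg z).
have GE t : cderive (F \o expi) t = G (expi t).
  rewrite /G /cderive; congr (_ +i* _).
    by apply: (derive1_expi_shift (fun z => Re (F z))); rewrite argP.
  by apply: (derive1_expi_shift (fun z => Im (F z))); rewrite argP.
exists G; split=> //; split.
  by move=> t; rewrite -GE; exact: cderivable_cisd.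
apply: ccont_ucont; rewrite (_ : G \o expi = cderive (F \o expi)); first by split.
by apply/funext => t; rewrite GE.
Qed.

(** Integral of the derivative of a periodic function. *)
Lemma angle_derivative_mean F dF : angle_derivative F dF -> ci (fun t => dF (expi t)) = 0.
Proof.
move=> [dd uf]; rewrite (ci_FTC dd); last exact: (ucont_ccont uf).
by rewrite /= expi_2pi expi0 subrr.
Qed.

(** Both sides are linear in F, agree on trigonometric polynomials, and are
    bounded by the sup norm of the derivative. So it suffices to approximate
    the derivative uniformly by derivatives of trigonometric polynomials, that
    is, by those of mean zero; the mean of an approximant is small because dF
    itself has mean zero. *)
Lemma trace_angle_derivative F dF : angle_derivative F dF -> tr F = J dF.
Proof.
move=> FdF; have [dd uf] := FdF.
pose I := Rintegral mu D (fun t => `|Re (eta t)| + `|Im (eta t)|).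
pose c := Num.sqrt S * (4 * (2 * 3 / cos 1) * K) + 2 * I * 3.
have key (eps : R) : 0 < eps -> nrm (tr F - J dF) <= c * eps.
  move=> e0; have [m [b hb]] := trig_approx uf e0.
  pose q z := dsum m (fun k => b k * zp z k).
  have uq : ucont q by exact: ucont_dsum.
  have p2 : 0 < 2 * pi :> R by exact: twopi_gt0.
  (* The mean of q is that of q - dF; the factor 2 comes from [ci_bound]. *)
  have b0 : nrm (b 0) <= 2 * eps.
    have := ci_zp_trig m b 0; rewrite leq0n oppr0 => hq.
    have hq' : ci (fun t => (q (expi t) - dF (expi t)) * 1) = (2 * pi)%:C * b 0.
      rewrite -hq -[RHS]subr0 -(angle_derivative_mean FdF) -ciB.
      - by apply: ci_ext => t _; rewrite mulr1 [zp _ 0]/= expr0 mul1r.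
      - by apply/cint_cont/ccontM; [exact: zp_ccont|exact: trig_ccont].
      - exact/cint_cont/(ucont_ccont uf).
    have uqd : ccont (fun t => q (expi t) - dF (expi t)).
      have := ucont_ccont (ucont_lin (-1) uf uq).
      by rewrite /comp; under eq_fun do rewrite mulN1r addrC.
    have := ci_bound uqd (cint_cont (ccont_cst 1)) (ltW e0).
    rewrite hq' nrmM nrm_ger0 ?(ltW p2)// => /(_ _)/=.
    rewrite normr1 normr0 addr0 => h.
    have : 2 * pi * nrm (b 0) <= 2 * (2 * pi) * eps.
      have i1 : 2 * pi = Rintegral mu D (fun=> 1 : R).
        by apply: (@complexI R); rewrite -ci_re ci_cst mulr1.
      by rewrite [in leRHS]i1; apply: h => t; rewrite nrmB hb// nrm_expi.
    have -> : 2 * (2 * pi) * eps = 2 * pi * (2 * eps) by move: (pi : R) => x; ring.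
    by rewrite ler_pM2l.
  pose a k := b k / imul k.
  have [okp tp] := ok_trig m a.
  set p := fun z => dsum m (fun k => a k * zp z k) in okp tp.
  set dp := fun z => dsum m (fun k => a k * imul k * zp z k) in okp tp.
  have udp : ucont dp by case: okp.
  have dpE z : dp z = q z - b 0.
    rewrite /dp /q -[b 0]mulr1 -(expr0 z) /dsum /a.
    rewrite (_ : imul 0 = 0) ?mulr0 ?mul0r ?add0r; last first.
      by [].
    rewrite addrAC subrr add0r; apply: eq_bigr => k _.
    by rewrite !divfK// imul_eq0.
  have fdp : angle_derivative (fun z => -1 * p z + F z) (fun z => -1 * dp z + dF z).
    exact: angle_derivative_lin.
  (* The derivative of the remainder F - p: eps from the approximation and 2
     eps from the removed mean. *)
  have bd z : nrm z = 1 -> nrm (-1 * dp z + dF z) <= 3 * eps.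
    move=> hz; rewrite dpE mulN1r opprB addrAC -addrA.
    rewrite (_ : 3 * eps = 2 * eps + eps); last by ring.
    rewrite [b 0 + _]addrC (le_trans (nrmD _ _))//.
    by rewrite [leLHS]addrC (lerD b0 (hb z hz)).
  have trp : tr (fun z => -1 * p z + F z) = tr F - J dp.
    have [A A0 hA] := ucont_bounded udp; have [B B0 hB] := ucont_bounded uf.
    rewrite (tr_lin (-1) (angle_derivative_alip okp hA) (angle_derivative_alip FdF hB)).
    by rewrite tp mulN1r addrC.
  have jp : J (fun z => -1 * dp z + dF z) = J dF - J dp.
    by rewrite J_lin// mulN1r addrC.
  have -> : tr F - J dF = tr (fun z => -1 * p z + F z) - J (fun z => -1 * dp z + dF z).
    by rewrite trp jp opprB addrA subrK.
  rewrite (le_trans (nrmD _ _))// nrmN /c mulrDl lerD//.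
    apply: (le_trans (tr_bound (angle_derivative_alip fdp bd))).
    by rewrite le_eqVlt; apply/orP; left; apply/eqP; rewrite /K; ring.
  have c3 : 0 <= 3 * eps by rewrite mulr_ge0// ltW.
  have := ci_bound (ucont_ccont (proj2 fdp)) ieta c3 => /(_ _); rewrite -/I mulrA; apply.
  by move=> t; apply: bd; exact: nrm_expi.
apply/eqP; rewrite -subr_eq0; apply/eqP/nrm_eq0/eqP; rewrite eq_le nrm_ge0 andbT.
have c0 : 0 < `|c| + 1 by rewrite ltr_wpDl.
suff key' (eps : R) : 0 < eps -> nrm (tr F - J dF) <= 0 + eps by exact/ler_addgt0Pr.
move=> e0; rewrite add0r; apply: (le_trans (key _ (divr_gt0 e0 c0))).
rewrite mulrA ler_pdivrMr// mulrC ler_pM2l//.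
by rewrite (le_trans (ler_norm _))// lerDl.
Qed.

End TraceFormulaC1.

(** * Schatten classes and the existence of the spectral shift density *)

(** In the form used for traces and Hilbert-Schmidt bounds: partial sums of
    squares instead of a convergent series of real powers. *)
Lemma schatten2_sqsum (R : realType) (H : hilbertType R) (X : H -> H) : schatten 2 X ->
  exists N s e f S, [/\ opb X N, singular_value_expansion X s e f &
    forall n, \sum_(0 <= k < n) s k ^+ 2 <= S].
Proof.
move=> [/bounded_linearP[N bX] [s [e [f [sve cv]]]]].
exists N, s, e, f, (limn (series (fun n => s n `^ 2))); split=> // n.
have [_ s0 _ _] := sve.
have -> : \sum_(0 <= k < n) s k ^+ 2 = series (fun n => s n `^ 2) n.
  by rewrite /series /=; apply: eq_bigr => k _; rewrite -powR_mulrn.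
apply: nondecreasing_cvgn_le cv n; apply/nondecreasing_seqP => m.
by rewrite /series /= big_nat_recr//= lerDl powR_ge0.
Qed.

Lemma contraction_opb (R : realType) (H : hilbertType R) (T : H -> H) :
  is_contraction_op T -> opb T 1.
Proof. by move=> [/opnorm_opb bT T1]; exact: opb_le bT. Qed.

(** Monomials are admissible in the trace formula, which is what uniqueness of
    the density rests on. *)
Lemma C1_zp (R : realType) k : C1_circle (@zp R ^~ k).
Proof.
have e : (fun t => cderive (zp ^~ k \o expi) t) = fun t : R => imul k * zp (expi t) k.
  by apply/funext => t; have [] := cisd_derive (cisd_zp k t).
have [c1 c2] := ccontM (ccont_cst (imul k)) (@zp_ccont R k).
split; first by move=> t; have [] := cisd_derive (cisd_zp k t).
  by under eq_fun do rewrite (congr1 (fun g => g _) e).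
by under eq_fun do rewrite (congr1 (fun g => g _) e).
Qed.

Local Close Scope complex_scope.
Unset Implicit Arguments.

Theorem corollary3p3 (R : realType) (H : hilbertType R) (T0 T1 : H -> H)
    (hT0 : is_contraction_op T0) (hT1 : is_contraction_op T1)
    (hstrict : is_strict_contraction_op T0 \/ is_strict_contraction_op T1)
    (hS2 : schatten 2 (T1 \- T0)) :
  (forall f : R[i] -> R[i], lipschitz_circle f ->
   forall X : H -> H, schatten 2 X ->
     schatten 1 ((contraction_calculus T1 f \- contraction_calculus T0 f) \o X))
  /\
  (forall X : H -> H, schatten 2 X ->
   exists eta : R -> R[i],
     [/\ cintegrable `[0, 2 * pi] eta,
         trace_formula T0 T1 X eta
       & forall eta' : R -> R[i],
           cintegrable `[0, 2 * pi] eta' -> trace_formula T0 T1 X eta' ->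
           exists c : R[i], {ae @lebesgue_measure R, forall t,
             t \in `[0, 2 * pi] -> eta' t = eta t + c}]).
Proof.
have b0 := contraction_opb hT0; have b1 := contraction_opb hT1.
have [Nd [sd [ed [fd [Sd [bd sved hSd]]]]]] := schatten2_sqsum hS2.
have hd : hs (fun x => T1 x - T0 x) (Num.sqrt Sd).
  exact: (sve_hs sved hSd (ex_intro _ Nd bd)).
have [r [r0 r1 strict]] : exists r : R, [/\ 0 <= r, r < 1 & opb T0 r \/ opb T1 r].
  case: hstrict => -[/opnorm_opb bT lt1]; have [_ n0 _] := bT.
    by exists (opnorm T0); split=> //; left.
  by exists (opnorm T1); split=> //; right.
split=> [f /lipschitz_alip[L fL] X hX|X hX].
  have [N [s [e [g [S [bX sve hS]]]]]] := schatten2_sqsum hX.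
  have := hs_comp_schatten1 (cdiff_hs b0 b1 r0 r1 hd strict fL) (sve_hs sve hS (ex_intro _ N bX)).
  exact.
have [N [s [e [g [S [bX sve hS]]]]]] := schatten2_sqsum hX.
have [eta [ieta heta]] := exists_trace_density b0 b1 r0 r1 hd strict sve hS.
have tf : trace_formula T0 T1 X eta.
  move=> f /C1_angle_derivative[df [fdf dfE]].
  have := trace_angle_derivative b0 b1 r0 r1 hd strict sve hS ieta heta fdf.
  by move=> e1; rewrite [LHS]e1; apply: ci_ext => t _; rewrite dfE.
exists eta; split=> // eta' ieta' tf'.
have tz (h : R -> R[i]) : trace_formula T0 T1 X h -> forall k,
    cintegral `[0, 2 * pi] (fun t => imul k * zp (expi t) k * h t) =
    trace (cdiff T0 T1 (zp ^~ k) \o X).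
  move=> /(_ _ (@C1_zp R _)) hz k; rewrite [RHS]hz; apply: ci_ext => t _.
  by have [_ ->] := cisd_derive (cisd_zp k t).
(* The two densities have the same coefficients except for the constant one.
   *)
have iB : cintegrable `[0, 2 * pi] (fun t => -1 * eta t + eta' t) by exact: cint_lin.
have [k k0|c hc] := fourier_const iB.
  have iz (h : R -> R[i]) : cintegrable `[0, 2 * pi] h ->
      cintegrable `[0, 2 * pi] (fun t => imul k * zp (expi t) k * h t).
    by move=> ih; apply: cint_mul => //; apply: ccontM; [exact: ccont_cst|exact: zp_ccont].
  apply: (mulfI (imul_eq0 k0)); rewrite mulr0 -ciZ; last first.
    by apply: cint_mul => //; exact: zp_ccont.
  have := ci_lin (-1) (iz _ ieta) (iz _ ieta'); rewrite (tz _ tf) (tz _ tf') mulN1r addNr => <-.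
  by apply: ci_ext => t _; ring.
exists c; apply: ae_imp hc => t h /h; rewrite mulN1r => <-.
by rewrite addrA subrr add0r.
Qed.
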